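(* Let $b\in\mathbb{R}$ be a constant and let $g:[0,\infty)\to[0,1]$ be a non-increasing function with $0<C:=\int_{\mathbb{R}^2}g(\|\boldsymbol{x}\|)\,d\boldsymbol{x}<\infty$ and $g(x)=o\left(\frac{1}{x^2\log^2 x}\right)$ as $x\to\infty$. Put $r_\rho=\sqrt{\frac{\log\rho+b}{C\rho}}$ and let $\mathcal{G}(\mathcal{X}_\rho,g_\rho)$ be the random connection network on the unit square with density $\rho$ in which two nodes at Euclidean distance $x$ are directly connected with probability $g(x/r_\rho)$. Then, as $\rho\to\infty$, the distribution of the number of isolated nodes in $\mathcal{G}(\mathcal{X}_\rho,g_\rho)$ converges to the Poisson distribution with mean $e^{-b}$.
   Context: The network $\mathcal{G}(\mathcal{X}_\rho,g_\rho)$: the nodes form a homogeneous Poisson point process $\mathcal{X}_\rho$ of density $\rho$ on the unit square $\left[-\frac12,\frac12\right)^2$. Given the node positions, each pair of nodes separated by Euclidean distance $x$ is directly connected (joined by an edge) with probability $g(x/r_\rho)$, independently of all other pairs. A node is isolated if it is not directly connected to any other node. $\|\cdot\|$ is the Euclidean norm. Throughout, $\rho$ is large enough that $\log\rho+b>0$. *)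

(* Defs.v *)
From HB Require Import structures.
From mathcomp Require Import all_boot all_order all_algebra.
From mathcomp Require Import all_classical all_reals all_analysis.

Set Implicit Arguments.
Unset Strict Implicit.
Unset Printing Implicit Defensive.

Import Order.TTheory GRing.Theory Num.Theory.
Import numFieldNormedType.Exports.

Local Open Scope classical_set_scope.
Local Open Scope ring_scope.

Notation plane R := (measurableTypeR R * measurableTypeR R)%type.

(* Required by the [=o_] notation, which expects a canonical [filter_on]. *)
Canonical pinfty_filterType (R : numFieldType) :=
  FilterType (pinfty_nbhs R) _.

(* The library norm on a product is the sup norm, hence an explicit one. *)
Definition eucl_norm (R : realType) (x : R * R) : R :=
  Num.sqrt (x.1 ^+ 2 + x.2 ^+ 2).

Definition unit_square (R : realType) : set (plane R) :=
  `[- 2^-1, 2^-1[ `*` `[- 2^-1, 2^-1[.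

Definition area (R : realType) : set (plane R) -> \bar R :=
  (@lebesgue_measure R \x @lebesgue_measure R)%E.

(* The nodes of a sample [w] are labelled by the [i < nodes w]; the values of
   [pos] and [edge] at other labels are irrelevant. *)
Record random_network d (T : measurableType d) (R : realType)
    (P : probability T R) := RandomNetwork {
  nodes : {RV P >-> nat} ;
  pos : nat -> {RV P >-> plane R} ;
  edge : nat -> nat -> {RV P >-> bool} ;
  edge_sym : forall i j w, edge i j w = edge j i w }.

Section network.
Context d (T : measurableType d) (R : realType) (P : probability T R).
Variable G : random_network P.

Definition node_count (A : set (plane R)) (w : T) : nat :=
  #|[pred i : 'I_(nodes G w) | pos G i w \in A]|.

Definition isolated (w : T) (i : 'I_(nodes G w)) : bool :=
  [forall j : 'I_(nodes G w), (j != i) ==> ~~ edge G i j w].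

Definition num_isolated (w : T) : nat :=
  #|[pred i : 'I_(nodes G w) | isolated i]|.

(* The second argument of [poisson_prob] is a dummy. *)
Record poisson_on_square (rho : R) : Prop := PoissonOnSquare {
  pos_in_square : forall w i, (i < nodes G w)%N -> unit_square (pos G i w) ;
  node_count_poisson : forall A, measurable A -> A `<=` @unit_square R ->
    forall U : set nat, P (node_count A @^-1` U) =
      poisson_prob (rho * fine (area A)) 0 U ;
  node_count_indep : forall m (A : 'I_m -> set (plane R)),
    (forall i, measurable (A i)) -> (forall i, A i `<=` @unit_square R) ->
    trivIset setT A -> forall U : 'I_m -> set nat,
    P (\bigcap_i (node_count (A i) @^-1` U i)) =
      (\prod_(i < m) P (node_count (A i) @^-1` U i))%E }.

Definition positions_in n (D : set (n.-tuple (plane R))) : set T :=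
  [set w | nodes G w = n /\ D [tuple pos G i w | i < n]].

(* Conditional independence of the edges given the node positions, with
   conditional probabilities [h (distance)]: the product rule holds for every
   finite set [H] of pairs, after integration over any event determined by the
   positions. *)
Definition connects_with (h : R -> R) : Prop :=
  forall n (D : set (n.-tuple (plane R))) (H : {set 'I_n * 'I_n}),
    measurable D -> (forall e, e \in H -> (e.1 < e.2)%N) ->
    P (positions_in D `&` [set w | forall e, e \in H -> edge G e.1 e.2 w]) =
    (\int[P]_(w in positions_in D)
      (\prod_(e in H) h (eucl_norm (pos G e.1 w - pos G e.2 w)))%:E)%E.

Lemma measurable_num_isolated : measurable_fun [set: T] num_isolated.
Proof.
move=> _ Y _; rewrite setTI.
pose isoc n (s : {ffun 'I_n * 'I_n -> bool}) :=
  #|[pred i : 'I_n | [forall j : 'I_n, (j != i) ==> ~~ s (i, j)]]|.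
have isocE w (s : {ffun 'I_(nodes G w) * 'I_(nodes G w) -> bool}) :
    (forall p : 'I_(nodes G w) * 'I_(nodes G w), edge G p.1 p.2 w = s p) ->
    num_isolated w = isoc _ s.
  move=> sE; apply: eq_card => i; rewrite !inE; apply: eq_forallb => j.
  by rewrite -sE.
have -> : num_isolated @^-1` Y =
    \bigcup_n \bigcup_(s in [set s | Y (isoc n s)])
      ((nodes G @^-1` [set n]) `&`
       \bigcap_(p in [set: 'I_n * 'I_n]) (edge G p.1 p.2 @^-1` [set s p])).
  apply/seteqP; split=> [w Yw | w [n _ [s /= Ys [/= nw sw]]]].
    pose s := [ffun p : 'I_(nodes G w) * 'I_(nodes G w) => edge G p.1 p.2 w].
    have sE (p : 'I_(nodes G w) * 'I_(nodes G w)) : edge G p.1 p.2 w = s p by rewrite ffunE.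
    exists (nodes G w) => //; exists s; first by rewrite /= -(isocE w s sE).
    by split=> // p _; exact: sE.
  by subst n; rewrite (isocE w s) // => p; exact: sw.
apply: bigcup_measurable => n _.
apply: fin_bigcup_measurable => [|s _]; first exact: finite_finset.
apply: measurableI; first exact: measurable_funPTI.
apply: fin_bigcap_measurable => [|p _]; first exact: finite_finset.
exact: measurable_funPTI.
Qed.

HB.instance Definition _ :=
  isMeasurableFun.Build _ _ _ _ num_isolated measurable_num_isolated.

End network.

Definition random_connection_network d (T : measurableType d) (R : realType)
    (P : probability T R) (rho : R) (h : R -> R) (G : random_network P) :=
  poisson_on_square G rho /\ connects_with G h.

Definition isolated_rv d (T : measurableType d) (R : realType)
  (P : probability T R) (G : random_network P) : {RV P >-> nat} :=
  num_isolated G.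

(* Weak convergence; as [nat] is discrete, every [f] is in fact continuous. *)
Definition cvg_in_law (R : realType) (I : Type) (F : set_system I)
    (mu_ : I -> probability nat R) (mu : probability nat R) : Prop :=
  forall f : nat -> R, continuous f -> bounded_fun f ->
    (\int[mu_ i]_n (f n)%:E)%E @[i --> F] --> (\int[mu]_n (f n)%:E)%E.

(* Main.v *)
(** The method of factorial moments. The [k]-th factorial moment of the number of
    isolated nodes in a region is the integral, over [k] points [u] of the region,
    of [rho ^ k] times the probability that the points of [u] are not linked to
    each other nor to a node of an independent Poisson process. By the Bonferroni
    inequalities it is enough to show that it tends to [expR (- b) ^ k].

    For the region of points far from the sides, let [x] be the leftmost of
    [k + 1] points, and [u] the others. Adding [x] to [u] multiplies the density by
    [rho] times the probability that [x] is isolated given that [u] is, which is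
    about [rho * expR (- C * rho * r ^ 2) = expR (- b)] if [x] is far from [u]. If
    [x] is at moderate distance from [u], the neighbourhoods overlap so little that
    this factor is at most about [rho ^ (1 / 4)]. If [x] is close to [u], a part of
    the neighbourhood of [x] on its left is not covered by those of [u], and the
    factor is still at most [rho ^ (1 - c)] for some [c > 0]. Such exceptional [x]
    fill an area of order [1 / rho], up to powers of [ln rho], and do not
    contribute in the limit.

    The expected number of isolated nodes near the sides vanishes: a point near a
    side keeps half of its neighbourhood, near a corner a quarter of it. Both
    there and in the interior the decay of [g] makes the mass of [g] beyond distance
    [s] a [o(1 / ln s)], so that the truncation of the neighbourhoods by the square
    changes [rho] times their mass by [o(1)] only. *)
Require Import Defs.
From HB Require Import structures.
From mathcomp Require Import all_boot all_order all_algebra.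
From mathcomp Require Import all_classical all_reals all_analysis.
From mathcomp Require Import measurable_realfun.
From mathcomp Require Import ring lra.

Import Order.TTheory GRing.Theory Num.Theory.
Import numFieldNormedType.Exports.

Local Open Scope classical_set_scope.
Local Open Scope ring_scope.

Set Implicit Arguments.
Unset Strict Implicit.
Unset Printing Implicit Defensive.

(** * Splittings of a sequence *)

(** The hypotheses give the law of the counts in regions, while the labelling of the nodes may
    depend on their positions in an arbitrary way. So only symmetric functions of the positions have
    a known law, and random quantities are first written as sums over the splittings of the labels
    into chosen nodes and the others.

    The obstacle in the upper bound is a profile equal to [1] near the origin. If a few points of
    [u] surround [x] without being linked to it, they can cover its whole neighbourhood; [rho] times
    the rate is then of order [rho], on an area of order [ln rho / rho], which does not vanish.
    Since nothing of [u] lies to the left of the leftmost point, that point cannot be surrounded.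

    The decay of [g] enters twice. At distance [L * r], with [L = ln rho + b], the overlap of two
    neighbourhoods is multiplied by [rho * r ^+ 2 * C = L], and [L * g (L / 2)] tends to 0. The tail
    mass, summed over dyadic annuli, is used at the distance [expR (L / 20)], whose logarithm is
    still of order [L]. *)

Section star.
Context (X V : Type) (op : V -> V -> V).

(* Sum of [H u v] over the [2 ^ size s] splittings of [s] into two subsequences. *)
Fixpoint star (H : seq X -> seq X -> V) (s : seq X) : V :=
  if s is x :: s' then
    op (star (fun u v => H (x :: u) v) s') (star (fun u v => H u (x :: v)) s')
  else H [::] [::].

Lemma eq_star H H' s : (forall u v, H u v = H' u v) -> star H s = star H' s.
Proof.
by elim: s H H' => [|x s IH] H H' e /=; rewrite ?e// (IH _ (fun u v => H' (x :: u) v))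
  ?(IH (fun u v => H u (x :: v)) (fun u v => H' u (x :: v))).
Qed.

Lemma star_cat H s t :
  star H (s ++ t) =
  star (fun u v => star (fun u' v' => H (u ++ u') (v ++ v')) t) s.
Proof.
elim: s H => [|x s IH] H /=; first exact: eq_star.
by congr op; rewrite IH.
Qed.

End star.

Lemma star_map X Y V (op : V -> V -> V) (f : X -> Y) H s :
  star op H (map f s) = star op (fun u v => H (map f u) (map f v)) s.
Proof. by elim: s H => [|x s IH] H //=; congr op; rewrite IH. Qed.

Lemma eq_star_perm (X : eqType) V (op : V -> V -> V) H H' (s : seq X) :
  (forall u v, perm_eq (u ++ v) s -> H u v = H' u v) ->
  star op H s = star op H' s.
Proof.
elim: s H H' => [|x s IH] H H' e /=; first exact: e.
congr op; apply: IH => u v uv; apply: e; first by rewrite /= perm_cons.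
by rewrite perm_catC /= perm_cons perm_catC.
Qed.

Lemma star_morph X V W (op : V -> V -> V) (op' : W -> W -> W) (f : V -> W) H
    (s : seq X) :
  {morph f : a b / op a b >-> op' a b} ->
  f (star op H s) = star op' (fun u v => f (H u v)) s.
Proof. by move=> fM; elim: s H => [|x s IH] H //=; rewrite fM !IH. Qed.

Lemma star_op X (V : nmodType) (H H' : seq X -> seq X -> V) s :
  star +%R (fun u v => H u v + H' u v) s = star +%R H s + star +%R H' s.
Proof.
elim: s H H' => [|x s IH] H H' //=.
by rewrite (IH (fun u v => H (x :: u) v)) (IH (fun u v => H u (x :: v))) addrACA.
Qed.

Lemma star_exchange X Y (V : nmodType)
    (H : seq X -> seq X -> seq Y -> seq Y -> V) s t :
  star +%R (fun u v => star +%R (H u v) t) s =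
  star +%R (fun u' v' => star +%R (fun u v => H u v u' v') s) t.
Proof.
elim: s H => [|x s IH] H /=; first exact: eq_star.
by rewrite star_op (IH (fun u v => H (x :: u) v)) (IH (fun u v => H u (x :: v))).
Qed.

(** A permutation is obtained by exchanging adjacent blocks; a splitting of a concatenation splits
    each block by itself, and the two inner sums commute. *)
Lemma star_perm (X : eqType) (V : nmodType) (H : seq X -> seq X -> V) s t :
  (forall u u' v v', perm_eq u u' -> perm_eq v v' -> H u v = H u' v') ->
  perm_eq s t -> star +%R H s = star +%R H t.
Proof.
move=> HP; apply: catCA_perm_subst => s1 s2 s3.
rewrite !catA star_cat [RHS]star_cat.
rewrite star_cat [RHS]star_cat star_exchange.
apply: eq_star => u v; apply: eq_star => u' v'; apply: eq_star => u2 v2.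
by apply: HP; rewrite perm_cat2r perm_catC.
Qed.

(** The splittings whose first half has [k] entries, all in [P], are the [k]-subsets of the entries
    in [P]. Through [bin_star], the binomial of the number of isolated nodes becomes a sum that can
    be integrated term by term. *)
Lemma star_binomial (R : pzRingType) X (P : pred X) k s :
  star +%R (fun u _ => ((size u == k) && all P u)%:R : R) s =
  'C(count P s, k)%:R.
Proof.
elim: s k => [|x s IH] k /=; first by case: k.
rewrite IH; case: (P x) => /=; last first.
  suff -> : star +%R (fun u _ => (((size u).+1 == k) && false)%:R) s = 0 :> R.
    by rewrite add0r.
  under eq_star do rewrite andbF.
  by elim: s {IH} => //= _ s ->; rewrite addr0.
case: k => [|k]; last by rewrite IH binS -natrD addnC.
suff -> : star +%R (fun u _ => (((size u).+1 == 0)%N && all P u)%:R) s = 0 :> R.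
  by rewrite add0r !bin0.
by rewrite /=; elim: s {IH} => //= _ s ->; rewrite addr0.
Qed.

Section pairprod.
Context (R : comPzRingType) (X : eqType) (t : X -> X -> R).
Hypothesis tC : forall x y, t x y = t y x.

(** When [t x y] is the probability that [x] and [y] are not linked, this is the probability that no
    edge joins [u] to [v], and [pairprod s] the probability that no edge joins two points of [s]. *)
Definition crossprod (u v : seq X) : R := \prod_(x <- u) \prod_(y <- v) t x y.

Fixpoint pairprod (s : seq X) : R :=
  if s is x :: s' then (\prod_(y <- s') t x y) * pairprod s' else 1.

Lemma crossprod_cons x u v :
  crossprod (x :: u) v = (\prod_(y <- v) t x y) * crossprod u v.
Proof. by rewrite /crossprod big_cons. Qed.

Lemma crossprodC u v : crossprod u v = crossprod v u.
Proof.
rewrite /crossprod exchange_big/=; apply: eq_bigr => x _.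
by apply: eq_bigr => y _; rewrite tC.
Qed.

Lemma crossprod_catr u v w :
  crossprod u (v ++ w) = crossprod u v * crossprod u w.
Proof.
rewrite /crossprod -big_split/=; apply: eq_bigr => x _.
by rewrite big_cat.
Qed.

Lemma pairprod_cat u v :
  pairprod (u ++ v) = pairprod u * crossprod u v * pairprod v.
Proof.
elim: u => [|x u IH] /=; first by rewrite /crossprod big_nil !mul1r.
by rewrite IH big_cat crossprod_cons /=; ring.
Qed.

Lemma perm_pairprod s s' : perm_eq s s' -> pairprod s = pairprod s'.
Proof.
apply: catCA_perm_subst => a b c.
rewrite !pairprod_cat !crossprod_catr (crossprodC b a); ring.
Qed.

Lemma perm_crossprod u u' v v' :
  perm_eq u u' -> perm_eq v v' -> crossprod u v = crossprod u' v'.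
Proof.
move=> uu' vv'; rewrite /crossprod (perm_big _ uu')/=; apply: eq_bigr => x _.
exact: perm_big.
Qed.

Lemma pairprod_iota m n (f : nat -> X) :
  pairprod (map f (iota m n)) =
  \prod_(m <= i < m + n) \prod_(i.+1 <= j < m + n) t (f i) (f j).
Proof.
elim: n m => [|n IH] m /=; first by rewrite addn0 big_geq.
rewrite IH addSnnS [RHS]big_ltn ?addnS ?ltnS ?leq_addr//; congr (_ * _).
by rewrite big_map /index_iota subSS addKn.
Qed.

End pairprod.

(** * Iterated integrals *)

Definition mk_mfun d d' (T : measurableType d) (T' : measurableType d')
    (f : T -> T') (mf : measurable_fun [set: T] f) : {mfun T >-> T'} :=
  HB.pack f (isMeasurableFun.Build _ _ _ _ f mf).

Section smeas.
Context d (X : measurableType d).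

(* Measurability of [F] on each [X^n], tested on all measurable maps into
   [X^n]; this form composes without any bookkeeping on tuples. *)
Definition smeas d' (Y : sigmaRingType d') (F : seq X -> Y) :=
  forall dz (Z : measurableType dz) (fs : seq {mfun Z >-> X}),
    measurable_fun [set: Z] (fun z => F [seq f z | f : {mfun Z >-> X} <- fs]).

Definition smeas2 d' (Y : sigmaRingType d') (H : seq X -> seq X -> Y) :=
  forall dz (Z : measurableType dz) (fs gs : seq {mfun Z >-> X}),
    measurable_fun [set: Z] (fun z => H [seq f z | f : {mfun Z >-> X} <- fs]
                                        [seq f z | f : {mfun Z >-> X} <- gs]).

End smeas.

Lemma star_ge0 (R : realType) (I : Type) (H : seq I -> seq I -> \bar R) s :
  (forall u v, 0 <= H u v)%E -> (0 <= star adde H s)%E.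
Proof. by elim: s H => [|x s IH] H H0 //=; rewrite adde_ge0// IH. Qed.

Section iint.
Context d (X : measurableType d) (R : realType) (U : probability X R).
Implicit Types F : seq X -> \bar R.
Local Open Scope ereal_scope.

Fixpoint iint n F : \bar R :=
  if n is n'.+1 then \int[U]_x iint n' (fun s => F (x :: s)) else F [::].

Lemma eq_iint n F F' : (forall s, size s = n -> F s = F' s) ->
  iint n F = iint n F'.
Proof.
elim: n F F' => [|n IH] F F' e /=; first exact: e.
by apply: eq_integral => x _; apply: IH => s sn; apply: e; rewrite /= sn.
Qed.

Lemma iint_ge0 n F : (forall s, 0 <= F s) -> 0 <= iint n F.
Proof.
by elim: n F => [|n IH] F F0 //=; apply: integral_ge0 => x _; exact: IH.
Qed.

(** The prefix [fs] makes the induction go through: the next integration variable becomes its last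
    entry, over the product space, and the theorem of Tonelli applies. *)
Lemma measurable_iint_cat n F dz (Z : measurableType dz)
    (fs : seq {mfun Z >-> X}) :
  smeas F -> (forall s, 0 <= F s) ->
  measurable_fun [set: Z]
    (fun z => iint n (fun s => F ([seq f z | f : {mfun Z >-> X} <- fs] ++ s))).
Proof.
move=> mF F0; elim: n dz Z fs => [|n IH] dz Z fs /=.
  by under eq_fun do rewrite cats0; exact: mF.
pose fs' : seq {mfun (Z * X)%type >-> X} :=
  rcons [seq mk_mfun (measurableT_comp (measurable_funPT f) measurable_fst)
          | f : {mfun Z >-> X} <- fs]
    (mk_mfun measurable_snd).
have fs'E z x s : [seq f (z, x) | f : {mfun (Z * X)%type >-> X} <- fs'] ++ s =
    [seq f z | f : {mfun Z >-> X} <- fs] ++ x :: s.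
  by rewrite /fs' map_rcons cat_rcons -map_comp.
have := @measurable_fun_fubini_tonelli_F _ _ Z X R U _ (IH _ _ fs')
  (fun x => iint_ge0 _ (fun s => F0 _)).
apply: eq_measurable_fun => z _; rewrite /fubini_F/=.
by apply: eq_integral => x _; apply: eq_iint => s _; rewrite fs'E.
Qed.

Lemma smeas_cons F x : smeas F -> smeas (fun s => F (x :: s)).
Proof.
move=> mF dz Z fs; have := mF _ _ (mk_mfun (measurable_cst x) :: fs).
exact.
Qed.

Lemma measurable_iint_cons n F :
  smeas F -> (forall s, 0 <= F s) ->
  measurable_fun [set: X] (fun x => iint n (fun s => F (x :: s))).
Proof.
move=> mF F0; have := measurable_iint_cat n [:: mk_mfun (@measurable_id _ X setT)] mF F0.
exact.
Qed.

Lemma le_iint n F F' : smeas F -> smeas F' -> (forall s, 0 <= F s) ->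
  (forall s, size s = n -> F s <= F' s) -> (forall s, 0 <= F' s) -> 
  iint n F <= iint n F'.
Proof.
elim: n F F' => [|n IH] F F' mF mF' F0 FF' F'0 /=; first exact: FF'.
apply: ge0_le_integral => //.
- by move=> x _; exact: iint_ge0.
- exact: measurable_iint_cons.
- exact: measurable_iint_cons.
- move=> x _; apply: IH => //; [exact: smeas_cons|exact: smeas_cons|].
  by move=> s sn; apply: FF'; rewrite /= sn.
Qed.

Lemma iintD n F F' : smeas F -> smeas F' -> (forall s, 0 <= F s) ->
  (forall s, 0 <= F' s) -> iint n (fun s => F s + F' s) = iint n F + iint n F'.
Proof.
elim: n F F' => [|n IH] F F' mF mF' F0 F'0 //=.
rewrite -ge0_integralD//; last 4 first.
- by move=> x _; exact: iint_ge0.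
- exact: measurable_iint_cons.
- by move=> x _; exact: iint_ge0.
- exact: measurable_iint_cons.
by apply: eq_integral => x _; rewrite IH//; exact: smeas_cons.
Qed.

Lemma iintZl n F k : smeas F -> (forall s, 0 <= F s) -> 0 <= k ->
  iint n (fun s => k * F s) = k * iint n F.
Proof.
elim: n F => [|n IH] F mF F0 k0 //=.
rewrite -ge0_integralZl//.
- by apply: eq_integral => x _; rewrite IH//; exact: smeas_cons.
- exact: measurable_iint_cons.
- by move=> x _; exact: iint_ge0.
Qed.

Lemma iint_cst n k : 0 <= k -> iint n (cst k) = k.
Proof.
move=> k0; elim: n => [|n IH] //=.
under eq_integral do rewrite IH.
by rewrite integral_cst// -[RHS]mule1; congr *%E; exact: probability_setT.
Qed.

Lemma smeas2_consl d' (Y : sigmaRingType d') (H : seq X -> seq X -> Y) x :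
  smeas2 H -> smeas2 (fun u v => H (x :: u) v).
Proof.
by move=> mH dz Z fs gs; exact: (mH _ _ (mk_mfun (measurable_cst x) :: fs) gs).
Qed.

Lemma smeas2_consr d' (Y : sigmaRingType d') (H : seq X -> seq X -> Y) x :
  smeas2 H -> smeas2 (fun u v => H u (x :: v)).
Proof.
by move=> mH dz Z fs gs; exact: (mH _ _ fs (mk_mfun (measurable_cst x) :: gs)).
Qed.

Lemma smeas2_r d' (Y : sigmaRingType d') (H : seq X -> seq X -> Y) u :
  smeas2 H -> smeas (fun v => H u v).
Proof.
move=> mH dz Z fs.
have := mH _ _ [seq mk_mfun (measurable_cst x) | x <- u] fs.
apply: eq_measurable_fun => z _ /=; congr H.
by rewrite -map_comp; exact: map_id.
Qed.

(** Cutting a concatenation at the known length of its first part turns a function of two lists into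
    a function of one. *)
Lemma measurable_iint2 n (H : seq X -> seq X -> \bar R) dz (Z : measurableType dz)
    (fs gs : seq {mfun Z >-> X}) :
  smeas2 H -> (forall u v, 0 <= H u v) ->
  measurable_fun [set: Z]
    (fun z => iint n (fun s => H [seq f z | f : {mfun Z >-> X} <- fs]
                                 ([seq f z | f : {mfun Z >-> X} <- gs] ++ s))).
Proof.
move=> mH H0.
pose F s := H (take (size fs) s) (drop (size fs) s).
have mF : smeas F.
  move=> dz' Z' hs; have := mH _ _ (take (size fs) hs) (drop (size fs) hs).
  by apply: eq_measurable_fun => z _; rewrite /F !map_take !map_drop.
have := measurable_iint_cat n (fs ++ gs) mF (fun s => H0 _ _).
apply: eq_measurable_fun => z _; apply: eq_iint => s _.
rewrite /F map_cat -catA take_size_cat ?size_map//.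
by rewrite drop_size_cat ?size_map.
Qed.

Lemma smeas_iint2 n (H : seq X -> seq X -> \bar R) :
  smeas2 H -> (forall u v, 0 <= H u v) -> smeas (fun u => iint n (H u)).
Proof. by move=> mH H0 dz Z fs; exact: (measurable_iint2 n fs [::] mH H0). Qed.

(** Joint measurability of [F] in the point and the list is expressed by [smeas2], the point being
    the head of a first list; the empty list receives the default value 0. *)
Lemma iint_swap n (F : X -> seq X -> \bar R) :
  smeas2 (fun u v => if u is x :: _ then F x v else 0) ->
  (forall x s, 0 <= F x s) ->
  \int[U]_x iint n (F x) = iint n (fun s => \int[U]_x F x s).
Proof.
elim: n F => [|n IH] F mF F0 //=.
have mH dz (Z : measurableType dz) (f : {mfun Z >-> X}) (gs : seq {mfun Z >-> X}) :
    measurable_fun [set: Z] (fun z => iint n (fun s => F (f z)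
      ([seq f z | f : {mfun Z >-> X} <- gs] ++ s))).
  apply: (measurable_iint2 n [:: f] gs mF) => -[|x u] v //.
transitivity (\int[U]_y \int[U]_x iint n (fun s => F x (y :: s))).
  apply: (@fubini_tonelli _ _ X X R U U
    (fun z => iint n (fun s => F z.1 (z.2 :: s)))) => [|z].
    exact: (mH _ _ (mk_mfun measurable_fst) [:: mk_mfun measurable_snd]).
  exact: iint_ge0.
apply: eq_integral => y _; apply: IH => // dz Z fs gs.
by have := mF _ _ fs (mk_mfun (measurable_cst y) :: gs).
Qed.

Lemma smeas_star (H : seq X -> seq X -> \bar R) :
  smeas2 H -> (forall u v, 0 <= H u v) -> smeas (star adde H).
Proof.
move=> mH H0 dz Z fs.
suff: forall gs hs, measurable_fun [set: Z]
    (fun z => star adde (fun u v => H ([seq f z | f : {mfun Z >-> X} <- gs] ++ u)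
                                      ([seq f z | f : {mfun Z >-> X} <- hs] ++ v))
             [seq f z | f : {mfun Z >-> X} <- fs]) by move/(_ [::] [::]).
elim: fs => [|f fs IH] gs hs /=.
  by under eq_fun do rewrite !cats0; exact: mH.
apply: emeasurable_funD.
  have := IH (rcons gs f) hs; apply: eq_measurable_fun => z _.
  by apply: eq_star => u v; rewrite map_rcons cat_rcons.
have := IH gs (rcons hs f); apply: eq_measurable_fun => z _.
by apply: eq_star => u v; rewrite map_rcons cat_rcons.
Qed.

Lemma natEFin_ge0 n : 0 <= n%:R%:E :> \bar R.
Proof. by rewrite lee_fin. Qed.
Hint Resolve natEFin_ge0 : core.

(** The integration variables are interchangeable, so all splittings with [a] points on the left
    contribute equally. In the induction the first variable goes to either side; if to the right,
    [iint_swap] carries it past the variables on the left, and the two sums combine by the rule of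
    Pascal. *)
Lemma iint_star n (H : seq X -> seq X -> \bar R) :
  smeas2 H -> (forall u v, 0 <= H u v) ->
  iint n (star adde H) =
  \sum_(0 <= a < n.+1) ('C(n, a))%:R%:E * iint a (fun u => iint (n - a) (H u)).
Proof.
elim: n H => [|n IH] H mH H0.
  by rewrite big_nat1 /= mul1e.
rewrite /=.
under eq_integral => x _.
  rewrite iintD; first last.
  - by move=> s; exact: star_ge0.
  - by move=> s; exact: star_ge0.
  - by apply: smeas_star => //; exact: smeas2_consr.
  - by apply: smeas_star => //; exact: smeas2_consl.
  rewrite IH//; last exact: smeas2_consl.
  rewrite IH//; last exact: smeas2_consr.
  over.
have m1 a b : measurable_fun [set: X]
    (fun x => iint a (fun u => iint b (fun v => H (x :: u) v))).
  apply: (measurable_iint_cons a (F := fun u => iint b (H u))) => //.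
    exact: smeas_iint2.
  by move=> s; exact: iint_ge0.
have m2' a b : measurable_fun [set: X]
    (fun x => iint a (fun u => iint b (fun v => H u (x :: v)))).
  pose H' (w u : seq X) := if w is x :: _ then iint b (fun v => H u (x :: v)) else 0.
  have mH' : smeas2 H'.
    move=> dz Z [|f fs] gs //=.
    exact: (measurable_iint2 b gs [:: f]).
  have H'0 u v : 0 <= H' u v by case: u => [|x u] //=; exact: iint_ge0.
  exact: (measurable_iint2 a [:: mk_mfun (@measurable_id _ X setT)] [::] mH' H'0).
have p1 a b x : 0 <= iint a (fun u => iint b (fun v => H (x :: u) v)).
  by apply: iint_ge0 => s; exact: iint_ge0.
have p2 a b x : 0 <= iint a (fun u => iint b (fun v => H u (x :: v))).
  by apply: iint_ge0 => s; exact: iint_ge0.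
rewrite ge0_integralD//; last 4 first.
- by move=> x _; apply: sume_ge0 => a _; rewrite mule_ge0.
- by apply: emeasurable_sum => a; apply: measurable_funeM.
- by move=> x _; apply: sume_ge0 => a _; rewrite mule_ge0.
- by apply: emeasurable_sum => a; apply: measurable_funeM.
rewrite ge0_integral_sum//; last 2 first.
- by move=> a; apply: measurable_funeM.
- by move=> a x _; rewrite mule_ge0.
rewrite ge0_integral_sum//; last 2 first.
- by move=> a; apply: measurable_funeM.
- by move=> a x _; rewrite mule_ge0.
pose T a b := iint a (fun u => iint b (H u)).
have T0 a b : 0 <= T a b by apply: iint_ge0 => s; exact: iint_ge0.
have E1 a : \int[U]_x (('C(n, a))%:R%:E *
    iint a (fun u => iint (n - a) (fun v => H (x :: u) v))) =
    ('C(n, a))%:R%:E * T a.+1 (n - a)%N.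
  by rewrite ge0_integralZl.
have E2 a : \int[U]_x (('C(n, a))%:R%:E *
    iint a (fun u => iint (n - a) (fun v => H u (x :: v)))) =
    ('C(n, a))%:R%:E * T a (n - a).+1.
  rewrite ge0_integralZl//; congr *%E; rewrite /T/=.
  rewrite iint_swap//.
    by move=> dz Z [|f fs] gs //=; exact: (measurable_iint2 _ gs [:: f]).
  by move=> x s; exact: iint_ge0.
rewrite (eq_bigr _ (fun a _ => E1 a)) [X in _ + X](eq_bigr _ (fun a _ => E2 a)).
rewrite [X in _ + X]big_nat [X in _ + X](eq_bigr (fun a =>
  ('C(n, a))%:R%:E * T a (n.+1 - a)%N)); last first.
  by move=> a /andP[_ an]; rewrite subSn.
rewrite -big_nat [X in _ + X]big_nat_recl//= bin0 subn0.
rewrite [RHS](_ : _ = \sum_(0 <= a < n.+2) ('C(n.+1, a))%:R%:E * T a (n.+1 - a)%N)//.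
rewrite [RHS]big_nat_recl//= bin0 subn0.
rewrite addeCA; congr +%E.
rewrite [RHS]big_nat_recr//= subSS subnn binn.
rewrite [X in X + _]big_nat_recr//= subnn binn.
rewrite -addeA addeC -addeA addeC; congr +%E.
rewrite -big_split/=; apply: eq_bigr => a _.
rewrite subSS binS natrD EFinD ge0_muleDl// addeC.
Qed.

End iint.

(** The head of such an ordering may be any entry whose type is the head [c] of the word, and there
    are as many of these as the word contains [c]; the tail orders the remaining entries. This links
    the orderings of the labels to the counts in disjoint cells. *)
Lemma count_permutations_map (I : eqType) (K : finType) (tau : I -> K)
    (s : seq I) (k : seq K) : uniq s ->
  count (fun q => map tau q == k) (permutations s) =
  (perm_eq (map tau s) k * \prod_c (count_mem c k)`!)%N.
Proof.
elim: k s => [|c k IH] s us.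
  rewrite big1 ?muln1// (_ : perm_eq _ _ = (s == [::])); last first.
    by apply/idP/eqP => [/perm_nilP|->] //; case: (s).
  case: s us => [|x s] us /=; first by rewrite addn0.
  apply/eqP; rewrite -leqn0 leqNgt -has_count; apply/hasPn => q.
  by rewrite mem_permutations => /perm_size sq; rewrite -size_eq0 size_map sq.
case: s us => [|x0 s0] us.
  rewrite (_ : perm_eq _ _ = false) ?mul0n//.
  by apply/negP => /perm_size.
set s := x0 :: s0 in us *.
rewrite (permP (permutationsE _))// undup_id//.
rewrite count_flatten -map_comp.
transitivity (\sum_(x <- s | tau x == c)
    (perm_eq (map tau (rem x s)) k * \prod_c (count_mem c k)`!))%N.
  rewrite sumnE big_map [RHS]big_mkcond [LHS]big_seq_cond [RHS]big_seq_cond.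
  apply: eq_bigr => x /andP[xs _]; rewrite [LHS]/comp count_map.
  case: (eqVneq (tau x) c) => [txc|/eqP txc]; last first.
    rewrite (@eq_count _ _ pred0) ?count_pred0// => q /=.
    by apply/negP => /eqP[/txc].
  rewrite -IH ?rem_uniq//; apply: eq_count => q /=.
  by rewrite eqseq_cons txc eqxx.
have remE x : x \in s -> tau x = c ->
    perm_eq (map tau (rem x s)) k = perm_eq (map tau s) (c :: k).
  move=> xs txc.
  have /permPl -> : perm_eq (map tau s) (tau x :: map tau (rem x s)).
    by rewrite -map_cons perm_map// perm_to_rem.
  by rewrite txc perm_cons.
rewrite big_seq_cond (eq_bigr (fun=> perm_eq (map tau s) (c :: k) *
    \prod_c (count_mem c k)`!)%N); last first.
  by move=> x /andP[xs /eqP txc]; rewrite remE.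
rewrite -big_seq_cond big_const_seq iter_addn_0 mulnC.
case: (boolP (perm_eq (map tau s) (c :: k))) => [sk|_]; last by rewrite !mul0n muln0.
rewrite !mul1n.
have -> : count (fun x => tau x == c) s = (count_mem c k).+1.
  have := permP sk (pred1 c); rewrite count_map => ->.
  by rewrite /= eqxx.
rewrite (bigD1 c)//= [in RHS](bigD1 c)//= eqxx add1n factS mulnA.
congr (_ * _)%N; apply: eq_bigr => d dc.
by rewrite eq_sym (negbTE dc).
Qed.

Lemma prod_count_mem (R : comPzRingType) (K : finType) (a : K -> R) (k : seq K) :
  \prod_c a c ^+ count_mem c k = \prod_(c <- k) a c.
Proof.
elim: k => [|c k IH]; first by rewrite big_nil big1.
rewrite big_cons -IH (bigD1 c)//= [in RHS](bigD1 c)//= eqxx exprS mulrA.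
by congr (_ * _); apply: eq_bigr => d dc; rewrite eq_sym (negbTE dc).
Qed.

(** * Positions of the nodes *)

Section unit_square.
Context (R : realType).
Local Notation mu2 := (@lebesgue_measure R \x @lebesgue_measure R)%E.

Lemma measurable_unit_square : measurable (@unit_square R).
Proof. by apply: measurableX; exact: measurable_itv. Qed.

Lemma lebesgue_itv_lebesgue (a b : R) c d : a <= b ->
  (@lebesgue_measure R [set` Interval (BSide c a) (BSide d b)]) = (b - a)%:E.
Proof.
move=> ab; rewrite lebesgue_measure_itv /= lte_fin.
by case: ltP => // ba; rewrite (@le_anti _ _ a b) ?ab// subrr.
Qed.

Lemma area_unit_square : mu2 (@unit_square R) = 1%E.
Proof.
rewrite product_measure1E//=; try exact: measurable_itv.
rewrite !lebesgue_itv_lebesgue; last lra.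
by rewrite -EFinM; congr (_%:E); lra.
Qed.

Definition square_unif : set (plane R) -> \bar R :=
  mrestr mu2 measurable_unit_square.

HB.instance Definition _ := Measure.on square_unif.

Let square_unif_setT : square_unif [set: plane R] = 1%E.
Proof. by rewrite /square_unif /mrestr setTI area_unit_square. Qed.

HB.instance Definition _ :=
  Measure_isProbability.Build _ _ _ square_unif square_unif_setT.

Lemma square_unifE A : square_unif A = mu2 (A `&` @unit_square R).
Proof. by []. Qed.

Lemma integral_square_unif (f : plane R -> \bar R) :
  measurable_fun setT f -> (forall x, 0 <= f x)%E ->
  (\int[square_unif]_x f x = \int[mu2]_(x in @unit_square R) f x)%E.
Proof.
move=> mf f0.
have mS := measurable_unit_square.
transitivity (\int[square_unif]_(x in [set: plane R] `\` ~` @unit_square R) f x)%E.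
  apply: ge0_negligible_integral => //; first exact: measurableC.
  have : square_unif (~` @unit_square R) = 0%E by rewrite square_unifE setICl measure0.
  exact.
rewrite setDE setCK setTI; apply: eq_measure_integral => A mA AS.
by rewrite -[LHS]/(square_unif A) square_unifE setIidl.
Qed.

End unit_square.

Section positions.
Context d (T : measurableType d) (R : realType) (P : probability T R).
Variables (G : random_network P) (rho : R).
Hypothesis rho_ge0 : 0 <= rho.
Hypothesis GP : poisson_on_square G rho.
Local Notation S := (@unit_square R).
Local Notation U := (@square_unif R).

Lemma node_countE A w :
  node_count G A w = count (fun i => pos G i w \in A) (iota 0 (nodes G w)).
Proof.
rewrite /node_count cardE /enum_mem size_filter -val_enum_ord count_map enumT.
exact: eq_count.
Qed.

Lemma measurable_nodes n : measurable [set w | nodes G w = n].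
Proof.
rewrite (_ : [set _ | _] = nodes G @^-1` [set n])//.
exact: measurable_funPTI.
Qed.

Lemma measurable_pos_in A i : measurable A -> measurable [set w | A (pos G i w)].
Proof. by move=> mA; exact: measurable_funPTI. Qed.

Lemma measurable_node_count A m : measurable A ->
  measurable [set w | node_count G A w = m].
Proof.
move=> mA.
rewrite (_ : [set _ | _] = \bigcup_n \bigcup_(J in [set J : {set 'I_n} | #|J| = m])
  ([set w | nodes G w = n] `&` \bigcap_(i in [set: 'I_n])
     (if i \in J then pos G i @^-1` A else ~` (pos G i @^-1` A)))).
  apply: bigcup_measurable => n _; apply: fin_bigcup_measurable => [|J _].
    exact: finite_finset.
  apply: measurableI; first exact: measurable_nodes.
  apply: fin_bigcap_measurable => [|i _]; first exact: finite_finset.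
  by case: ifP => _; [|apply: measurableC]; exact: measurable_funPTI.
apply/seteqP; split=> [w <-|w [n _ [J <-] [wn wJ]]] /=.
  exists (nodes G w) => //; exists [set i : 'I_(nodes G w) | pos G i w \in A]%SET => /=.
    by rewrite cardsE.
  split=> // i _; case: ifP; rewrite inE => Ai; first by move/set_mem: Ai.
  by move=> Aw; move/negbT/negP: Ai; apply; exact: mem_set.
move: wn => /= wn; subst n; rewrite /node_count; apply: eq_card => i; rewrite inE.
apply/idP/idP => [Ai|iJ].
  by apply/negPn/negP => iJ; have := wJ i I; rewrite (negbTE iJ); apply; exact: set_mem.
by apply/mem_set; have := wJ i I; rewrite iJ.
Qed.

(** At mean 0, [poisson_prob] is the Dirac mass at its dummy argument 0; the formula agrees with it
    because [0 ^+ 0 = 1], so that cells of area 0 need no special treatment afterwards. *)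
Definition poisson_weight (a : R) m : R := expR (- a) * a ^+ m / m`!%:R.

Lemma prob_node_count A m : measurable A -> A `<=` S ->
  P [set w | node_count G A w = m] =
  (poisson_weight (rho * fine (area A)) m)%:E.
Proof.
move=> mA AS; rewrite (_ : [set _ | _] = node_count G A @^-1` [set m])//.
rewrite (node_count_poisson GP)//.
have : 0 <= rho * fine (area A) by rewrite mulr_ge0// fine_ge0// measure_ge0.
move: (rho * _) => a; rewrite le_eqVlt => /predU1P[<-|a0].
  rewrite /poisson_prob ltxx diracE /poisson_weight oppr0 expR0 mul1r.
  case: m => [|m]; first by rewrite mem_set// expr0 fact0 divr1.
  by rewrite memNset// expr0n/= mul0r.
rewrite /poisson_prob a0 esum_set1; last by rewrite lee_fin poisson_pmf_ge0.
by rewrite /poisson_pmf a0 /poisson_weight; congr (_%:E); ring.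
Qed.

Section rectangle.
Variables (n : nat) (A : 'I_n -> set (plane R)).
Hypothesis mA : forall i, measurable (A i).

(* The atom containing [y] of the algebra generated by the [A i]. *)
Let ty (y : plane R) : {set 'I_n} := [set i | y \in A i]%SET.
(** The sets [A i] may overlap, whereas the independence of the counts is given for disjoint sets.
    These cells are disjoint and fill the square. *)
Let B (c : {set 'I_n}) : set (plane R) := S `&` [set y | ty y = c].

Let mB c : measurable (B c).
Proof.
apply: measurableI; first exact: measurable_unit_square.
rewrite (_ : [set _ | _] =
  \bigcap_(i in [set: 'I_n]) (if i \in c then A i else ~` A i)).
  apply: fin_bigcap_measurable => [|i _]; first exact: finite_finset.
  by case: ifP => _ //; exact: measurableC.
apply/seteqP; split=> [y <- i _|y yc] /=.
  case: ifP; rewrite inE => yA; first exact: set_mem.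
  by move=> Aw; move/negbT/negP: yA; apply; exact: mem_set.
apply/setP => i; rewrite inE; apply/idP/idP => [yA|ic].
  by apply/negPn/negP => iJ; have := yc i I; rewrite (negbTE iJ); apply; exact: set_mem.
by apply/mem_set; have := yc i I; rewrite ic.
Qed.

Let a c := rho * fine (area (B c)).

Let BS c : B c `<=` S. Proof. by move=> y []. Qed.

Let area_fin A' : measurable A' -> A' `<=` S -> area A' \is a fin_num.
Proof.
move=> mA' AS; rewrite ge0_fin_numE ?measure_ge0//.
apply: (@le_lt_trans _ _ (area S)); last by rewrite /area area_unit_square ltry.
by apply: le_measure; rewrite ?inE//; exact: measurable_unit_square.
Qed.

Let trivB : trivIset setT B.
Proof.
by apply/trivIsetP => c c' _ _ cc'; apply/seteqP; split=> // y [[_ /= yc] [_ /= yc']];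
  case/eqP: cc'; rewrite -yc.
Qed.

Let area_sum (Q : pred {set 'I_n}) :
  \sum_(c | Q c) a c = rho * fine (area (S `&` [set y | Q (ty y)])).
Proof.
have -> : S `&` [set y | Q (ty y)] = \bigcup_(c in [set` enum Q]) B c.
  apply/seteqP; split=> [y [Sy Qy]|y [c /=]].
    by exists (ty y) => //=; rewrite mem_enum.
  by rewrite mem_enum => Qc [Sy yc]; split => //=; rewrite yc.
rewrite /area measure_fin_bigcup//; last exact: sub_trivIset trivB.
rewrite -fsbig_seq ?enum_uniq// -sum_fine; last by move=> c _; exact: area_fin.
by rewrite mulr_sumr big_enum.
Qed.

Let E (k : {ffun 'I_n -> {set 'I_n}}) : set T :=
  [set w | forall c, node_count G (B c) w = count_mem c (codom k)].

Let EE k : E k = \bigcap_(c in [set: {set 'I_n}])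
  [set w | node_count G (B c) w = count_mem c (codom k)].
Proof. by apply/seteqP; split=> [w Ew c _|w Ew c]; [exact: Ew|exact: Ew]. Qed.

Let mE k : measurable (E k).
Proof.
rewrite EE; apply: fin_bigcap_measurable => [|c _]; first exact: finite_finset.
exact: measurable_node_count.
Qed.

Let PE k : P (E k) = (\prod_c poisson_weight (a c) (count_mem c (codom k)))%:E.
Proof.
pose B' (i : 'I_#|{set 'I_n}|) := B (enum_val i).
pose V (i : 'I_#|{set 'I_n}|) := [set count_mem (enum_val i) (codom k)].
have -> : E k = \bigcap_i (node_count G (B' i) @^-1` V i).
  apply/seteqP; split=> [w Ew i _|w Ew c]; first exact: Ew.
  by have := Ew (enum_rank c) I; rewrite /B' /V/= enum_rankK.
rewrite (node_count_indep GP)//; first last.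
- apply/trivIsetP => i j _ _ ij; have /trivIsetP tB := trivB; apply: tB => //.
  by apply: contra ij => /eqP /enum_val_inj ->.
- by move=> i; exact: BS.
- by move=> i; exact: mB.
rewrite (eq_bigr (fun i : 'I_#|{set 'I_n}| =>
  (poisson_weight (a (enum_val i)) (count_mem (enum_val i) (codom k)))%:E)).
  by rewrite prodEFin; congr EFin; rewrite [RHS]big_enum_val.
by move=> i _; exact: (prob_node_count _ (mB _) (@BS _)).
Qed.

Let types w q := [seq ty (pos G i w) | i <- q].

Let node_count_types c w :
  node_count G (B c) w = count_mem c (types w (iota 0 (nodes G w))).
Proof.
rewrite node_countE count_map; apply: eq_in_count => i; rewrite mem_iota add0n /= => iw.
apply/idP/idP => [/set_mem[_ /= ->]//|/eqP tyc].
by apply/mem_set; split => //; exact: (pos_in_square GP).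
Qed.

Let EP k w : n = nodes G w ->
  E k w <-> perm_eq (types w (iota 0 n)) (codom k).
Proof.
move=> nw; rewrite [X in iota 0 X]nw; split=> [Ew|/permP pw c]; last by rewrite node_count_types pw.
by apply/allP => c _ /=; apply/eqP; rewrite -Ew node_count_types.
Qed.

Let E_nodes k w : E k w -> nodes G w = n.
Proof.
move=> Ew; rewrite -[RHS](card_ord n) -(size_codom k) -[LHS](size_iota 0).
rewrite -(size_map (fun i => ty (pos G i w))) -/(types w _).
suff /perm_size : perm_eq (types w (iota 0 (nodes G w))) (codom k) by [].
by apply/allP => c _ /=; apply/eqP; rewrite -Ew node_count_types.
Qed.

Let good (k : {ffun 'I_n -> {set 'I_n}}) := [forall i, i \in k i].

Let D q : set T :=
  [set w | nodes G w = n /\ forall i : 'I_n, A i (pos G (nth 0%N q i) w)].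

Let mD q : measurable (D q).
Proof.
rewrite (_ : D q = [set w | nodes G w = n] `&`
  \bigcap_(i in [set: 'I_n]) [set w | A i (pos G (nth 0%N q i) w)]).
  apply: measurableI; first exact: measurable_nodes.
  apply: fin_bigcap_measurable => [|i _]; first exact: finite_finset.
  exact: measurable_pos_in.
by apply/seteqP; split=> w [nw wA]; split=> // i; [move=> _|]; exact: wA.
Qed.

(** An ordering [q] that puts the [i]-th position in [A i] for every [i] determines one word [k] of
    cells, and this word is [good]. Conversely the orderings with a given word exist only if the
    counts in the cells match it, and their number is then the product of factorials. *)
Let sum_D w : \sum_(q <- permutations (iota 0 n)) \1_(D q) w =
  \sum_(k | good k) (\prod_c (count_mem c (codom k))`!)%:R * \1_(E k) w :> R.
Proof.
have [nw|nw] := eqVneq (nodes G w) n; last first.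
  rewrite big1 => [|q _]; last by rewrite indicE memNset// => -[wn]; move: nw; rewrite wn eqxx.
  by rewrite big1// => k _; rewrite indicE memNset ?mulr0// => /E_nodes wn; move: nw; rewrite wn eqxx.
have -> : \sum_(q <- permutations (iota 0 n)) \1_(D q) w =
    \sum_(q <- permutations (iota 0 n)) \sum_(k | good k)
      (types w q == codom k)%:R :> R.
  rewrite [LHS]big_seq [RHS]big_seq; apply: eq_bigr => q.
  rewrite mem_permutations => /perm_size; rewrite size_iota => sq.
  pose kq := [ffun i : 'I_n => ty (pos G (nth 0%N q i) w)].
  have kqE : codom kq = types w q.
    apply: (@eq_from_nth _ finset.set0).
      by rewrite size_codom card_ord size_map sq.
    rewrite size_codom card_ord => i ni.
    rewrite (nth_map 0%N) ?sq// (nth_map (Ordinal ni)) ?size_enum_ord//.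
    by rewrite ffunE nth_enum_ord.
  rewrite (eq_bigr (fun k => (k == kq)%:R)); last first.
    move=> k _; congr (_%:R); rewrite -kqE eq_sym; congr (nat_of_bool _).
    apply/eqP/eqP => [kk|->//]; apply/ffunP => i.
    have := congr1 (nth (k i) ^~ i) kk; rewrite /codom /image_mem.
    by rewrite !(nth_map i) -?enumT ?size_enum_ord// !nth_ord_enum.
  rewrite indicE; have [gk|ngk] := boolP (good kq).
    rewrite (bigD1 kq)//= eqxx big1 ?addr0; last by move=> k /andP[_ /negbTE ->].
    rewrite mem_set//; split=> // i; move/forallP: gk => /(_ i).
    by rewrite ffunE inE => /set_mem.
  rewrite memNset; last first.
    move=> [_ wA]; move/negP: ngk; apply; apply/forallP => i.
    by rewrite ffunE inE; apply/mem_set.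
  rewrite big1// => k gk; case: eqP => // kk; move: gk.
  by rewrite kk (negbTE ngk).
rewrite exchange_big/=; apply: eq_bigr => k _.
rewrite -natr_sum.
rewrite (_ : (\sum_(q <- _) _)%N =
    count (fun q => types w q == codom k) (permutations (iota 0 n))); last first.
  by rewrite -sum1_count [RHS]big_mkcond; apply: eq_bigr => q _; case: ifP.
have := count_permutations_map (fun i => ty (pos G i w)) (codom k) (iota_uniq 0 n).
rewrite -/(types w _) => ->; rewrite natrM mulrC; congr (_ * _).
rewrite indicE; case: (boolP (perm_eq _ _)) => pk.
  by rewrite mem_set//; apply/EP.
by rewrite memNset// => /(EP _ (esym nw)); apply/negP.
Qed.

(** Summing over all orderings removes the dependence on the labelling. The factorials of [sum_D]
    cancel those of the Poisson weights, the exponentials multiply to [expR (- rho)] because the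
    cells fill the square, and the sum over good words factors into a product over [i]. *)
Lemma poisson_rectangle :
  (\sum_(q <- permutations (iota 0 n)) P (D q) =
   (expR (- rho) * \prod_i (rho * fine (area (S `&` A i))))%:E)%E.
Proof.
transitivity (\int[P]_w (\sum_(q <- permutations (iota 0 n)) (\1_(D q) w)%:E))%E.
  rewrite ge0_integral_sum//; first last.
  - by move=> q; apply/measurable_EFinP; exact: measurable_indic.
  by apply: eq_bigr => q _; rewrite integral_indic// setIT.
transitivity (\int[P]_w (\sum_(k | good k)
    ((\prod_c (count_mem c (codom k))`!)%:R%:E * (\1_(E k) w)%:E)))%E.
  apply: eq_integral => w _; rewrite sumEFin sum_D -sumEFin.
  by apply: eq_bigr => k _; rewrite EFinM.
transitivity (\sum_(k | good k)
    ((\prod_c (count_mem c (codom k))`!)%:R%:E * P (E k)))%E.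
  rewrite -big_filter; under eq_integral do rewrite -big_filter.
  have m1 k : measurable_fun setT (fun w => (\1_(E k) w : R)%:E).
    by apply/measurable_EFinP; exact: measurable_indic.
  have p1 k w : (0 <= (\1_(E k) w : R)%:E)%E by rewrite lee_fin.
  have mc (k : {ffun 'I_n -> {set 'I_n}}) : measurable_fun setT (fun w =>
      ((\prod_c (count_mem c (codom k))`!)%:R%:E * (\1_(E k) w : R)%:E)%E).
    exact: measurable_funeM.
  have pc (k : {ffun 'I_n -> {set 'I_n}}) w : (0 <= (\prod_c (count_mem c (codom k))`!)%:R%:E * (\1_(E k) w : R)%:E)%E.
    by rewrite mule_ge0// lee_fin.
  rewrite ge0_integral_sum//; apply: eq_bigr => k _.
  by rewrite ge0_integralZl ?lee_fin// integral_indic// setIT.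
rewrite (eq_bigr (fun k : {ffun 'I_n -> {set 'I_n}} => ((\prod_c (count_mem c (codom k))`!)%:R *
    \prod_c poisson_weight (a c) (count_mem c (codom k)))%:E)); last first.
  by move=> k _; rewrite EFinM -PE.
rewrite sumEFin; congr EFin.
have a_sum : \sum_c a c = rho.
  rewrite (area_sum xpredT) (_ : S `&` _ = S); last first.
    by apply/seteqP; split=> y // -[].
  by rewrite /area area_unit_square/= mulr1.
transitivity (\sum_(k | good k) (expR (- rho) * \prod_i a (k i))).
  apply: eq_bigr => k _; rewrite natr_prod -big_split/=.
  transitivity (\prod_c (expR (- a c) * a c ^+ count_mem c (codom k))).
    apply: eq_bigr => c _; rewrite /poisson_weight mulrC divfK//.
  rewrite big_split/= prod_count_mem -expR_sum sumrN a_sum; congr (_ * _).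
  by rewrite big_map big_enum.
rewrite -mulr_sumr; congr (_ * _).
rewrite (eq_bigr (fun i => \sum_(c : {set 'I_n} | i \in c) a c)); last first.
  move=> i _; rewrite (area_sum (fun c => i \in c)); congr (_ * fine (area (_ `&` _))).
  by apply/seteqP; split=> y /=; rewrite inE; [move/mem_set|move/set_mem].
rewrite (bigA_distr_big_dep (fun i (c : {set 'I_n}) => i \in c) (fun _ c => a c)).
by apply: eq_bigl => k; apply/forallP/familyP.
Qed.

End rectangle.
End positions.

Lemma integral_mrestr d (T : measurableType d) (R : realType)
    (mu : {measure set T -> \bar R}) (D : set T) (mD : measurable D)
    (f : T -> \bar R) :
  measurable_fun setT f -> (forall x, 0 <= f x)%E ->
  (\int[mrestr mu mD]_x f x = \int[mu]_(x in D) f x)%E.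
Proof.
move=> mf f0.
transitivity (\int[mrestr mu mD]_(x in setT `\` ~` D) f x)%E.
  apply: ge0_negligible_integral => //; first exact: measurableC.
  have : mrestr mu mD (~` D) = 0%E by rewrite /mrestr setICl measure0.
  exact.
rewrite setDE setCK setTI; apply: eq_measure_integral => A mA AS.
by rewrite -[LHS]/(mrestr mu mD A) /mrestr setIidl.
Qed.

Definition mpush d d' (T : measurableType d) (T' : measurableType d')
    (R : realType) (m : {measure set T -> \bar R}) (f : T -> T')
    (mf : measurable_fun setT f) : {measure set T' -> \bar R}.
Proof. by refine (pushforward m f : {measure set T' -> \bar R}). Defined.

Lemma mpushE d d' (T : measurableType d) (T' : measurableType d')
    (R : realType) (m : {measure set T -> \bar R}) (f : T -> T')
    (mf : measurable_fun setT f) A : mpush m mf A = m (f @^-1` A).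
Proof. by []. Qed.

Lemma integral_mpush d d' (T : measurableType d) (T' : measurableType d')
    (R : realType) (m : {measure set T -> \bar R}) (f : T -> T')
    (mf : measurable_fun setT f) (F : T' -> \bar R) :
  measurable_fun setT F -> (forall x, 0 <= F x)%E ->
  (\int[mpush m mf]_x F x = \int[m]_x F (f x))%E.
Proof. by move=> mF F0; rewrite ge0_integral_pushforward. Qed.

(** * Powers of a probability measure on tuples *)

Section tuple_power.
Context d (X : measurableType d) (R : realType) (U : probability X R).

Definition tcons n (x : X * n.-tuple X) : n.+1.-tuple X := [tuple of x.1 :: x.2].

Lemma measurable_tcons n : measurable_fun [set: X * n.-tuple X] (@tcons n).
Proof. exact: measurable_cons. Qed.

(** The functional [iint] as a genuine measure, which is what the uniqueness theorem for measures
    can be applied to; [integral_tpow] returns to [iint]. *)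
Fixpoint tpow n : probability (n.-tuple X) R :=
  match n with
  | 0 => [the probability _ R of \d_([tuple] : 0.-tuple X)]
  | n'.+1 => [the probability _ R of
      distribution (U \x tpow n')%E (mk_mfun (@measurable_tcons n'))]
  end.

Definition trect n (A : 'I_n -> set X) : set (n.-tuple X) :=
  [set t | forall i, A i (tnth t i)].

Lemma measurable_trect n (A : 'I_n -> set X) :
  (forall i, measurable (A i)) -> measurable (trect A).
Proof.
move=> mA; rewrite (_ : trect A =
  \bigcap_(i in [set: 'I_n]) ((fun t : n.-tuple X => tnth t i) @^-1` A i)).
  apply: fin_bigcap_measurable => [|i _]; first exact: finite_finset.
  by rewrite -[X in measurable X]setTI; exact: measurable_tnth.
by apply/seteqP; split=> t tA i; [move=> _|]; exact: tA.
Qed.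

Lemma tpow_trect n (A : 'I_n -> set X) : (forall i, measurable (A i)) ->
  tpow n (trect A) = (\prod_i U (A i))%E.
Proof.
elim: n A => [|n IH] A mA /=.
  by rewrite big_ord0 diracE mem_set// => -[].
rewrite /distribution /pushforward.
rewrite (_ : _ @^-1` _ = A ord0 `*` trect (fun i => A (lift ord0 i))); last first.
  apply/seteqP; split=> [[x t] /= xtA|[x t] /= [xA tA] i].
    split; first by have := xtA ord0; rewrite /tcons/= tnth0.
    by move=> i; have := xtA (lift ord0 i); rewrite /tcons/= tnthS.
  by case: (unliftP ord0 i) => [j|] ->; rewrite /tcons ?tnthS// tnth0.
rewrite product_measure1E//; last exact: measurable_trect.
by rewrite big_ord_recl; congr (_ * _)%E; exact: IH.
Qed.

Lemma measurable_smeas_tval d' (Y : sigmaRingType d') (F : seq X -> Y) n :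
  smeas F -> measurable_fun [set: n.-tuple X] (fun t => F (tval t)).
Proof.
move=> mF.
have := mF _ _ [seq mk_mfun (@measurable_tnth _ X n i) | i <- enum 'I_n].
apply: eq_measurable_fun => t _; congr F.
by rewrite -map_comp -[RHS]map_tnth_enum.
Qed.

Lemma integral_tpow n (F : seq X -> \bar R) :
  smeas F -> (forall s, 0 <= F s)%E ->
  (\int[tpow n]_t F (tval t) = iint U n F)%E.
Proof.
elim: n F => [|n IH] F mF F0.
  rewrite /= integral_dirac// ?diracT ?mul1e//.
  exact: measurable_smeas_tval.
rewrite /= ge0_integral_distribution//; last exact: measurable_smeas_tval.
have mFc := measurableT_comp (measurable_smeas_tval (n:=n.+1) mF) (@measurable_tcons n).
rewrite (@fubini_tonelli1 _ _ _ _ R U (tpow n) _ mFc (fun x => F0 _)).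
by apply: eq_integral => x _; rewrite -IH//; exact: smeas_cons.
Qed.

(** Rectangles are closed under intersection, so that two finite measures agreeing on this
    generating family are equal. *)
Lemma tuple_measurableE n :
  @measurable _ (n.-tuple X) =
  <<s [set trect A | A in [set A : 'I_n -> set X | forall i, measurable (A i)]] >>.
Proof.
apply/seteqP; split; last first.
  apply: smallest_sub; first exact: sigma_algebra_measurable.
  by move=> _ [A mA <-]; exact: measurable_trect.
apply: smallest_sub; first exact: smallest_sigma_algebra.
move=> B; rewrite -bigcup_seq => -[i /= _ [A mA <-]].
apply: sub_gen_smallest; exists (fun j => if j == i then A else setT).
  by move=> j; case: ifP.
apply/seteqP; split=> [t tA|t [_ tA] j /=]; last by case: eqP => // ->.
by split=> //; have := tA i; rewrite eqxx.
Qed.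

End tuple_power.

Section janossy.
Context d (T : measurableType d) (R : realType) (P : probability T R).
Variables (G : random_network P) (rho : R).
Hypothesis rho_ge0 : 0 <= rho.
Hypothesis GP : poisson_on_square G rho.
Local Notation S := (@unit_square R).
Local Notation U := (@square_unif R).

(* The symmetrised law of the positions of the [n] nodes is Lebesgue measure
   up to a constant; a symmetric function does not see the symmetrisation. *)
Lemma janossy n (F : seq (plane R) -> \bar R) :
  smeas F -> (forall s, 0 <= F s)%E ->
  (forall s s', perm_eq s s' -> F s = F s') ->
  (\int[P]_(w in [set w | nodes G w = n]) F [seq pos G i w | i <- iota 0 n] =
   (poisson_weight rho n)%:E * iint U n F)%E.
Proof.
move=> mF F0 FP.
have mphi (q : seq nat) : measurable_fun setT
    (fun w => [tuple pos G (nth 0%N q i) w | i < n]).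
  apply/measurable_fun_tnthP => i.
  rewrite (_ : _ \o _ = pos G (nth 0%N q i)); first exact: measurable_funPT.
  by apply/funext => w /=; rewrite tnth_mktuple.
pose PR := mrestr P (measurable_nodes G n).
pose ps := permutations (iota 0 n).
(* The law of the positions read in the order of a permutation, summed over all permutations and
   restricted to samples with [n] nodes. Its value on a rectangle is the left-hand side of
   [poisson_rectangle]. *)
pose nu := msum (fun k => 
  mpush [the {measure set _ -> \bar R} of PR] (mphi (nth [::] ps k))) (size ps).
have c0 : 0 <= expR (- rho) * rho ^+ n by rewrite mulr_ge0 ?expR_ge0 ?exprn_ge0.
pose mu := mscale (NngNum c0) (tpow U n).
have nu_mu B : measurable B -> nu B = mu B.
  apply: (measure_unique _ (fun=> setT) (tuple_measurableE (plane R) n)).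
  - move=> _ _ [A mA <-] [B' mB <-]; exists (fun i => A i `&` B' i).
      by move=> i; exact: measurableI.
    apply/seteqP; split=> [t tAB|t [tA tB] i].
      by split=> i; have [] := tAB i.
    by split; [exact: tA|exact: tB].
  - by move=> _; exists (fun=> setT) => //; apply/seteqP.
  - by rewrite bigcup_const//; exists 0%N.
  - move=> _ [A mA <-].
    transitivity ((expR (- rho) * rho ^+ n)%:E * \prod_i U (A i))%E; last first.
      by congr (_ * _)%E; apply/esym; exact: tpow_trect.
    rewrite /nu /msum/=.
    have := poisson_rectangle rho_ge0 GP mA.
    rewrite (big_nth [::]) big_mkord => E.
    transitivity ((\sum_(i0 < size ps) P
      [set w | nodes G w = n /\ forall i : 'I_n, A i (pos G (nth 0%N (nth [::] ps i0) i) w)])%E).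
      apply: eq_bigr => k _; rewrite mpushE /PR /mrestr; congr (P _).
      apply/seteqP; split=> [w [wA nw]|w [nw wA]]; split => //= i.
        by have := wA i; rewrite tnth_mktuple.
      by rewrite tnth_mktuple.
    rewrite E.
    rewrite [in RHS](eq_bigr (fun i => (fine (area (S `&` A i)))%:E)); last first.
      move=> i _; rewrite -[LHS]/(square_unif (A i)) square_unifE setIC /area fineK//.
      rewrite -[X in X \is a fin_num]/(area (S `&` A i)) setIC.
      exact: (fin_num_measure U).
    rewrite prodEFin -EFinM; congr EFin.
    by rewrite big_split/= prodr_const card_ord mulrA.
  - move=> _; apply: lte_sum_pinfty => k _; rewrite mpushE.
    rewrite (le_lt_trans (probability_le1 P _)) ?ltry//.
    apply: measurableI; last exact: measurable_nodes.
    by rewrite preimage_setT.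
have mFt := measurable_smeas_tval (n:=n) mF.
have I1 : (\int[nu]_t F (tval t) = \sum_(k < size ps)
    \int[P]_(w in [set w | nodes G w = n]) F [seq pos G i w | i <- iota 0 n])%E.
  rewrite ge0_integral_measure_sum//; apply: eq_bigr => k _.
  rewrite integral_mpush// integral_mrestr//; last first.
    exact: (measurableT_comp mFt (mphi _)).
  apply: eq_integral => w _; apply: FP.
  have kps : nth [::] ps k \in ps by exact: mem_nth.
  move: kps; rewrite /ps mem_permutations => kps.
  suff -> : tval [tuple pos G (nth 0%N (nth [::] ps k) i) w | i < n] =
      [seq pos G i w | i <- nth [::] ps k] by exact: perm_map.
  have sq : size (nth [::] ps k) = n by rewrite (perm_size kps) size_iota.
  rewrite -[in RHS](mkseq_nth 0%N (nth [::] ps k)) sq /mkseq -val_enum_ord.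
  by rewrite -map_comp -map_comp.
have I2 : (\int[mu]_t F (tval t) = (expR (- rho) * rho ^+ n)%:E * iint U n F)%E.
  by rewrite ge0_integral_mscale// integral_tpow.
have : (\int[nu]_t F (tval t) = \int[mu]_t F (tval t))%E.
  by apply: eq_measure_integral => B mB _; exact: nu_mu.
rewrite I1 I2; set J := (X in (\sum_(_ < _) X)%E) => E.
(* All the terms of the sum over permutations are equal because [F] is symmetric; their number gives
   the factorial in the Poisson weight. *)
have {}E : (n`!%:R%:E * J = (expR (- rho) * rho ^+ n)%:E * iint U n F)%E.
  rewrite -E; under [RHS]eq_bigr do rewrite -(mul1e J).
  rewrite -ge0_sume_distrl ?lee_fin// sumEFin sumr_const card_ord.
  by rewrite (size_permutations (iota_uniq 0 n)) size_iota.
have nz : n`!%:R != 0 :> R by rewrite pnatr_eq0 -lt0n fact_gt0.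
rewrite -[LHS]mul1e -(mulVf nz) EFinM -muleA E muleA -EFinM.
by congr (_%:E * _)%E; rewrite /poisson_weight mulrC.
Qed.

End janossy.

(** * Factorial moments of the number of isolated nodes *)

Lemma measurable_prod_cond d (T : measurableType d) (R : realType) (D : set T)
    (I : eqType) (s : seq I) (Q : pred I) (h : I -> T -> R) :
  (forall i, measurable_fun D (h i)) ->
  measurable_fun D (fun x => \prod_(i <- s | Q i) h i x).
Proof.
move=> mh; under eq_fun do rewrite -big_filter.
exact: measurable_prod.
Qed.

Section no_edges.
Context d (T : measurableType d) (R : realType) (P : probability T R).
Variables (G : random_network P) (h : R -> R).
Hypothesis h01 : forall x, 0 <= x -> 0 <= h x <= 1.
Hypothesis mh : measurable_fun setT
  (fun z : plane R * plane R => h (eucl_norm (z.1 - z.2))).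
Hypothesis Gh : connects_with G h.

Lemma eucl_norm_ge0 (x : R * R) : 0 <= eucl_norm x.
Proof. exact: sqrtr_ge0. Qed.

Local Notation hh i j w := (h (eucl_norm (pos G i w - pos G j w))).

Lemma measurable_hh i j : measurable_fun setT (fun w => hh i j w).
Proof.
have mp : measurable_fun setT (fun w => (pos G i w, pos G j w)).
  by apply: measurable_fun_pair; exact: measurable_funPT.
exact: (measurableT_comp mh mp).
Qed.

Lemma hh01 i j w : 0 <= hh i j w <= 1.
Proof. exact/h01/eucl_norm_ge0. Qed.

Lemma measurable_positions_in n (D : set (n.-tuple (plane R))) :
  measurable D -> measurable (positions_in G D).
Proof.
move=> mD; apply: measurableI; first exact: measurable_nodes.
rewrite -[X in measurable X]setTI.
suff : measurable_fun setT (fun w => [tuple pos G i w | i < n]) by exact.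
apply/measurable_fun_tnthP => i.
rewrite (_ : _ \o _ = pos G i); first exact: measurable_funPT.
by apply/funext => w /=; rewrite tnth_mktuple.
Qed.

Lemma measurable_edge i j b : measurable [set w | edge G i j w = b].
Proof.
rewrite (_ : [set _ | _] = edge G i j @^-1` [set b])//.
exact: measurable_funPTI.
Qed.

Let ev n (H : {set 'I_n * 'I_n}) b :=
  [set w | forall e, e \in H -> edge G e.1 e.2 w = b].

Let mev n (H : {set 'I_n * 'I_n}) b : measurable (ev H b).
Proof.
rewrite (_ : ev H b = \bigcap_(e in [set` H]) [set w | edge G e.1 e.2 w = b])//.
apply: fin_bigcap_measurable => [|e _]; first exact: finite_finset.
exact: measurable_edge.
Qed.

(** [connects_with] speaks of edges that are present. A pair [e] required to be absent is removed by
    a difference: the event without any condition on [e], minus the event with [e] present. Both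
    have one absent pair fewer, and the factor [1 - h] appears when the integrals are subtracted. *)
Lemma connects_with_absent n (D : set (n.-tuple (plane R)))
    (H1 H2 : {set 'I_n * 'I_n}) :
  measurable D -> (forall e, e \in H1 :|: H2 -> (e.1 < e.2)%N) ->
  (forall e, e \in H1 -> e \notin H2) ->
  P (positions_in G D `&` (ev H1 true `&` ev H2 false)) =
  (\int[P]_(w in positions_in G D)
     (\prod_(e in H1) hh e.1 e.2 w * \prod_(e in H2) (1 - hh e.1 e.2 w))%:E)%E.
Proof.
move=> mD; move: {2}#|H2| (leqnn #|H2|) => k; elim: k H1 H2 => [|k IH] H1 H2.
  rewrite leqn0 cards_eq0 => /eqP -> H12 _.
  rewrite (_ : ev finset.set0 false = setT) ?setIT; last first.
    by apply/seteqP; split=> // w _ e; rewrite inE.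
  rewrite Gh//; last by move=> e eH; apply: H12; rewrite inE eH.
  by apply: eq_integral => w _; rewrite [in RHS]big_set0 mulr1.
have [->|[e eH2]] := finset.set_0Vmem H2.
  by move=> _; apply: IH; rewrite cards0.
move=> cH2 H12 dH.
pose H2' := H2 :\ e.
have cH2' : (#|H2'| <= k)%N by move: cH2; rewrite (cardsD1 e) eH2.
have eH1 : e \notin H1 by apply/negP => /dH; rewrite eH2.
have IH1 : P (positions_in G D `&` (ev H1 true `&` ev H2' false)) =
  (\int[P]_(w in positions_in G D)
     (\prod_(e in H1) hh e.1 e.2 w * \prod_(e in H2') (1 - hh e.1 e.2 w))%:E)%E.
  apply: IH => // f; last by move=> /dH; rewrite !inE negb_and => ->; rewrite orbT.
  by move=> fH; apply: H12; move: fH; rewrite !inE => /orP[->//|/andP[_ ->]]; rewrite orbT.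
have IH2 : P (positions_in G D `&` (ev (e |: H1) true `&` ev H2' false)) =
  (\int[P]_(w in positions_in G D)
     (\prod_(f in e |: H1) hh f.1 f.2 w * \prod_(f in H2') (1 - hh f.1 f.2 w))%:E)%E.
  apply: IH => // f.
    move=> fH; apply: H12; move: fH; rewrite !inE => /orP[/orP[/eqP->|->//]|/andP[_ ->]];
    by rewrite ?eH2 orbT.
  rewrite !inE => /orP[/eqP->|/dH fH2]; first by rewrite eqxx.
  by rewrite negb_and fH2 orbT.
pose A0 := positions_in G D `&` (ev H1 true `&` ev H2' false).
pose A1 := positions_in G D `&` (ev (e |: H1) true `&` ev H2' false).
pose A2 := positions_in G D `&` (ev H1 true `&` ev H2 false).
have mpD := measurable_positions_in mD.
have mA1 : measurable A1 by apply: measurableI => //; exact: measurableI.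
have mA2 : measurable A2 by apply: measurableI => //; exact: measurableI.
have A12 : A0 = A1 `|` A2.
  apply/seteqP; split=> [w [Dw [w1 w2]]|w].
    case: (boolP (edge G e.1 e.2 w)) => [we|/negbTE we]; [left|right].
      by split=> //; split=> // f; rewrite !inE => /orP[/eqP ->//|]; exact: w1.
    split=> //; split=> // f fH; have [->//|fe] := eqVneq f e.
    by apply: w2; rewrite !inE fe.
  case=> -[Dw [w1 w2]]; split=> //; split=> //.
    by move=> f fH; apply: w1; rewrite !inE fH orbT.
  by move=> f fH; apply: w2; move: fH; rewrite !inE => /andP[].
have A12d : A1 `&` A2 = set0.
  apply/seteqP; split=> // w [[_ [w1 _]] [_ [_ w2]]].
  by have := w1 e; rewrite !inE eqxx (w2 _ eH2) => /(_ isT).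
have PA : P A0 = (P A1 + P A2)%E by rewrite A12 measureU.
pose a w := \prod_(f in H1) hh f.1 f.2 w * \prod_(f in H2') (1 - hh f.1 f.2 w).
have a0 w : 0 <= a w.
  by apply: mulr_ge0; apply: prodr_ge0 => f _; have /andP[] := hh01 f.1 f.2 w;
    rewrite ?subr_ge0.
have ma : measurable_fun setT a.
  apply: measurable_funM; apply: measurable_prod_cond => f.
    exact: measurable_hh.
  by apply: measurable_funB => //; exact: measurable_hh.
have mD' : measurable_fun (positions_in G D) a by exact: measurable_funTS.
have mhe : measurable_fun (positions_in G D) (fun w => hh e.1 e.2 w).
  by apply: measurable_funTS; exact: measurable_hh.
have he0 w : 0 <= hh e.1 e.2 w by have /andP[] := hh01 e.1 e.2 w.
have he1 w : 0 <= 1 - hh e.1 e.2 w by have /andP[] := hh01 e.1 e.2 w; rewrite subr_ge0.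
have split_int : (\int[P]_(w in positions_in G D) (a w)%:E =
   \int[P]_(w in positions_in G D) (hh e.1 e.2 w * a w)%:E +
   \int[P]_(w in positions_in G D) ((1 - hh e.1 e.2 w) * a w)%:E)%E.
  rewrite -ge0_integralD//; first last.
  - apply/measurable_EFinP; apply: measurable_funM => //.
    exact: measurable_funB.
  - by move=> w _; rewrite lee_fin mulr_ge0.
  - by apply/measurable_EFinP; exact: measurable_funM.
  - by move=> w _; rewrite lee_fin mulr_ge0.
  by apply: eq_integral => w _; rewrite -EFinD -mulrDl addrC subrK mul1r.
have I1 : (\int[P]_(w in positions_in G D) (\prod_(f in e |: H1) hh f.1 f.2 w *
    \prod_(f in H2') (1 - hh f.1 f.2 w))%:E =
    \int[P]_(w in positions_in G D) (hh e.1 e.2 w * a w)%:E)%E.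
  by apply: eq_integral => w _; rewrite big_setU1//= mulrA.
have I2 : (\int[P]_(w in positions_in G D) (\prod_(f in H1) hh f.1 f.2 w *
    \prod_(f in H2) (1 - hh f.1 f.2 w))%:E =
    \int[P]_(w in positions_in G D) ((1 - hh e.1 e.2 w) * a w)%:E)%E.
  by apply: eq_integral => w _; rewrite (big_setD1 e eH2)/= /a -/H2'; congr EFin; ring.
have A1fin : P A1 \is a fin_num by exact: fin_num_measure.
move: IH1; rewrite -[LHS]/(P A0) PA split_int -I1 -IH2 I2 -/A2.
have addKe (x y : \bar R) : x \is a fin_num -> (x + y - x = y)%E.
  by move=> xf; rewrite [X in (X - _)%E]addeC addeK.
by move=> /(congr1 (fun x => x - P A1)%E); rewrite !addKe.
Qed.

End no_edges.

Lemma measurable_star_fun d (T : measurableType d) (R : realType) (D : set T)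
    (I : Type) (H : seq I -> seq I -> T -> \bar R) s :
  (forall u v, measurable_fun D (H u v)) ->
  measurable_fun D (fun w => star adde (fun u v => H u v w) s).
Proof.
elim: s H => [|x s IH] H mH /=; first exact: mH.
by apply: emeasurable_funD; [apply: (IH (fun u v => H (x :: u) v))|
  apply: (IH (fun u v => H u (x :: v)))].
Qed.

Lemma integral_star d (T : measurableType d) (R : realType)
    (mu : {measure set T -> \bar R}) (D : set T) (mD : measurable D)
    (I : Type) (H : seq I -> seq I -> T -> \bar R) s :
  (forall u v, measurable_fun D (H u v)) ->
  (forall u v w, 0 <= H u v w)%E ->
  (\int[mu]_(w in D) star adde (fun u v => H u v w) s =
   star adde (fun u v => \int[mu]_(w in D) H u v w) s)%E.
Proof.
elim: s H => [|x s IH] H mH H0 //=.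
rewrite ge0_integralD//.
- by rewrite (IH (fun u v => H (x :: u) v))// (IH (fun u v => H u (x :: v))).
- by move=> w _; exact: star_ge0.
- exact: (measurable_star_fun s (fun u v => mH (x :: u) v)).
- by move=> w _; exact: star_ge0.
- exact: (measurable_star_fun s (fun u v => mH u (x :: v))).
Qed.

Section pairprod_map.
Context (R : comPzRingType) (X Y : eqType).
Implicit Types t : X -> X -> R.

Lemma pairprod_map t (f : Y -> X) s :
  pairprod t (map f s) = pairprod (fun i j => t (f i) (f j)) s.
Proof. by elim: s => //= i s ->; rewrite big_map. Qed.

Lemma crossprod_map t (f : Y -> X) u v :
  crossprod t (map f u) (map f v) = crossprod (fun i j => t (f i) (f j)) u v.
Proof.
by rewrite /crossprod big_map; apply: eq_bigr => i _; rewrite big_map.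
Qed.

Lemma eq_in_pairprod t t' s : {in s &, t =2 t'} -> pairprod t s = pairprod t' s.
Proof.
elim: s => //= x s IH e; congr (_ * _).
  by apply: eq_big_seq => y ys; rewrite e ?inE ?eqxx ?ys ?orbT.
by apply: IH => y z ys zs; rewrite e ?inE ?ys ?zs ?orbT.
Qed.

Lemma eq_in_crossprod t t' u v : {in u & v, t =2 t'} ->
  crossprod t u v = crossprod t' u v.
Proof.
by move=> e; apply: eq_big_seq => x xu; apply: eq_big_seq => y yv; exact: e.
Qed.

Lemma pairprod1 s : pairprod (fun _ _ : X => 1 : R) s = 1.
Proof. by elim: s => //= _ s ->; rewrite big1// mulr1. Qed.

End pairprod_map.

Section moments.
Context d (T : measurableType d) (R : realType) (P : probability T R).
Variables (G : random_network P) (h : R -> R) (rho : R).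
Hypothesis rho_ge0 : 0 <= rho.
Hypothesis GP : poisson_on_square G rho.
Hypothesis h01 : forall x, 0 <= x -> 0 <= h x <= 1.
Hypothesis mh : measurable_fun setT
  (fun z : plane R * plane R => h (eucl_norm (z.1 - z.2))).
Hypothesis Gh : connects_with G h.
Variable B : set (plane R).
Hypothesis mB : measurable B.

Definition absent (x y : plane R) : R := 1 - h (eucl_norm (x - y)).

Lemma absentC x y : absent x y = absent y x.
Proof.
rewrite /absent /eucl_norm; congr (1 - h (Num.sqrt _)) => /=.
by rewrite -(opprB y.1) -(opprB y.2) !sqrrN.
Qed.

Lemma absent_ge0 x y : 0 <= absent x y.
Proof. by rewrite subr_ge0; have /andP[] := h01 (eucl_norm_ge0 (x - y)). Qed.

Lemma absent_le1 x y : absent x y <= 1.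
Proof. by rewrite gerBl; have /andP[] := h01 (eucl_norm_ge0 (x - y)). Qed.

Definition isolated_at n w i :=
  all (fun j => (j == i) || ~~ edge G i j w) (iota 0 n).

Definition num_isolated_in w :=
  count (fun i => isolated_at (nodes G w) w i && (pos G i w \in B))
    (iota 0 (nodes G w)).

Let Hn n k (u v : seq nat) : set T :=
  [set w | size u = k /\ all (fun i => pos G i w \in B) u /\ all (isolated_at n w) u].

Let mall (Q : nat -> T -> bool) (s : seq nat) :
  (forall i, measurable [set w | Q i w]) -> measurable [set w | all (Q^~ w) s].
Proof.
move=> mQ; elim: s => [|i s IH] /=.
  by rewrite (_ : [set _ | _] = setT)//; apply/seteqP.
rewrite (_ : [set _ | _] = [set w | Q i w] `&` [set w | all (Q^~ w) s]).
  exact: measurableI.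
by apply/seteqP; split=> w /=; move/andP.
Qed.

Let mHn n k u v : measurable (Hn n k u v).
Proof.
rewrite (_ : Hn n k u v = (if size u == k then setT else set0) `&`
    ([set w | all (fun i => pos G i w \in B) u] `&` [set w | all (isolated_at n w) u])).
  apply: measurableI; first by case: ifP.
  apply: measurableI.
    apply: (mall (Q := fun i w => pos G i w \in B)) => i.
    rewrite (_ : [set _ | _] = [set w | B (pos G i w)]); first exact: measurable_pos_in.
    by apply/seteqP; split=> w /=; [move/set_mem|move/mem_set].
  apply: (mall (Q := fun i w => isolated_at n w i)) => i.
  apply: (mall (Q := fun j w => (j == i) || ~~ edge G i j w)) => j.
  case: (j == i) => /=; first by rewrite (_ : [set _ | _] = setT)//; apply/seteqP.
  rewrite (_ : [set _ | _] = [set w | edge G i j w = false]); first exact: measurable_edge.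
  by apply/seteqP; split=> w /=; [move/negbTE|move=> ->].
apply/seteqP; split=> w /=; first by case=> uk [w1 w2]; rewrite uk eqxx.
by case: eqP => [uk [_ [w1 w2]]|_ []].
Qed.

Let bin_star k w : ('C(num_isolated_in w, k))%:R%:E =
  star adde (fun u v => (\1_(Hn (nodes G w) k u v) w)%:E) (iota 0 (nodes G w)) :> \bar R.
Proof.
rewrite /num_isolated_in -star_binomial.
rewrite (star_morph (op' := adde) (f := @EFin R)); last by move=> a b; rewrite EFinD.
apply: eq_star => u v; rewrite indicE; congr (_%:R%:E).
rewrite all_predI; case: (eqVneq (size u) k) => /= uk; last first.
  by rewrite memNset// => -[ku]; rewrite ku eqxx in uk.
case: (boolP (all _ _)) => /= p1; last first.
  by rewrite memNset// => -[_ [_ p2]]; rewrite p2 in p1.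
case: (boolP (all _ _)) => /= p2; last first.
  by rewrite memNset// => -[_ [p3 _]]; rewrite p3 in p2.
by rewrite mem_set.
Qed.

(** For nodes at [u ++ v], the conditional probability that [u] consists of [k] isolated nodes in
    [B]. Edges inside [v] are unconstrained, hence no [pairprod] of [v]. *)
Definition moment_kernel k (u v : seq (plane R)) : R :=
  ((size u == k) && all (fun x => x \in B) u)%:R * pairprod absent u *
  crossprod absent u v.

Let kernel_nodes n k u v w : perm_eq (u ++ v) (iota 0 n) ->
  moment_kernel k [seq pos G i w | i <- u] [seq pos G i w | i <- v] =
  ((size u == k) && all (fun i => pos G i w \in B) u)%:R *
  \prod_(e : 'I_n * 'I_n | (e.1 < e.2)%N && ((val e.1 \in u) || (val e.2 \in u)))
    (1 - h (eucl_norm (pos G e.1 w - pos G e.2 w))).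
Proof.
move=> uv; rewrite /moment_kernel size_map all_map -mulrA; congr (_ * _).
(* Giving weight 1 to the pairs that avoid [u] makes the kernel a single [pairprod] over all labels.
   This is invariant under permutation, so the labels can be put back in increasing order and each
   pair is met once, smaller label first. *)
pose tau (i j : nat) : R :=
  if (i \in u) || (j \in u) then absent (pos G i w) (pos G j w) else 1.
have tauC i j : tau i j = tau j i by rewrite /tau orbC absentC.
have uniq_uv : uniq (u ++ v) by rewrite (perm_uniq uv) iota_uniq.
have -> : pairprod absent [seq pos G i w | i <- u] *
    crossprod absent [seq pos G i w | i <- u] [seq pos G i w | i <- v] =
    pairprod tau (u ++ v).
  rewrite pairprod_cat pairprod_map crossprod_map.
  have nuv j : j \in v -> j \notin u.
    move=> jv; apply/negP => ju; move: uniq_uv; rewrite cat_uniq => /and3P[_ /hasPn/(_ j jv)].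
    by rewrite /= ju.
  rewrite [X in _ = _ * X](@eq_in_pairprod _ _ _ (fun _ _ => 1)) ?pairprod1 ?mulr1.
    congr (_ * _); first by apply: eq_in_pairprod => i j iu ju; rewrite /tau iu.
    by apply: eq_in_crossprod => i j iu jv; rewrite /tau iu.
  by move=> i j /nuv/negbTE iv /nuv/negbTE jv; rewrite /tau iv jv.
rewrite (perm_pairprod tauC uv) -[X in pairprod tau X]map_id pairprod_iota.
rewrite add0n big_mkord.
under eq_bigr do rewrite big_geq_mkord.
rewrite pair_big_dep/= [RHS]big_mkcondr.
by apply: eq_big => [e|e _]; rewrite ?andbT ?andTb //.
Qed.

Let integral_Hn n k u v : perm_eq (u ++ v) (iota 0 n) ->
  (\int[P]_(w in [set w | nodes G w = n]) (\1_(Hn n k u v) w)%:E =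
   \int[P]_(w in [set w | nodes G w = n])
     (moment_kernel k [seq pos G i w | i <- u] [seq pos G i w | i <- v])%:E)%E.
Proof.
move=> uv.
have un i : i \in u -> (i < n)%N.
  move=> iu; have : i \in iota 0 n by rewrite -(perm_mem uv) mem_cat iu.
  by rewrite mem_iota.
case: (eqVneq (size u) k) => [uk|uk]; last first.
  apply: eq_integral => w _; rewrite indicE memNset; last by case=> /eqP; rewrite (negbTE uk).
  by rewrite /moment_kernel size_map (negbTE uk) !mul0r.
pose D : set (n.-tuple (plane R)) := trect (fun i : 'I_n => if (i : nat) \in u then B else setT).
have mD : measurable D by apply: measurable_trect => i; case: ifP.
pose H2 : {set 'I_n * 'I_n} :=
  [set e : 'I_n * 'I_n | (e.1 < e.2)%N && (((e.1 : nat) \in u) || ((e.2 : nat) \in u))]%SET.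
have posD w : positions_in G D w <->
    nodes G w = n /\ all (fun i => pos G i w \in B) u.
  split=> -[nw]; rewrite /D /trect/= => wD; split=> //.
    apply/allP => i iu; have := wD (Ordinal (un _ iu)); rewrite tnth_mktuple/= iu.
    exact: mem_set.
  by move=> i; rewrite tnth_mktuple; case: ifP => // iu; apply: set_mem; exact: (allP wD).
have E1 : [set w | nodes G w = n] `&` Hn n k u v =
    positions_in G D `&` ([set w | forall e, e \in (finset.set0 : {set 'I_n * 'I_n}) -> edge G e.1 e.2 w = true]
      `&` [set w | forall e, e \in H2 -> edge G e.1 e.2 w = false]).
  apply/seteqP; split=> w.
    move=> [nw [_ [wB /allP wi]]]; split; first by apply/posD.
    split=> [e|e]; first by rewrite inE.
    rewrite inE => /andP[e12 eu]; apply/negbTE.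
    have iso i j : i \in u -> (j < n)%N -> j != i -> ~~ edge G i j w.
      move=> iu jn ji; have /allP/(_ j) := wi i iu.
      by rewrite mem_iota add0n jn (negbTE ji); apply.
    case/orP: eu => eu; first by apply: iso => //; rewrite ?ltn_ord// gtn_eqF.
    by rewrite edge_sym; apply: iso => //; rewrite ?ltn_ord// ltn_eqF.
  move=> [/posD[nw wB] [_ we]]; split=> //; split=> //; split=> //.
  apply/allP => i iu; apply/allP => j; rewrite mem_iota add0n /= => jn.
  have [->//|ji] := eqVneq j i; apply/negbT.
  move: ji; rewrite neq_ltn => /orP[ji|ij].
    by rewrite edge_sym; apply: (we (Ordinal jn, Ordinal (un _ iu))); rewrite inE/= ji iu orbT.
  by apply: (we (Ordinal (un _ iu), Ordinal jn)); rewrite inE/= ij iu.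
have Hsub (e : 'I_n * 'I_n) : e \in (finset.set0 : {set 'I_n * 'I_n}) :|: H2 -> (e.1 < e.2)%N.
  by rewrite !inE => /andP[].
have H0 (e : 'I_n * 'I_n) : e \in (finset.set0 : {set 'I_n * 'I_n}) -> e \notin H2 by rewrite inE.
rewrite integral_indic//; last exact: measurable_nodes.
rewrite setIC E1; apply: (eq_trans (connects_with_absent h01 mh Gh mD Hsub H0)).
rewrite (_ : positions_in G D = [set w | nodes G w = n] `&`
  [set w | all (fun i => pos G i w \in B) u]); last first.
  by apply/seteqP; split=> w; move/posD.
rewrite integral_mkcondr; apply: eq_integral => w _.
rewrite patchE (kernel_nodes _ _ uv) uk eqxx /= big_set0 mul1r.
case: ifPn => [/set_mem /= ->|]; first by rewrite mul1r; congr EFin; apply: eq_bigl => e; rewrite inE.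
by move=> wB; rewrite (_ : all _ _ = false) ?mul0r//; apply/negbTE; apply: contra wB => /mem_set.
Qed.

Let mabsent : measurable_fun setT (fun z : plane R * plane R => absent z.1 z.2).
Proof. exact: measurable_funB. Qed.

Let mabsent2 dz (Z : measurableType dz) (f g : {mfun Z >-> plane R}) :
  measurable_fun setT (fun z => absent (f z) (g z)).
Proof.
have mp : measurable_fun setT (fun z => (f z, g z)).
  by apply: measurable_fun_pair; exact: measurable_funPT.
exact: (measurableT_comp mabsent mp).
Qed.

Lemma measurable_prod_absent dz (Z : measurableType dz) (f : {mfun Z >-> plane R})
    (gs : seq {mfun Z >-> plane R}) :
  measurable_fun setT
    (fun z => \prod_(y <- [seq g z | g : {mfun Z >-> plane R} <- gs]) absent (f z) y).
Proof.
elim: gs => [|g gs IH] /=; first by under eq_fun do rewrite big_nil; exact: measurable_cst.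
by under eq_fun do rewrite big_cons; apply: measurable_funM; [exact: mabsent2|].
Qed.

Lemma smeas2_crossprod : smeas2 (crossprod absent).
Proof.
move=> dz Z fs gs; rewrite /crossprod; elim: fs => [|f fs IH] /=.
  by under eq_fun do rewrite big_nil; exact: measurable_cst.
under eq_fun do rewrite big_cons; apply: measurable_funM => //.
exact: measurable_prod_absent.
Qed.

Lemma smeas_pairprod : smeas (pairprod absent).
Proof.
move=> dz Z; elim=> [|f fs IH] //=; apply: measurable_funM => //.
exact: measurable_prod_absent.
Qed.

Lemma smeas_all : smeas (fun u => (all (fun x => x \in B) u)%:R : R).
Proof.
move=> dz Z; elim=> [|f fs IH] //=.
under eq_fun do rewrite -mulnb natrM.
apply: measurable_funM => //.
exact: (measurableT_comp (measurable_indic mB) (measurable_funPT f)).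
Qed.

Lemma crossprod_ge0 u v : 0 <= crossprod absent u v.
Proof. by do 2![apply: prodr_ge0 => ? _]; exact: absent_ge0. Qed.

Lemma pairprod_ge0 u : 0 <= pairprod absent u.
Proof.
by elim: u => //= x u IH; rewrite mulr_ge0// prodr_ge0// => ? _; exact: absent_ge0.
Qed.

Let K0 k (u : seq (plane R)) : R :=
  ((size u == k) && all (fun x => x \in B) u)%:R * pairprod absent u.

Let K0_ge0 k u : 0 <= K0 k u.
Proof. by rewrite mulr_ge0// pairprod_ge0. Qed.

Let smeas_K0 k : smeas (K0 k).
Proof.
move=> dz Z fs; apply: measurable_funM; last exact: smeas_pairprod.
under eq_fun do rewrite size_map -mulnb natrM.
by apply: measurable_funM => //; exact: smeas_all.
Qed.

Let K_ge0 k u v : 0 <= moment_kernel k u v.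
Proof. by rewrite mulr_ge0 ?K0_ge0// crossprod_ge0. Qed.

Let smeas2_K k : smeas2 (fun u v => (moment_kernel k u v)%:E).
Proof.
move=> dz Z fs gs; apply/measurable_EFinP; apply: measurable_funM.
  exact: smeas_K0.
exact: smeas2_crossprod.
Qed.

Local Notation U := (@square_unif R).

Definition miss (u : seq (plane R)) : R :=
  fine (\int[U]_y (\prod_(x <- u) absent x y)%:E)%E.

Lemma prod_absent_ge0 u y : 0 <= \prod_(x <- u) absent x y.
Proof. by rewrite prodr_ge0// => ? _; exact: absent_ge0. Qed.

Lemma prod_absent_le1 u y : \prod_(x <- u) absent x y <= 1.
Proof.
by rewrite prodr_ile1// => x _; rewrite absent_ge0 absent_le1.
Qed.

Lemma measurable_prod_absentl u :
  measurable_fun setT (fun y => \prod_(x <- u) absent x y).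
Proof.
elim: u => [|x u IH]; first by under eq_fun do rewrite big_nil; exact: measurable_cst.
under eq_fun do rewrite big_cons; apply: measurable_funM => //.
exact: (mabsent2 (mk_mfun (measurable_cst x)) (mk_mfun (@measurable_id _ _ setT))).
Qed.

Lemma miss_int u : (\int[U]_y (\prod_(x <- u) absent x y)%:E)%E = (miss u)%:E.
Proof.
rewrite /miss fineK// ge0_fin_numE; last first.
  by apply: integral_ge0 => y _; rewrite lee_fin prod_absent_ge0.
apply: (@le_lt_trans _ _ (\int[U]_y (cst 1%E) y)%E).
  apply: ge0_le_integral => //.
  - by move=> y _; rewrite lee_fin prod_absent_ge0.
  - by apply/measurable_EFinP; exact: measurable_prod_absentl.
  - by move=> y _; rewrite lee_fin prod_absent_le1.
rewrite integral_cst// mul1e (le_lt_trans _ (ltry 1))//.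
by have := probability_le1 U measurableT.
Qed.

Lemma miss_ge0 u : 0 <= miss u.
Proof.
by apply/fine_ge0/integral_ge0 => y _; rewrite lee_fin prod_absent_ge0.
Qed.

Lemma smeas_miss : smeas miss.
Proof.
move=> dz Z fs.
suff : measurable_fun setT (fun z =>
    \int[U]_y (\prod_(x <- [seq f z | f : {mfun Z >-> plane R} <- fs]) absent x y)%:E)%E.
  by move=> mf; apply: measurableT_comp mf.
apply: (@measurable_fun_fubini_tonelli_F _ _ Z (plane R) R U
  (fun z => (\prod_(x <- [seq f z.1 | f : {mfun Z >-> plane R} <- fs]) absent x z.2)%:E)).
  apply/measurable_EFinP.
  have := @measurable_prod_absent _ (Z * plane R)%type (mk_mfun measurable_snd)
    [seq mk_mfun (measurableT_comp (measurable_funPT f) measurable_fst)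
          | f : {mfun Z >-> plane R} <- fs].
  apply: eq_measurable_fun => z _; rewrite !big_map; apply: eq_bigr => f _.
  by rewrite absentC.
by move=> z; rewrite lee_fin prod_absent_ge0.
Qed.

Let iint_crossprod m u :
  iint U m (fun v => (crossprod absent u v)%:E) = (miss u ^+ m)%:E.
Proof.
elim: m => [|m IH] /=.
  by rewrite /crossprod big1// => x _; rewrite big_nil.
under eq_integral => y _.
  rewrite (eq_iint _ (F' := fun v => (\prod_(x <- u) absent x y)%:E *
      (crossprod absent u v)%:E)%E); last first.
    move=> v _; rewrite crossprodC; last exact: absentC.
    rewrite crossprod_cons -EFinM -crossprodC; last exact: absentC.
    by congr (_ * _)%:E; apply: eq_bigr => x _; rewrite absentC.
  rewrite iintZl ?IH ?lee_fin ?prod_absent_ge0//; first over.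
  - by move=> dz Z fs; apply/measurable_EFinP; exact: (smeas2_r u smeas2_crossprod).
  - by move=> s; rewrite lee_fin crossprod_ge0.
rewrite /= ge0_integralZr ?miss_int//.
- by rewrite exprS EFinM.
- by apply/measurable_EFinP; exact: measurable_prod_absentl.
- by move=> y _; rewrite lee_fin prod_absent_ge0.
- by rewrite lee_fin exprn_ge0// miss_ge0.
Qed.

Let iint_K k m u :
  iint U m (fun v => (moment_kernel k u v)%:E) = (K0 k u * miss u ^+ m)%:E.
Proof.
have mc : smeas (fun v => (crossprod absent u v)%:E).
  by move=> dz Z fs; apply/measurable_EFinP; exact: (smeas2_r u smeas2_crossprod).
have c0 v : (0 <= (crossprod absent u v)%:E)%E by rewrite lee_fin crossprod_ge0.
by rewrite EFinM -iint_crossprod -iintZl ?lee_fin//.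
Qed.

Let F k := star adde (fun u v => (moment_kernel k u v)%:E).

Let perm_F k s s' : perm_eq s s' -> F k s = F k s'.
Proof.
move=> ss'; apply: (@star_perm _ (\bar R)) => // u u' v v' uu' vv'; congr EFin.
rewrite /moment_kernel (perm_size uu') (perm_all _ uu') (perm_pairprod absentC uu').
by congr (_ * _); exact: perm_crossprod.
Qed.

Let F_ge0 k s : (0 <= F k s)%E.
Proof. by apply: star_ge0 => u v; rewrite lee_fin. Qed.

Let smeas_F k : smeas (F k).
Proof. by apply: smeas_star => // u v; rewrite lee_fin. Qed.

(** The kernel vanishes unless [u] has [k] points, which leaves one term of [iint_star]. The other
    [n - k] points are independent and uniform, and each misses [u] with probability [miss u]. *)
Let iint_F n k : iint U n (F k) =
  (('C(n, k))%:R%:E * iint U k (fun u => (K0 k u * miss u ^+ (n - k))%:E))%E.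
Proof.
rewrite iint_star//; last by move=> u v; rewrite lee_fin.
have zero a : a != k -> iint U a (fun u => iint U (n - a) (fun v => (moment_kernel k u v)%:E)) = 0%E.
  move=> ak; rewrite (eq_iint _ (F' := cst 0%E)) ?iint_cst// => u ua.
  by rewrite iint_K /K0 ua (negbTE ak) !mul0r.
have [kn|nk] := leqP k n; last first.
  rewrite bin_small// mul0e big_nat big1// => a /andP[_ an].
  by rewrite zero ?mule0// neq_ltn (leq_trans an).
rewrite big_mkord (bigD1 (Ordinal (_ : k < n.+1)%N))//= big1 => [|a ak].
  by rewrite adde0; congr (_ * _)%E; apply: eq_iint => u _; rewrite iint_K.
by rewrite zero ?mule0//; apply: contra ak => /eqP ak; apply/eqP/val_inj.
Qed.

Let integral_bin_n n k :
  (\int[P]_(w in [set w | nodes G w = n]) ('C(num_isolated_in w, k))%:R%:E =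
  (poisson_weight rho n * ('C(n, k))%:R)%:E *
    iint U k (fun u => (K0 k u * miss u ^+ (n - k))%:E))%E.
Proof.
rewrite EFinM -muleA -iint_F -(janossy rho_ge0 GP)//; last exact: perm_F.
transitivity (\int[P]_(w in [set w | nodes G w = n])
    star adde (fun u v => (\1_(Hn n k u v) w)%:E) (iota 0 n))%E.
  by apply: eq_integral => w /set_mem /= nw; rewrite bin_star nw.
have m1 u v : measurable_fun [set w | nodes G w = n] (fun w => (\1_(Hn n k u v) w : R)%:E).
  by apply/measurable_EFinP/measurable_funTS; exact: measurable_indic.
have m2 u v : measurable_fun [set w | nodes G w = n] (fun w =>
    (moment_kernel k [seq pos G i w | i <- u] [seq pos G i w | i <- v])%:E).
  apply: measurable_funTS.
  have := smeas2_K k [seq (pos G i : {mfun T >-> plane R}) | i <- u]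
    [seq (pos G i : {mfun T >-> plane R}) | i <- v].
  by apply: eq_measurable_fun => w _; rewrite -!map_comp.
have p1 u v w : (0 <= (\1_(Hn n k u v) w : R)%:E)%E by rewrite lee_fin.
have p2 u v w : (0 <= (moment_kernel k [seq pos G i w | i <- u]
  [seq pos G i w | i <- v])%:E)%E by rewrite lee_fin.
have mn := measurable_nodes G n.
rewrite (integral_star P mn _ m1 p1).
under [RHS]eq_integral do rewrite /F star_map.
rewrite (integral_star P mn _ m2 p2).
by apply: eq_star_perm => u v uv; exact: integral_Hn.
Qed.

Let bigcup_nodes : \bigcup_n [set w | nodes G w = n] = [set: T].
Proof. by apply/seteqP; split=> // w _; exists (nodes G w). Qed.

Lemma measurable_bin_isolated k :
  measurable_fun setT (fun w => ('C(num_isolated_in w, k))%:R%:E : \bar R).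
Proof.
rewrite -bigcup_nodes; apply/measurable_fun_bigcup => [n|n].
  exact: measurable_nodes.
have : measurable_fun [set w | nodes G w = n]
    (fun w => star adde (fun u v => (\1_(Hn n k u v) w : R)%:E) (iota 0 n)).
  apply: measurable_star_fun => u v.
  by apply/measurable_EFinP/measurable_funTS; exact: measurable_indic.
by apply: eq_measurable_fun => w /set_mem /= nw; rewrite bin_star nw.
Qed.

(** The nodes linked to at least one point of [u] form a thinned Poisson process of mean
    [rho * (1 - miss u)]; the exponential is the probability that there are none. *)
Definition isolation_density (u : seq (plane R)) : R :=
  pairprod absent u * expR (rho * (miss u - 1)).

Lemma eseries_exp_coeff (x : R) : 0 <= x ->
  (\sum_(0 <= m <oo) (x ^+ m / m`!%:R)%:E = (expR x)%:E)%E.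
Proof.
move=> x0; rewrite expRE -EFin_lim; last first.
  rewrite /pseries/=; under eq_fun do rewrite mulrC.
  exact: is_cvg_series_exp_coeff.
apply/congr_lim/funext => n/=; rewrite /pseries/= /series/= -sumEFin//.
by under eq_bigr do rewrite mulrC.
Qed.

Lemma iint_nneseries d' (X : measurableType d') (V : probability X R) n
    (f : nat -> seq X -> \bar R) :
  (forall m, smeas (f m)) -> (forall m s, 0 <= f m s)%E ->
  (iint V n (fun s => \sum_(0 <= m <oo) f m s) = \sum_(0 <= m <oo) iint V n (f m))%E.
Proof.
elim: n f => [|n IH] f mf f0 //=.
under eq_integral.
  move=> x _; rewrite (IH (fun m s => f m (x :: s)))//; first over.
  by move=> m; exact: smeas_cons.
rewrite integral_nneseries//.
- by move=> m; exact: measurable_iint_cons.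
- by move=> m x _; exact: iint_ge0.
Qed.

(** A formula of Mecke type. The Poisson weight of [m + k] nodes times the number of their
    [k]-subsets is [rho ^+ k / k!] times the Poisson weight of [m]: once [k] points are singled out,
    the others again form a Poisson process. The series of powers of [miss u] over [m] is an
    exponential. *)
Theorem factorial_moment k :
  (\int[P]_w ('C(num_isolated_in w, k))%:R%:E =
   (rho ^+ k / k`!%:R)%:E *
   iint U k (fun u => ((all (fun x => x \in B) u)%:R * isolation_density u)%:E))%E.
Proof.
pose I m := iint U k (fun u => (K0 k u * miss u ^+ m)%:E).
pose c m := expR (- rho) * rho ^+ m / m`!%:R.
have c0 m : 0 <= c m by rewrite divr_ge0// mulr_ge0 ?expR_ge0 ?exprn_ge0.
have I0 m : (0 <= I m)%E.
  by apply: iint_ge0 => s; rewrite lee_fin mulr_ge0// exprn_ge0// miss_ge0.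
pose f n := ((c n * ('C(n, k))%:R)%:E * I (n - k)%N)%E.
have f0 n : (0 <= f n)%E by rewrite mule_ge0// lee_fin mulr_ge0.
have -> : (\int[P]_w ('C(num_isolated_in w, k))%:R%:E = \sum_(0 <= n <oo) f n)%E.
  have mB' := measurable_bin_isolated k; move: mB'.
  rewrite -[in X in measurable_fun X]bigcup_nodes -[in X in (\int[P]_(_ in X) _)%E]bigcup_nodes => mB'.
  have tn : trivIset [set: nat] (fun n => [set w | nodes G w = n]).
    by apply/trivIsetP => i j _ _ ij; apply/seteqP; split=> // w [/= wi wj]; case/eqP: ij; rewrite -wi -wj.
  rewrite ge0_integral_bigcup//; first by apply: eq_eseriesr => n _; exact: integral_bin_n.
  exact: measurable_nodes.
rewrite (nneseries_split 0 k)// add0n big_mkord big1 ?add0e; last first.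
  by move=> n _; rewrite /f bin_small// mulr0 mul0e.
rewrite -nneseries_addn//.
have fE m : f (m + k)%N = ((rho ^+ k / k`!%:R)%:E * ((c m)%:E * I m))%E.
  rewrite /f addnK muleA -EFinM; congr (_%:E * _)%E; rewrite /c exprD.
  have nz n : n`!%:R != 0 :> R by rewrite pnatr_eq0 -lt0n fact_gt0.
  have -> : ('C(m + k, k))%:R = (m + k)`!%:R / (k`!%:R * m`!%:R) :> R.
    apply: (canRL (mulfK _)); first by rewrite mulf_neq0.
    by rewrite -!natrM -(bin_fact (leq_addl m k)) addnK.
  by field; rewrite !nz.
rewrite (eq_eseriesr (fun m _ => fE m)) nneseriesZl; last first.
  by move=> m _; rewrite mule_ge0// lee_fin.
congr (_ * _)%E.
have mKm m : smeas (fun u => (K0 k u * miss u ^+ m)%:E).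
  move=> dz Z fs; apply/measurable_EFinP; apply: measurable_funM; first exact: smeas_K0.
  by apply: measurable_funX; exact: smeas_miss.
have Km0 m u : (0 <= (K0 k u * miss u ^+ m)%:E)%E.
  by rewrite lee_fin mulr_ge0// exprn_ge0// miss_ge0.
rewrite (eq_eseriesr (g := fun m => iint U k (fun u => (c m)%:E * (K0 k u * miss u ^+ m)%:E)%E)); last first.
  by move=> m _; rewrite iintZl ?lee_fin.
rewrite -iint_nneseries; last 2 first.
- by move=> m dz Z fs; apply: measurable_funeM; exact: mKm.
- by move=> m s; rewrite mule_ge0// lee_fin.
apply: eq_iint => u uk.
rewrite (eq_eseriesr (g := fun m => (K0 k u * expR (- rho))%:E *
    ((rho * miss u) ^+ m / m`!%:R)%:E)%E); last first.
  by move=> m _; rewrite -!EFinM /c exprMn; congr EFin; ring.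
have rm0 : 0 <= rho * miss u by rewrite mulr_ge0// miss_ge0.
rewrite nneseriesZl ?eseries_exp_coeff//; last first.
  by move=> m _; rewrite lee_fin divr_ge0// exprn_ge0.
rewrite -EFinM /K0 uk eqxx /isolation_density mulrBr mulr1 addrC expRD; congr EFin.
by rewrite !mulrA.
Qed.

End moments.

(** * Bonferroni inequalities and the Poisson limit *)

(** The sum telescopes by the rule of Pascal. *)
Lemma sum_alternating_bin (R : pzRingType) N q :
  \sum_(i < q.+1) (-1) ^+ i * ('C(N.+1, i))%:R = (-1) ^+ q * ('C(N, q))%:R :> R.
Proof.
elim: q => [|q IH]; first by rewrite big_ord1 !bin0.
by rewrite big_ord_recr/= IH binS natrD mulrDr exprS mulN1r !mulNr addrCA subrr addr0.
Qed.

Lemma bin_trinomial (n j i : nat) :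
  ('C(n, j + i) * 'C(j + i, j) = 'C(n, j) * 'C(n - j, i))%N.
Proof.
have [nji|] := leqP (j + i) n; last first.
  move=> nji; rewrite bin_small// mul0n; have [jn|nj] := leqP j n.
    by rewrite [X in (_ * X)%N]bin_small ?muln0// ltn_subLR.
  by rewrite bin_small.
have jn : (j <= n)%N := leq_trans (leq_addr i j) nji.
have inj : (i <= n - j)%N by rewrite leq_subRL.
apply/eqP; rewrite -(eqn_pmul2r (fact_gt0 (n - (j + i)))).
rewrite -(eqn_pmul2r (fact_gt0 j)) -(eqn_pmul2r (fact_gt0 i)); apply/eqP.
have E1 := bin_fact nji; have E2 := bin_fact (leq_addr i j).
have E3 := bin_fact jn; have E4 := bin_fact inj.
rewrite addnC addnK addnC in E2; rewrite subnDA in E1 *.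
transitivity n`!.
  by rewrite -E1 -E2; ring.
by rewrite -E3 -E4; ring.
Qed.

(** Taking out ['C(n, j)] leaves a truncated alternating sum of the binomials of [n - j]. By
    [sum_alternating_bin] it is a single binomial of [n - j - 1] up to sign when [j < n], and it
    equals 1 when [n = j]. *)
Lemma bonferroni (R : numDomainType) (n j q : nat) :
  `|(n == j)%:R - \sum_(i < q.+1) (-1) ^+ i * ('C(j + i, j) * 'C(n, j + i))%:R|
  <= ('C(j + q.+1, j) * 'C(n, j + q.+1))%:R :> R.
Proof.
under eq_bigr do rewrite mulnC bin_trinomial.
rewrite mulnC bin_trinomial.
have -> : \sum_(i < q.+1) (-1) ^+ i * ('C(n, j) * 'C(n - j, i))%:R =
    ('C(n, j))%:R * \sum_(i < q.+1) (-1) ^+ i * ('C(n - j, i))%:R :> R.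
  by rewrite mulr_sumr; apply: eq_bigr => i _; rewrite natrM mulrCA.
case: (ltngtP n j) => [nj|jn|->].
- by rewrite bin_small// mul0r subrr normr0.
- rewrite -(subnSK jn) sum_alternating_bin sub0r normrN !normrM normrX normrN1 expr1n mul1r.
  rewrite !ger0_norm// natrM ler_wpM2l// ler_nat binS.
  exact: leq_addl.
- rewrite subnn binn mul1r big_ord_recl/= expr0 mul1r bin0 big1 ?addr0 ?subrr ?normr0//.
  by move=> i _; rewrite bin_small// mulr0.
Qed.

Section poisson_limit.
Context (R : realType).
Local Open Scope ereal_scope.

Lemma moment_bonferroni d (T : measurableType d) (P : probability T R)
    (V : T -> nat) (a : nat -> R) :
  (forall j, measurable [set w | V w = j]) ->
  (forall k, measurable_fun setT (fun w => ('C(V w, k))%:R%:E : \bar R)) ->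
  (forall k, \int[P]_w ('C(V w, k))%:R%:E = (a k)%:E) ->
  forall j q, (`|fine (P [set w | V w = j]) -
    \sum_(i < q.+1) (-1) ^+ i * ('C(j + i, j))%:R * a (j + i)%N|
    <= ('C(j + q.+1, j))%:R * a (j + q.+1)%N)%R.
Proof.
move=> mV mC aE j q.
have iC k : P.-integrable setT (fun w => ('C(V w, k))%:R%:E : \bar R).
  apply/integrableP; split => //.
  by under eq_integral do rewrite gee0_abs ?lee_fin//; rewrite aE ltry.
have E1 : (fun w => ((V w == j)%:R)%:E : \bar R) = (fun w => (\1_[set w | V w = j] w)%:E).
  apply/funext => w; rewrite indicE; congr ((nat_of_bool _)%:R%:E).
  by apply/eqP/idP => [Vj|/set_mem //]; exact: mem_set.
have i1 : P.-integrable setT (fun w => ((V w == j)%:R)%:E : \bar R).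
  rewrite E1; apply/integrableP; split.
    by apply/measurable_EFinP; exact: measurable_indic.
  under eq_integral do rewrite gee0_abs ?lee_fin//.
  rewrite integral_indic// setIT (le_lt_trans (probability_le1 P _))//.
  exact: ltry.
pose c i : R := ((-1) ^+ i * ('C(j + i, j))%:R)%R.
pose s w := \sum_(i < q.+1) (c i)%:E * ('C(V w, j + i))%:R%:E.
have isc (i : 'I_q.+1) : P.-integrable setT
    (fun w => (c i)%:E * ('C(V w, j + i))%:R%:E : \bar R).
  exact: integrableZl.
have is_ : P.-integrable setT s by exact: integrable_sum.
have Is : \int[P]_w s w = (\sum_(i < q.+1) c i * a (j + i)%N)%:E.
  rewrite /s integral_sum// -sumEFin; apply: eq_bigr => i _.
  by rewrite integralZl// aE.
have -> : (fine (P [set w | V w = j]) - \sum_(i < q.+1) (-1) ^+ i * ('C(j + i, j))%:R * a (j + i)%N)%R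
    = fine (\int[P]_w (((V w == j)%:R)%:E - s w)).
  rewrite integralB// Is E1 integral_indic// setIT.
  by rewrite fineB// fin_num_measure.
set f := fun w => _ - s w.
have if_ : P.-integrable setT f by exact: integrableB.
have fin_f : \int[P]_w f w \is a fin_num by exact: integrable_fin_num.
rewrite -lee_fin EFinM -aE -ge0_integralZl// ?lee_fin//.
rewrite -abse_EFin fineK//.
apply: (le_trans (le_abse_integral P measurableT _)); first exact: measurable_int if_.
apply: ge0_le_integral => //.
- by apply: measurableT_comp => //; exact: measurable_int if_.
- exact: measurable_funeM.
- move=> w _; rewrite /f -EFinM -natrM.
  have -> : s w = (\sum_(i < q.+1) (-1) ^+ i * ('C(j + i, j) * 'C(V w, j + i))%:R)%:E.
    by rewrite -sumEFin; apply: eq_bigr => i _; rewrite -EFinM /c natrM mulrA.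
  by rewrite -EFinB abse_EFin lee_fin bonferroni.
Qed.

End poisson_limit.

Section poisson_convergence.
Context (R : realType).

Lemma cvg_mull (I : Type) (F : set_system I) {FF : Filter F} (c : R)
    (f : I -> R) (l : R) :
  f x @[x --> F] --> l -> c * f x @[x --> F] --> c * l.
Proof. by move=> fl; apply: (@cvgM R I F FF (fun=> c)) fl; exact: cvg_cst. Qed.

Lemma cvg_sum_ord (I : Type) (F : set_system I) {FF : Filter F} n
    (f : 'I_n -> I -> R) (l : 'I_n -> R) :
  (forall i, f i x @[x --> F] --> l i) ->
  (\sum_(i < n) f i x) @[x --> F] --> \sum_(i < n) l i.
Proof.
elim: n f l => [|n IH] f l fl.
  by rewrite big_ord0; under eq_fun do rewrite big_ord0; exact: cvg_cst.
rewrite big_ord_recl; under eq_fun do rewrite big_ord_recl.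
by apply: cvgD => //; exact: IH.
Qed.

(** The truncation [q] is fixed first, so that the partial sum for [expR (- lam)] and the first
    omitted term are both within [e / 4] of their limits; only then does [x] run along [F], which
    costs [e / 4] for the partial sum and [e / 4] for the error term. *)
Lemma poisson_limit_pmf (I : Type) (F : set_system I) {FF : Filter F}
    (lam : R) (p : I -> nat -> R) (a : I -> nat -> R) :
  (forall j q, \forall x \near F,
     `|p x j - \sum_(i < q.+1) (-1) ^+ i * ('C(j + i, j))%:R * a x (j + i)%N|
     <= ('C(j + q.+1, j))%:R * a x (j + q.+1)%N) ->
  (forall k, a x k @[x --> F] --> lam ^+ k / k`!%:R) ->
  forall j, p x j @[x --> F] --> poisson_weight lam j.
Proof.
move=> pa ak j; apply/cvgrPdist_le => e e0.
pose w : R := lam ^+ j / j`!%:R.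
have nz n : n`!%:R != 0 :> R by rewrite pnatr_eq0 -lt0n fact_gt0.
have binE i : ('C(j + i, j))%:R * (lam ^+ (j + i) / (j + i)`!%:R) = w * exp_coeff lam i.
  rewrite /exp_coeff /w exprD /=.
  have -> : ('C(j + i, j))%:R = (j + i)`!%:R / (j`!%:R * i`!%:R) :> R.
    apply: (canRL (mulfK _)); first by rewrite mulf_neq0.
    by rewrite -!natrM -(bin_fact (leq_addr i j)) addnC addnK.
  by field; rewrite !nz.
have signE i : (-1) ^+ i * exp_coeff lam i = exp_coeff (- lam) i.
  by rewrite /exp_coeff/= (exprNn lam) mulrA.
have S_cvg : w * series (exp_coeff (- lam)) q @[q --> \oo] --> poisson_weight lam j.
  rewrite (_ : poisson_weight lam j = w * expR (- lam)); last first.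
    by rewrite /poisson_weight /w; ring.
  by apply: cvg_mull; exact: is_cvg_series_exp_coeff.
have E_cvg : w * exp_coeff lam q @[q --> \oo] --> (0 : R).
  by rewrite -(mulr0 w); apply: cvg_mull; exact: cvg_exp_coeff.
have e4 : 0 < e / 4 by rewrite divr_gt0.
have [q [Sq Eq]] : exists q,
    `|poisson_weight lam j - w * series (exp_coeff (- lam)) q.+1| <= e / 4 /\
    `|w * exp_coeff lam q.+1| <= e / 4.
  move/cvgrPdist_le : S_cvg => /(_ _ e4)[n1 _ H1].
  move/cvgrPdist_le : E_cvg => /(_ _ e4)[n2 _ H2].
  exists (maxn n1 n2); split; first by apply: H1; rewrite /= leqW// leq_maxl.
  by rewrite -normrN -sub0r; apply: H2; rewrite /= leqW// leq_maxr.
have sum_cvg : (\sum_(i < q.+1) (-1) ^+ i * ('C(j + i, j))%:R * a x (j + i)%N)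
    @[x --> F] --> w * series (exp_coeff (- lam)) q.+1.
  rewrite /series/= big_mkord mulr_sumr.
  apply: cvg_sum_ord => i; rewrite -signE mulrCA -binE [X in _ --> X]mulrA.
  by apply: cvg_mull; exact: ak.
have err_cvg : ('C(j + q.+1, j))%:R * a x (j + q.+1)%N @[x --> F] -->
    w * exp_coeff lam q.+1.
  by rewrite -binE; apply: cvg_mull; exact: ak.
move/cvgrPdist_le : sum_cvg => /(_ _ e4) s4.
move/cvgrPdist_le : err_cvg => /(_ _ e4) r4.
near=> x.
have h1 : `|p x j - \sum_(i < q.+1) (-1) ^+ i * ('C(j + i, j))%:R * a x (j + i)%N|
     <= ('C(j + q.+1, j))%:R * a x (j + q.+1)%N by near: x; exact: pa.
have h2 : `|w * series (exp_coeff (- lam)) q.+1 -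
    \sum_(i < q.+1) (-1) ^+ i * ('C(j + i, j))%:R * a x (j + i)%N| <= e / 4.
  by near: x; exact: s4.
have h3 : `|w * exp_coeff lam q.+1 - ('C(j + q.+1, j))%:R * a x (j + q.+1)%N| <= e / 4.
  by near: x; exact: r4.
move: h1 h2 h3 Sq Eq.
move: (\sum_(i < q.+1) _) (_ * a x _) (w * series _ _) (w * exp_coeff _ _) (p x j)
  (poisson_weight _ _) => u v y z t o.
rewrite !ler_norml => /andP[? ?] /andP[? ?] /andP[? ?] /andP[? ?] /andP[? ?].
apply/andP; split; lra.
Unshelve. all: by end_near. Qed.

(** No mass can escape, as the limits of the point masses belong to a probability: an initial
    segment carrying almost all of [mu] eventually carries almost all of [mu_ x]. Beyond it the
    integral of [f] is at most the bound of [f] times the missing mass, which is a finite sum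
    again. *)
Lemma cvg_in_law_pmf (I : Type) (F : set_system I) {FF : ProperFilter F}
    (mu_ : I -> probability nat R) (mu : probability nat R) :
  (forall j, fine (mu_ x [set j]) @[x --> F] --> fine (mu [set j])) ->
  cvg_in_law F mu_ mu.
Proof.
move=> mu_j f _ [B [_ Bf]].
have {}Bf n : `|f n| <= `|B| + 1.
  apply: Bf => //; first by rewrite (le_lt_trans (ler_norm _))// ltrDl.
have mf : measurable_fun setT f by [].
have B0 : 0 < `|B| + 1 by rewrite ltr_wpDl.
have intf (nu : probability nat R) D : nu.-integrable D (EFin \o f).
  apply: (@integrableS _ _ _ _ setT) => //.
  apply: measurable_bounded_integrable => //.
    by rewrite (le_lt_trans (probability_le1 nu measurableT))// ltry.
  by exists (`|B| + 1); split => // x Bx n _; apply: (le_trans (Bf n)); exact: ltW.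
pose cut m := [set k | (k < m)%N].
have mcut m : measurable (cut m) by [].
have cutsum (nu : probability nat R) m (f' : nat -> R) :
    (\int[nu]_(n in cut m) (f' n)%:E = (\sum_(k < m) f' k * fine (nu [set (k : nat)]))%:E)%E.
  transitivity (\int[nu]_(n in cut m) \sum_(k < m) ((f' k)%:E * (\1_[set (k : nat)] n)%:E))%E.
    apply: eq_integral => n /set_mem /= nm.
    rewrite (bigD1 (Ordinal nm))//= indicE mem_set// mule1 big1 ?adde0// => k kn.
    rewrite indicE memNset ?mule0// => /= nk; case/eqP: kn.
    by apply/val_inj; rewrite /= nk.
  have i1 (k : 'I_m) : nu.-integrable (cut m) (fun n => (\1_[set (k : nat)] n : R)%:E).
    apply/integrableP; split; first by [].
    under eq_integral do rewrite gee0_abs ?lee_fin//.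
    by rewrite integral_indic// (le_lt_trans (probability_le1 nu _))// ltry.
  rewrite integral_sum//; last by move=> k; exact: integrableZl.
  rewrite -sumEFin; apply: eq_bigr => k _.
  rewrite integralZl// integral_indic// setIidl; last by move=> _ ->; exact: ltn_ord.
  by rewrite EFinM fineK// fin_num_measure.
have nucut (nu : probability nat R) m :
    nu (cut m) = (\sum_(k < m) fine (nu [set (k : nat)]))%:E.
  transitivity (\int[nu]_(n in cut m) (cst 1%E) n)%E.
    by rewrite integral_cst// mul1e.
  by rewrite (cutsum nu m (fun=> 1)); congr EFin; apply: eq_bigr => k _; rewrite mul1r.
have key (nu : probability nat R) m :
    `|fine (\int[nu]_n (f n)%:E) - \sum_(k < m) f k * fine (nu [set (k : nat)])| <=
    (`|B| + 1) * (1 - \sum_(k < m) fine (nu [set (k : nat)])).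
  have nuC : nu (~` cut m) = (1 - \sum_(k < m) fine (nu [set (k : nat)]))%:E.
    by rewrite probability_setC// nucut.
  rewrite -lee_fin EFinM -nuC.
  have -> : (\int[nu]_n (f n)%:E = \int[nu]_(n in cut m) (f n)%:E + \int[nu]_(n in ~` cut m) (f n)%:E)%E.
    transitivity (\int[nu]_(n in cut m `|` ~` cut m) (f n)%:E)%E.
      by rewrite setUv.
    by apply: integral_setU => //; apply/disj_setPS => x [].
  have fin2 : (\int[nu]_(n in ~` cut m) (f n)%:E)%E \is a fin_num.
    by apply: integrable_fin_num => //; exact: intf.
  rewrite cutsum fineD//= addrAC subrr add0r -abse_EFin fineK//.
  apply: (le_trans (le_abse_integral nu _ _)) => //.
  rewrite -[X in (_ <= X * _)%E]/(cst (`|B| + 1)%:E 0%N) -integral_cst//.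
  apply: ge0_le_integral => //.
  by move=> n _; rewrite abse_EFin lee_fin; exact: Bf.
have fmu : (\int[mu]_n (f n)%:E)%E \is a fin_num.
  by apply: integrable_fin_num => //; exact: intf.
rewrite -(fineK fmu); apply/fine_cvgP; split.
  by apply: nearW => x; apply: integrable_fin_num => //; exact: intf.
apply/cvgrPdist_le => e e0.
have cutcvg : (\sum_(k < m) fine (mu [set (k : nat)])) @[m --> \oo] --> (1 : R).
  have bc : \bigcup_m cut m = setT.
    by apply/seteqP; split=> // n _; exists n.+1 => //; exact: ltnSn.
  have hcut : {homo cut : n m / (n <= m)%N >-> (n <= m)%O}.
    by move=> n m nm; apply/subsetPset => k /= kn; exact: leq_trans kn nm.
  have mbc : measurable (\bigcup_m cut m) by [].
  have := nondecreasing_cvg_mu (mu := mu) mcut mbc hcut.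
  rewrite bc (_ : (mu : {measure set nat -> \bar R}) setT = 1%E); last exact: probability_setT.
  rewrite (_ : mu \o cut = fun m =>
    (\sum_(k < m) fine (mu [set (k : nat)]))%:E); last first.
    by apply/funext => m /=; exact: nucut.
  by move/fine_cvgP => [_].
set B' := `|B| + 1 in B0 key *.
have eta0 : 0 < e / (4 * B') by rewrite divr_gt0// mulr_gt0.
have e4 : 0 < e / 4 by rewrite divr_gt0.
move/cvgrPdist_le : cutcvg => /(_ _ eta0)[m _ /(_ m (leqnn m)) /= Hm].
have s1 : (\sum_(k < m) f k * fine (mu_ x [set (k : nat)])) @[x --> F] -->
    \sum_(k < m) f k * fine (mu [set (k : nat)]).
  by apply: cvg_sum_ord => k; exact: cvg_mull.
have s2 : (\sum_(k < m) fine (mu_ x [set (k : nat)])) @[x --> F] -->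
    \sum_(k < m) fine (mu [set (k : nat)]).
  exact: cvg_sum_ord.
move/cvgrPdist_le : s1 => /(_ _ e4) s1.
move/cvgrPdist_le : s2 => /(_ _ eta0) s2.
near=> x.
have h1 : `|\sum_(k < m) f k * fine (mu [set (k : nat)]) -
    \sum_(k < m) f k * fine (mu_ x [set (k : nat)])| <= e / 4 by near: x; exact: s1.
have h2 : `|\sum_(k < m) fine (mu [set (k : nat)]) -
    \sum_(k < m) fine (mu_ x [set (k : nat)])| <= e / (4 * B') by near: x; exact: s2.
have k1 := key mu m; have k2 := key (mu_ x) m.
have eE : B' * (e / (4 * B')) = e / 4 by field; rewrite gt_eqF.
move: h1 h2 k1 k2 Hm eE.
move: (\sum_(k < m) f k * fine (mu [set (k : nat)])) (\sum_(k < m) f k * fine (mu_ x [set (k : nat)]))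
  (\sum_(k < m) fine (mu [set (k : nat)])) (\sum_(k < m) fine (mu_ x [set (k : nat)]))
  (e / (4 * B')) => u v y z t h1 h2 k1 k2 Hm eE.
have h3 : B' * (1 - y) <= e / 4.
  rewrite -eE ler_pM2l//; by move: Hm; rewrite ler_norml => /andP[].
have h4 : B' * (1 - z) <= e / 2.
  have : B' * (1 - z) <= B' * (t + t).
    rewrite ler_pM2l//; move: h2 Hm; rewrite !ler_norml => /andP[? ?] /andP[? ?]; lra.
  by rewrite (mulrDr B' t t) eE; lra.
move: h1 (le_trans k1 h3) (le_trans k2 h4); rewrite /= !ler_norml.
by move=> /andP[? ?] /andP[? ?] /andP[? ?]; apply/andP; split; lra.
Unshelve. all: by end_near. Qed.

End poisson_convergence.

(** * Scaling and the mass of the connection function *)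

Section affine_change.
Context (R : realType).
Local Notation leb := (@lebesgue_measure R).
Local Notation mu2 := (@lebesgue_measure R \x @lebesgue_measure R)%E.
Local Notation RM := (measurableTypeR R).

Lemma measurable_affine (a r : R) : measurable_fun setT (fun y : RM => (y - a) / r : RM).
Proof.
by apply: measurable_funM => //; apply: measurable_funB.
Qed.

Lemma lebesgue_affine (a r : R) (A : set RM) : r != 0 -> measurable A ->
  leb ((fun y : RM => (y - a) / r) @^-1` A) = (`|r|%:E * leb A)%E.
Proof.
move=> r0 mA; have nr0 : 0 < `|r| by rewrite normr_gt0.
have nrV : 0 <= `|r|^-1 by rewrite invr_ge0 ltW.
pose nu := mscale (NngNum nrV) (mpush leb (measurable_affine a r)).
suff : leb A = nu A.
  move=> ->; rewrite /nu /mscale/= muleA -EFinM mulfV ?gt_eqF// mul1e.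
  by [].
apply: lebesgue_measure_unique => // _ [[c d] /= cd <-].
rewrite /nu /mscale mpushE lebesgue_measure_itv/=.
case: (ltrgt0P r) r0 => // [r0 _|r0 _].
  rewrite (_ : _ @^-1` _ = `](a + r * c), (a + r * d)]%classic); last first.
    apply/seteqP; split=> y /=; rewrite !in_itv/=.
      rewrite ltr_pdivlMr// ler_pdivrMr// => /andP[? ?]; apply/andP; split; lra.
    rewrite ltr_pdivlMr// ler_pdivrMr// => /andP[? ?]; apply/andP; split; lra.
  rewrite lebesgue_measure_itv/= !lte_fin ltrD2l ltr_pM2l//.
  case: ifP => _; last by rewrite mule0.
  by rewrite -!EFinB -EFinM; congr EFin; field; rewrite gt_eqF.
rewrite (_ : _ @^-1` _ = `[(a + r * d), (a + r * c)[%classic); last first.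
  apply/seteqP; split=> y /=; rewrite !in_itv/=.
    rewrite ltr_ndivlMr// ler_ndivrMr// => /andP[? ?]; apply/andP; split; lra.
  rewrite ltr_ndivlMr// ler_ndivrMr// => /andP[? ?]; apply/andP; split; lra.
rewrite lebesgue_measure_itv/= !lte_fin ltrD2l ltr_nM2l//.
case: ifP => _; last by rewrite mule0.
by rewrite -!EFinB -EFinM; congr EFin; field; rewrite lt_eqF.
Qed.

(** The ratios are separate and may be negative, so that either coordinate can be reflected. This
    gives the symmetries of [mass] and lets a point near any side or corner be treated in the same
    orientation. *)
Definition affine2 (x : plane R) (r1 r2 : R) (y : plane R) : plane R :=
  ((y.1 - x.1) / r1, (y.2 - x.2) / r2).

Lemma measurable_affine2 x r1 r2 : measurable_fun setT (affine2 x r1 r2).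
Proof.
apply: measurable_fun_pair.
  exact: (measurableT_comp (measurable_affine x.1 r1) measurable_fst).
exact: (measurableT_comp (measurable_affine x.2 r2) measurable_snd).
Qed.

Lemma area_affine2 x r1 r2 (A : set (plane R)) : r1 != 0 -> r2 != 0 ->
  measurable A ->
  mu2 (affine2 x r1 r2 @^-1` A) = (`|r1 * r2|%:E * mu2 A)%E.
Proof.
move=> r10 r20 mA.
have nr0 : 0 < `|r1 * r2| by rewrite normr_gt0 mulf_neq0.
have nrV : 0 <= `|r1 * r2|^-1 by rewrite invr_ge0 ltW.
pose nu := mscale (NngNum nrV) (mpush mu2 (measurable_affine2 x r1 r2)).
suff : mu2 A = nu A.
  move=> ->; rewrite /nu /mscale/= muleA -EFinM mulfV ?gt_eqF// mul1e.
  by [].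
apply: product_measure_unique => // B1 B2 mB1 mB2.
rewrite -[LHS]/(`|r1 * r2|^-1%:E * mu2 (affine2 x r1 r2 @^-1` (B1 `*` B2)))%E.
rewrite (_ : _ @^-1` _ = ((fun y : RM => (y - x.1) / r1) @^-1` B1) `*`
   ((fun y : RM => (y - x.2) / r2) @^-1` B2))//.
have mA1 : measurable ((fun y : RM => (y - x.1) / r1) @^-1` B1).
  by rewrite -[X in measurable X]setTI; exact: measurable_affine.
have mA2 : measurable ((fun y : RM => (y - x.2) / r2) @^-1` B2).
  by rewrite -[X in measurable X]setTI; exact: measurable_affine.
transitivity (`|r1 * r2|^-1%:E * (leb ((fun y : RM => ((y - x.1) / r1)%R) @^-1` B1) *
    leb ((fun y : RM => ((y - x.2) / r2)%R) @^-1` B2)))%E.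
  by congr (_ * _)%E; exact: product_measure1E.
rewrite !lebesgue_affine// [X in (_ * X)%E]muleACA. have E : (`|r1 * r2|^-1%:E * (`|r1|%:E * `|r2|%:E) = 1 :> \bar R)%E.
  by rewrite normrM -!EFinM mulVf// -normrM gt_eqF.
by rewrite [LHS]muleA E mul1e.
Qed.

Lemma integral_affine2 x r1 r2 (F : plane R -> \bar R) : r1 != 0 -> r2 != 0 ->
  measurable_fun setT F -> (forall z, 0 <= F z)%E ->
  (\int[mu2]_y F (affine2 x r1 r2 y) = `|r1 * r2|%:E * \int[mu2]_z F z)%E.
Proof.
move=> r10 r20 mF F0.
rewrite -(integral_mpush mu2 (measurable_affine2 x r1 r2))//.
have nr0 : 0 <= `|r1 * r2| by [].
transitivity (\int[mscale (NngNum nr0) mu2]_z F z)%E.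
  by apply: eq_measure_integral => A mA _; rewrite mpushE; exact: area_affine2.
by rewrite ge0_integral_mscale.
Qed.

Lemma integral_swap2 (F : plane R -> \bar R) :
  measurable_fun setT F -> (forall z, 0 <= F z)%E ->
  (\int[mu2]_y F (y.2, y.1) = \int[mu2]_z F z)%E.
Proof.
move=> mF F0.
have ms : measurable_fun setT (fun y : plane R => (y.2, y.1) : plane R).
  by apply: measurable_fun_pair.
rewrite fubini_tonelli1//; last exact: (measurableT_comp mF ms).
by rewrite fubini_tonelli2.
Qed.

Lemma area_box (a b c e : R) : a <= b -> c <= e ->
  mu2 (`[a, b[ `*` `[c, e[) = ((b - a) * (e - c))%:E.
Proof.
move=> ab ce; rewrite product_measure1E//=; try exact: measurable_itv.
by rewrite !lebesgue_itv_lebesgue.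
Qed.

End affine_change.

Section profile.
Context (R : realType) (g : R -> R) (C : R).
Hypothesis g01 : forall x : R, 0 <= x -> 0 <= g x <= 1.
Hypothesis g_noninc : forall x y : R, 0 <= x -> x <= y -> g y <= g x.
Local Notation mu2 := (@lebesgue_measure R \x @lebesgue_measure R)%E.
Hypothesis C_def : (\int[mu2]_x (g (eucl_norm x))%:E = C%:E)%E.
Implicit Types A B : set (plane R).

Lemma measurable_eucl_norm : measurable_fun setT (@eucl_norm R : plane R -> R).
Proof.
apply: measurableT_comp; first exact: continuous_measurable_fun (@sqrt_continuous R).
by apply: measurable_funD; exact: measurable_funX.
Qed.

Lemma measurable_profile d (T : measurableType d) (f : T -> R) :
  measurable_fun setT f -> (forall x, 0 <= f x) ->
  measurable_fun setT (fun x => g (f x)).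
Proof.
move=> mf f0.
(* The profile is known to be monotone on nonnegative arguments only; after truncation at 0 it is
   monotone on the whole line. *)
have mg : measurable_fun setT (fun x : R => g (Num.max x 0)).
  apply: nonincreasing_measurable => // x y xy; apply: g_noninc.
    by rewrite le_max lexx orbT.
  by rewrite ge_max !le_max xy lexx orbT.
have := measurableT_comp mg mf; apply: eq_measurable_fun => x _ /=.
by rewrite max_l.
Qed.

Definition gp (y : plane R) : R := g (eucl_norm y).

Lemma measurable_gp : measurable_fun setT gp.
Proof.
by apply: measurable_profile; [exact: measurable_eucl_norm|move=> x; exact: sqrtr_ge0].
Qed.

Lemma gp_ge0 y : 0 <= gp y.
Proof. by have /andP[] := g01 (sqrtr_ge0 (y.1 ^+ 2 + y.2 ^+ 2)). Qed.

Lemma gp_le1 y : gp y <= 1.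
Proof. by have /andP[] := g01 (sqrtr_ge0 (y.1 ^+ 2 + y.2 ^+ 2)). Qed.

Definition mass A : R := fine (\int[mu2]_(y in A) (gp y)%:E)%E.

Let mgp A : measurable_fun A (EFin \o gp).
Proof. by apply/measurable_EFinP/measurable_funTS; exact: measurable_gp. Qed.

Let gp0 y : (0 <= (gp y)%:E)%E. Proof. by rewrite lee_fin gp_ge0. Qed.

Lemma massE A : measurable A -> (\int[mu2]_(y in A) (gp y)%:E = (mass A)%:E)%E.
Proof.
move=> mA; rewrite /mass fineK// ge0_fin_numE; last exact: integral_ge0.
apply: (@le_lt_trans _ _ C%:E); last exact: ltry.
by rewrite -C_def; apply: ge0_subset_integral => //; exact: mgp.
Qed.

Lemma mass_ge0 A : 0 <= mass A.
Proof. by apply: fine_ge0; exact: integral_ge0. Qed.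

Lemma mass_setT : mass setT = C.
Proof. by rewrite /mass C_def. Qed.

Lemma le_mass A B : measurable A -> measurable B -> A `<=` B -> mass A <= mass B.
Proof.
move=> mA mB AB; rewrite -lee_fin -!massE//.
by apply: ge0_subset_integral => //; exact: mgp.
Qed.

Lemma mass_setU A B : measurable A -> measurable B -> A `&` B = set0 ->
  mass (A `|` B) = mass A + mass B.
Proof.
move=> mA mB AB; apply: EFin_inj; rewrite EFinD -!massE//; last exact: measurableU.
by apply: ge0_integral_setU => //; apply/disj_setPS; rewrite AB.
Qed.

Lemma mass_setU_le A B : measurable A -> measurable B ->
  mass (A `|` B) <= mass A + mass B.
Proof.
move=> mA mB; have mD : measurable (B `\` A) by exact: measurableD.
have -> : A `|` B = A `|` (B `\` A).
  apply/seteqP; split=> x; last by case=> [|[]]; [left|right].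
  by case=> [Ax|Bx]; [left|have [Ax|Ax] := pselect (A x); [left|right]].
rewrite mass_setU//; last by apply/seteqP; split=> // x [? []].
by rewrite lerD2l; apply: le_mass => // x [].
Qed.

Lemma mass_cover A B D : measurable A -> measurable B -> measurable D ->
  A `<=` B `|` D -> mass A <= mass B + mass D.
Proof.
move=> mA mB mD ABD; apply: (le_trans _ (mass_setU_le mB mD)).
by apply: le_mass => //; exact: measurableU.
Qed.

Lemma eucl_norm_affine2 (x y : plane R) (r1 r2 r : R) : 0 < r -> `|r1| = r -> `|r2| = r ->
  eucl_norm (affine2 x r1 r2 y) = eucl_norm (x - y) / r.
Proof.
move=> r0 r1r r2r; rewrite /eucl_norm /affine2/= !expr_div_n.
rewrite -(real_normK (num_real r1)) -(real_normK (num_real r2)) r1r r2r.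
rewrite -mulrDl sqrtrM ?addr_ge0 ?sqr_ge0// sqrtrV ?sqr_ge0// sqrtr_sqr (gtr0_norm r0).
by congr (Num.sqrt _ / _); congr (_ + _); rewrite -sqrrN opprB.
Qed.

Lemma integral_profile_affine A (x : plane R) (r1 r2 r : R) : measurable A ->
  0 < r -> `|r1| = r -> `|r2| = r ->
  (\int[mu2]_(y in affine2 x r1 r2 @^-1` A) (g (eucl_norm (x - y) / r))%:E =
   (r ^+ 2 * mass A)%:E)%E.
Proof.
move=> mA r0 r1r r2r.
have r1n : r1 != 0 by rewrite -normr_gt0 r1r.
have r2n : r2 != 0 by rewrite -normr_gt0 r2r.
pose F := (EFin \o gp) \_ A.
have mF : measurable_fun setT F by apply/(measurable_restrictT _ _).1 => //; exact: mgp.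
have F0 z : (0 <= F z)%E by apply: erestrict_ge0 => // y _; exact: gp0.
have E := integral_affine2 x r1n r2n mF F0.
have E2 : (\int[mu2]_z F z = (mass A)%:E)%E by rewrite -massE// /F -integral_mkcond.
transitivity (`|r1 * r2|%:E * (mass A)%:E)%E; last by rewrite normrM r1r r2r -EFinM.
rewrite -E2; apply: (eq_trans _ E).
rewrite integral_mkcond; apply: eq_integral => y _.
rewrite /F !patchE [(EFin \o gp) _]/= /gp (eucl_norm_affine2 _ _ r0 r1r r2r).
by rewrite (_ : (y \in _) = (affine2 x r1 r2 y \in A)).
Qed.

Lemma mass_reflect A (e1 e2 : R) : measurable A -> `|e1| = 1 -> `|e2| = 1 ->
  mass [set y | A (e1 * y.1, e2 * y.2)] = mass A.
Proof.
move=> mA h1 h2; have := integral_profile_affine 0 mA ltr01 h1 h2.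
rewrite expr1n mul1r.
have inv1 e : `|e| = 1 :> R -> e^-1 = e.
  by move=> e1'; have /eqP := e1'; rewrite eqr_norml ler01 andbT => /orP[]/eqP->; rewrite ?invrN invr1.
have E : affine2 0 e1 e2 @^-1` A = [set y | A (e1 * y.1, e2 * y.2)].
  apply/funext => y /=; rewrite /affine2/= !subr0.
  by rewrite (inv1 _ h1) (inv1 _ h2) (mulrC y.1) (mulrC y.2).
rewrite E => H; rewrite -[RHS]/(fine (mass A)%:E) -H; congr fine; apply: eq_integral => y _.
rewrite /gp /eucl_norm /= !divr1 !add0r.
by rewrite !sqrrN.
Qed.

Lemma mass_swap A : measurable A -> mass [set y | A (y.2, y.1)] = mass A.
Proof.
move=> mA.
have mF : measurable_fun setT ((EFin \o gp) \_ A).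
  by apply/(measurable_restrictT _ _).1 => //; exact: mgp.
have F0 z : (0 <= ((EFin \o gp) \_ A) z)%E by apply: erestrict_ge0 => // y _; exact: gp0.
rewrite /mass; congr fine; rewrite [RHS]integral_mkcond.
rewrite [LHS]integral_mkcond; apply: (eq_trans _ (integral_swap2 mF F0)).
apply: eq_integral => y _.
rewrite !patchE /gp /= (_ : eucl_norm (y.2, y.1) = eucl_norm y)//.
by rewrite /eucl_norm/= addrC.
Qed.

Definition quadrant (a b : R) : set (plane R) :=
  [set y | - a <= y.1 /\ - b <= y.2].

(** Taken in the sup norm, so that the complement is a box, which fits the square and has an
    explicit area. *)
Definition far (s : R) : set (plane R) := [set y | s <= `|y.1| \/ s <= `|y.2|].

Lemma measurable_quadrant a b : measurable (quadrant a b).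
Proof.
rewrite (_ : quadrant a b = `[- a, +oo[%classic `*` `[- b, +oo[%classic).
  by apply: measurableX; exact: measurable_itv.
by apply/seteqP; split=> y /=; rewrite !in_itv/= !andbT.
Qed.

Lemma measurable_far s : measurable (far s).
Proof.
rewrite (_ : far s = ~` (`]- s, s[%classic `*` `]- s, s[%classic)).
  by apply: measurableC; apply: measurableX; exact: measurable_itv.
apply/seteqP; split=> y /=; rewrite !in_itv/= -!ltr_norml !ltNge.
  by case=> ys [/negP + /negP]; rewrite ys.
by move=> /not_andP[] /negP/negPn; [left|right].
Qed.

Lemma le_far s t : s <= t -> mass (far t) <= mass (far s).
Proof.
move=> st; apply: le_mass; try exact: measurable_far.
by move=> y [] ty; [left|right]; exact: le_trans ty.
Qed.

Lemma mass_quadrantC a b : mass (quadrant a b) = mass (quadrant b a).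
Proof.
rewrite -mass_swap; last exact: measurable_quadrant.
by congr mass; apply/seteqP; split=> y [].
Qed.

Let half (a : R) : set (plane R) := [set y | - a <= y.1].

Let measurable_half a : measurable (half a).
Proof.
rewrite (_ : half a = `[- a, +oo[%classic `*` setT).
  by apply: measurableX => //; exact: measurable_itv.
by apply/seteqP; split=> y /=; rewrite !in_itv/= !andbT//; case.
Qed.

Let half_quadrant a b : mass (half a) <= mass (quadrant a b) + mass (far b).
Proof.
apply: mass_cover => //; [exact: measurable_quadrant|exact: measurable_far|].
move=> y ya; have [yb|yb] := leP (- b) y.2; [by left; split|right; right].
by rewrite ler_normr; apply/orP; right; rewrite lerNr ltW.
Qed.

Let m1 : `|-1 : R| = 1. Proof. by rewrite normrN1. Qed.
Let p1 : `|1 : R| = 1. Proof. by rewrite normr1. Qed.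

(** The images of the quadrant under sign changes cover the plane and have equal mass; overlaps on
    the axes do no harm to the inequality. *)
Lemma mass_quadrant00 : C / 4 <= mass (quadrant 0 0).
Proof.
have mq := measurable_quadrant 0 0.
have mh := measurable_half 0.
have mr (A : set (plane R)) (e1 e2 : R) : measurable A ->
    measurable [set y : plane R | A (e1 * y.1, e2 * y.2)].
  move=> mA; have mf : measurable_fun setT (fun y : plane R => (e1 * y.1, e2 * y.2) : plane R).
    by apply: measurable_fun_pair; apply: measurable_funM.
  by rewrite -[X in measurable X]setTI; exact: mf.
have h1 : C <= mass (half 0) + mass (half 0).
  rewrite -{2}(mass_reflect mh m1 p1) -mass_setT.
  apply: mass_cover => //; first exact: mr.
  move=> y _; rewrite /half/= oppr0 mulN1r oppr_ge0.
  by have [y0|y0] := leP 0 y.1; [left|right; rewrite ltW].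
have h2 : mass (half 0) <= mass (quadrant 0 0) + mass (quadrant 0 0).
  rewrite -{2}(mass_reflect mq p1 m1).
  apply: mass_cover => //; first exact: mr.
  move=> y; rewrite /half /quadrant/= oppr0 mulN1r oppr_ge0 mul1r => y1.
  by have [y0|y0] := leP 0 y.2; [left|right; split=> //; rewrite ltW].
lra.
Qed.

Let mass_half0 : C / 2 <= mass (half 0).
Proof.
have mh := measurable_half 0.
have mr (A : set (plane R)) (e1 e2 : R) : measurable A ->
    measurable [set y : plane R | A (e1 * y.1, e2 * y.2)].
  move=> mA; have mf : measurable_fun setT (fun y : plane R => (e1 * y.1, e2 * y.2) : plane R).
    by apply: measurable_fun_pair; apply: measurable_funM.
  by rewrite -[X in measurable X]setTI; exact: mf.
have h1 : C <= mass (half 0) + mass (half 0).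
  rewrite -{2}(mass_reflect mh m1 p1) -mass_setT.
  apply: mass_cover => //; first exact: mr.
  move=> y _; rewrite /half/= oppr0 mulN1r oppr_ge0.
  by have [y0|y0] := leP 0 y.1; [left|right; rewrite ltW].
lra.
Qed.

Lemma mass_quadrant0 b : C / 2 - mass (far b) <= mass (quadrant 0 b).
Proof. by have := half_quadrant 0 b; move: mass_half0; lra. Qed.

Lemma mass_quadrant_far a b : C - mass (far a) - mass (far b) <= mass (quadrant a b).
Proof.
have h : C <= mass (half a) + mass (far a).
  rewrite -mass_setT; apply: mass_cover => //; first exact: measurable_far.
  move=> y _; have [ya|ya] := leP (- a) y.1; [by left|right; left].
  by rewrite ler_normr; apply/orP; right; rewrite lerNr ltW.
have := half_quadrant a b; lra.
Qed.

(** Besides the half-plane, the strip of width [w] contains a box of sides [w] and [eta], all of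
    whose points are within [2 * eta] of the origin. *)
Lemma mass_quadrant_strip w b eta : 0 <= w -> w <= eta ->
  C / 2 + g (2 * eta) * (w * eta) - mass (far b) <= mass (quadrant w b).
Proof.
move=> w0 weta; have eta0 := le_trans w0 weta.
have mh := measurable_half 0.
pose box : set (plane R) := `[- w, 0[%classic `*` `[0, eta[%classic.
have mbox : measurable box by apply: measurableX; exact: measurable_itv.
have box_mass : g (2 * eta) * (w * eta) <= mass box.
  rewrite -lee_fin -massE//.
  have -> : (g (2 * eta) * (w * eta))%:E = (\int[mu2]_(y in box) (cst (g (2 * eta))%:E) y)%E.
    rewrite integral_cst// EFinM; congr (_ * _)%E.
    by rewrite -[RHS]/(mu2 box) area_box ?oppr_le0//; congr EFin; ring.
  have geta : 0 <= g (2 * eta) by have /andP[] := g01 (mulr_ge0 (ler0n R 2) eta0).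
  apply: ge0_le_integral => //.
  move=> y [/=]; rewrite !in_itv/= => /andP[y1 y1'] /andP[y2 y2'].
  rewrite lee_fin /gp; apply: g_noninc; first exact: sqrtr_ge0.
  have e2 : 0 <= 2 * eta by rewrite mulr_ge0.
  rewrite -(ger0_norm e2) -sqrtr_sqr; apply: ler_wsqrtr.
  have : y.1 ^+ 2 <= eta ^+ 2 by rewrite -sqrrN ler_pXn2r// ?nnegrE; lra.
  have : y.2 ^+ 2 <= eta ^+ 2 by rewrite ler_pXn2r// ?nnegrE; lra.
  rewrite exprMn; have := sqr_ge0 eta; lra.
have : mass (half 0) + mass box <= mass (half w).
  rewrite -mass_setU//; last first.
    apply/seteqP; split=> // y [/=]; rewrite /half/= oppr0 => y0 [/=].
    by rewrite in_itv/= => /andP[_]; rewrite ltNge y0.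
  apply: le_mass => //; first exact: measurableU.
  move=> y [|[/=]]; rewrite /half/=; first by rewrite oppr0; lra.
  by rewrite in_itv/= => /andP[].
have := half_quadrant w b; move: mass_half0; lra.
Qed.

Lemma far_cvg0 : forall e, 0 < e -> exists s0, forall s, s0 <= s -> mass (far s) <= e.
Proof.
move=> e e0.
have mfar n : measurable (far n%:R) by exact: measurable_far.
have cE : (fun n : nat => C - mass (far n%:R)) =
    fine \o (fun n => \int[mu2]_(y in ~` far n%:R) (gp y)%:E)%E.
  apply/funext => n /=; have mC : measurable (~` far n%:R) by exact: measurableC.
  rewrite massE//= -mass_setT -(setUv (far n%:R)) mass_setU ?setICr//; ring.
have : (\int[mu2]_(y in ~` far n%:R) (gp y)%:E)%E @[n --> \oo] -->
    (\int[mu2]_(y in \bigcup_n ~` far n%:R) (gp y)%:E)%E.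
  apply: ge0_nondecreasing_set_cvg_integral => //.
  - move=> n m nm; apply/subsetPset => y yn ym; case: yn.
    by case: ym => ym; [left|right]; apply: le_trans ym; rewrite ler_nat.
  - by move=> n; exact: measurableC.
have -> : \bigcup_n ~` far n%:R = [set: plane R].
  apply/seteqP; split=> // y _; exists (Num.bound (`|y.1| + `|y.2|)) => //.
  have yb := archi_boundP (addr_ge0 (normr_ge0 y.1) (normr_ge0 y.2)).
  by move=> [] /(lt_le_trans yb); rewrite ltNge => /negP; apply;
    rewrite ?lerDl ?lerDr.
rewrite C_def => /fine_cvgP[_] /cvgrPdist_le /(_ _ e0)[n _ /(_ n (leqnn n)) /=].
have := congr1 (fun f => f n) cE => /= <-; rewrite opprB addrC subrK => Hn.
exists n%:R => s ns; apply: (le_trans (le_far ns)).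
by rewrite (le_trans _ Hn)// ler_norm.
Qed.

End profile.

(** * Decay of the tail mass of the profile *)

Section tail.
Context (R : realType) (g : R -> R) (C : R).
Hypothesis g01 : forall x : R, 0 <= x -> 0 <= g x <= 1.
Hypothesis g_noninc : forall x y : R, 0 <= x -> x <= y -> g y <= g x.
Local Notation mu2 := (@lebesgue_measure R \x @lebesgue_measure R)%E.
Hypothesis C_def : (\int[mu2]_x (g (eucl_norm x))%:E = C%:E)%E.
Hypothesis g_small : (g : R -> R^o) =o_ (pinfty_nbhs R)
  (fun x => (x ^+ 2 * ln x ^+ 2)^-1 : R^o).

Local Notation T s := (mass g (far s)).

Lemma profile_small e : 0 < e ->
  exists2 s0, 1 < s0 & forall x, s0 <= x -> g x <= e / (x ^+ 2 * ln x ^+ 2).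
Proof.
move=> e0; move/eqoP : g_small => /(_ _ e0)[M [_ HM]].
exists (Num.max 2 (M + 1)) => [|x]; first by rewrite lt_max ltr1n.
rewrite ge_max => /andP[x2 xM].
have := HM x; rewrite (lt_le_trans _ xM) ?ltrDl// => /(_ isT) /=.
have x0 : 0 <= x by lra.
have d0 : 0 <= (x ^+ 2 * ln x ^+ 2)^-1 by rewrite invr_ge0 mulr_ge0 ?sqr_ge0.
by rewrite /= !ger0_norm//; have /andP[] := g01 x0.
Qed.

Lemma profile_cvg0 e : 0 < e -> exists2 s0, 0 < s0 & forall x, s0 <= x -> g x <= e.
Proof.
move=> e0; have [s0 s01 H] := profile_small e0.
exists (Num.max s0 (expR 1)) => [|x]; first by rewrite lt_max expR_gt0 orbT.
rewrite ge_max => /andP[xs xe]; apply: (le_trans (H _ xs)).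
have x1 : 1 <= x by rewrite (le_trans _ xs)// ltW.
have l1 : 1 <= ln x.
  by rewrite -(expRK 1) ler_ln// posrE ?expR_gt0//; lra.
rewrite ler_pdivrMr; last by rewrite mulr_gt0// exprn_gt0//; lra.
by rewrite ler_peMr ?(ltW e0)// mulr_ege1// exprn_ege1.
Qed.

(** What lies between the two levels is contained in a box of side [4 * s], and its points are at
    distance at least [s] from the origin. *)
Lemma far_double s : 0 <= s -> T s <= T (2 * s) + 16 * s ^+ 2 * g s.
Proof.
move=> s0; pose box : set (plane R) :=
  (`[- (2 * s), 2 * s[%classic `*` `[- (2 * s), 2 * s[%classic) `&` far s.
have mB : measurable (`[- (2 * s), 2 * s[%classic `*` `[- (2 * s), 2 * s[%classic : set (plane R)).
  by apply: measurableX; exact: measurable_itv.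
have mf t : measurable (far t : set (plane R)) by exact: measurable_far.
have mbox : measurable box by exact: measurableI.
have g0 : 0 <= g s by have /andP[] := g01 s0.
apply: (@le_trans _ _ (T (2 * s) + mass g box)).
  apply: (mass_cover g01 g_noninc C_def) => // y ys; have [y2|y2] := pselect (far (2 * s) y); [by left|right].
  split=> //; move/not_orP : y2 => -[/negP + /negP]; rewrite -!ltNge !ltr_norml.
  by rewrite /= !in_itv/= => /andP[/ltW -> ->] /andP[/ltW -> ->].
rewrite lerD2l -lee_fin -(massE g01 g_noninc C_def)//.
apply: (@le_trans _ _ (\int[mu2]_(y in box) (cst (g s)%:E) y)%E).
  apply: ge0_le_integral => //.
  - by move=> y _; rewrite lee_fin (gp_ge0 g01).
  - by apply/measurable_EFinP/measurable_funTS; exact: (measurable_gp g_noninc).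
  - move=> y [_ ys]; rewrite lee_fin; apply: g_noninc => //.
    rewrite -(ger0_norm s0) -sqrtr_sqr; apply: ler_wsqrtr.
    case: ys => ys.
      have : s ^+ 2 <= y.1 ^+ 2 by rewrite -(real_normK (num_real y.1)) ler_pXn2r// nnegrE.
      by have := sqr_ge0 y.2; lra.
    have : s ^+ 2 <= y.2 ^+ 2 by rewrite -(real_normK (num_real y.2)) ler_pXn2r// nnegrE.
    by have := sqr_ge0 y.1; lra.
rewrite integral_cst// muleC EFinM; apply: lee_wpmul2r; first by rewrite lee_fin.
apply: (@le_trans _ _ (mu2 (`[- (2 * s), 2 * s[%classic `*` `[- (2 * s), 2 * s[%classic))).
  by apply: le_measure; rewrite ?inE//; exact: subIsetl.
by rewrite area_box ?lee_fin; lra.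
Qed.

(** From one dyadic annulus to the next [ln x] grows by [ln 2], and the mass of an annulus is at
    most a small multiple of [1 / ln x ^+ 2]. Such terms sum from [s] onwards to a small multiple of
    [1 / ln s]. *)
Lemma far_ln e : 0 < e -> exists2 s0, 1 < s0 & forall s, s0 <= s -> T s * ln s <= e.
Proof.
move=> e0; pose c : R := ln 2; have c0 : 0 < c by rewrite ln_gt0// ltr1n.
(* Chosen so that [16 * e' / c = e / 2]; the remaining factor [u / (u - c)] is at most 2 because
   [s >= 4] means [u >= 2 * c]. *)
pose e' := e * c / 32; have e'0 : 0 < e' by rewrite divr_gt0// mulr_gt0.
have [s1 s11 Hs1] := profile_small e'0.
exists (Num.max s1 4) => [|s]; first by rewrite lt_max s11.
rewrite ge_max => /andP[ss1 s4]; have s0 : 0 < s by lra.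
pose u := ln s; have uc : 2 * c <= u.
  have -> : 2 * c = ln (2 * 2 : R) by rewrite lnM ?posrE// -/c; ring.
  by rewrite ler_ln ?posrE ?mulr_gt0//; lra.
(* The annulus at [x = 2 ^+ n * s] costs [16 * e' / ln x ^+ 2]. With [ln x = v + c], the bound
   [1 / (v + c) ^+ 2 <= 1 / (v * (v + c))] is [c^-1] times a difference of consecutive inverses, so
   that the costs telescope. *)
have key n : T s <= T (2 ^+ n * s) + 16 * e' / c * ((u - c)^-1 - (u + n%:R * c - c)^-1).
  elim: n => [|n IH]; first by rewrite expr0 mul1r mul0r addr0 subrr mulr0 addr0.
  have pn : 1 <= 2 ^+ n :> R by rewrite exprn_ege1// ler1n.
  have sn : s <= 2 ^+ n * s by rewrite ler_peMl// ltW.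
  have lnE : ln (2 ^+ n * s) = u + n%:R * c.
    by rewrite lnM ?posrE ?exprn_gt0// lnXn// addrC mulr_natl.
  apply: (le_trans IH); have := far_double (le_trans (ltW s0) sn).
  rewrite (exprS 2 n) -(mulrA 2 (2 ^+ n) s).
  have := Hs1 _ (le_trans ss1 sn); rewrite lnE.
  have nc : 0 <= n%:R * c by rewrite mulr_ge0// ltW.
  have -> : u + n.+1%:R * c - c = u + n%:R * c by rewrite -natr1; ring.
  set x := 2 ^+ n * s in sn *; have x0 : 0 < x by lra.
  pose v := u + n%:R * c - c; have v0 : 0 < v by rewrite /v; lra.
  have -> : u + n%:R * c = v + c by rewrite /v; ring.
  have -> : v + c - c = v by ring.
  have vcn : v + c != 0 by apply: lt0r_neq0; exact: addr_gt0.
  have xn : x != 0 by exact: lt0r_neq0.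
  have vn : v != 0 by exact: lt0r_neq0.
  have cn : c != 0 by exact: lt0r_neq0.
  have uc0 : 0 < u - c by lra.
  have ucn : u - c != 0 by exact: lt0r_neq0.
  move=> gx Tx; apply: (@le_trans _ _ (T (2 * x) + 16 * x ^+ 2 * (e' / (x ^+ 2 * (v + c) ^+ 2)) +
      16 * e' / c * ((u - c)^-1 - v^-1))).
    rewrite lerD2r; apply: (le_trans Tx); rewrite lerD2l.
    by rewrite ler_wpM2l// mulr_ge0// sqr_ge0.
  rewrite -addrA lerD2l.
  have -> : 16 * x ^+ 2 * (e' / (x ^+ 2 * (v + c) ^+ 2)) = 16 * e' / (v + c) ^+ 2.
    by field; rewrite vcn xn.
  have -> : 16 * e' / c * ((u - c)^-1 - (v + c)^-1) = 16 * e' / c * ((u - c)^-1 - v^-1) +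
      16 * e' / (v * (v + c)).
    by field; rewrite vcn vn ucn cn.
  rewrite [leLHS]addrC lerD2l; apply: ler_wpM2l; first by rewrite mulr_ge0// ltW.
  have vc0 : 0 < v + c by exact: addr_gt0.
  rewrite lef_pV2 ?posrE ?exprn_gt0 ?mulr_gt0// expr2.
  by rewrite ler_wpM2r ?(ltW vc0)// lerDl ltW.
have uc0 : 0 < u - c by lra.
have bound : T s <= 16 * e' / c * (u - c)^-1.
  apply/ler_addgt0Pr => t t0; have [s2 Hs2] := far_cvg0 g01 g_noninc C_def t0.
  pose n := Num.bound `|s2|.
  have ns : s2 <= 2 ^+ n * s.
    have h1 : s2 < n%:R by rewrite (le_lt_trans (ler_norm _))// archi_boundP.
    have h2 : n%:R <= 2 ^+ n :> R by rewrite -natrX ler_nat ltnW// ltn_expl.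
    have h3 : 2 ^+ n <= 2 ^+ n * s by rewrite ler_peMr ?exprn_ge0//; lra.
    lra.
  apply: (le_trans (key n)); rewrite addrC; apply: lerD; last exact: Hs2.
  apply: ler_wpM2l; first by rewrite divr_ge0 ?(ltW c0)// mulr_ge0// ltW.
  rewrite gerBl invr_ge0.
  have : 0 <= n%:R * c by rewrite mulr_ge0// ltW.
  lra.
apply: (@le_trans _ _ (16 * e' / c * (u - c)^-1 * u)).
  have u0 : 0 <= u by lra.
  exact: ler_wpM2r.
have -> : 16 * e' / c * (u - c)^-1 * u = (e / 2) * (u / (u - c)).
  by rewrite /e'; field; rewrite !gt_eqF.
have : u / (u - c) <= 2 by rewrite ler_pdivrMr//; lra.
have e2 : 0 <= e / 2 by rewrite divr_ge0// ltW.
by move=> /(ler_wpM2l e2)/le_trans; apply; rewrite divfK.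
Qed.

End tail.

(** * Bounded measurable functions under a probability *)

Section bounded_integral.
Context d (X : measurableType d) (R : realType) (U : probability X R).
Implicit Types f k : X -> R.

(** Such functions are integrable and stable under sums and products, which is enough to calculate
    with real-valued integrals without tracking integrability. *)
Definition bmeas f := measurable_fun setT f /\ exists M, forall x, `|f x| <= M.

Lemma bmeas_integrable f : bmeas f -> U.-integrable setT (EFin \o f).
Proof.
move=> [mf [M fM]]; apply: measurable_bounded_integrable => //.
  by rewrite (le_lt_trans (probability_le1 U measurableT))// ltry.
by exists M; split; [exact: num_real|move=> N /ltW MN x _; exact: le_trans (fM x) MN].
Qed.

Lemma bmeas01 f : measurable_fun setT f -> (forall x, 0 <= f x <= 1) -> bmeas f.
Proof.
move=> mf f01; split=> //; exists 1 => x.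
by have /andP[f0 f1] := f01 x; rewrite ger0_norm.
Qed.

Lemma bmeas_cst c : bmeas (cst c).
Proof. by split=> //; exists `|c|. Qed.

Lemma bmeasD f k : bmeas f -> bmeas k -> bmeas (fun x => f x + k x).
Proof.
move=> [mf [M fM]] [mk [N kN]]; split; first exact: measurable_funD.
by exists (M + N) => x; rewrite (le_trans (ler_normD _ _))// lerD.
Qed.

Lemma bmeasM f k : bmeas f -> bmeas k -> bmeas (fun x => f x * k x).
Proof.
move=> [mf [M fM]] [mk [N kN]]; split; first exact: measurable_funM.
by exists (M * N) => x; rewrite normrM ler_pM.
Qed.

Lemma bmeasB f k : bmeas f -> bmeas k -> bmeas (fun x => f x - k x).
Proof.
move=> bf bk; have := bmeasD bf (bmeasM (bmeas_cst (-1)) bk).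
by congr bmeas; apply/funext => x /=; rewrite mulN1r.
Qed.

Lemma bmeas_sum (I : Type) (s : seq I) (f : I -> X -> R) :
  (forall i, bmeas (f i)) -> bmeas (fun x => \sum_(i <- s) f i x).
Proof.
move=> bf; elim: s => [|i s IH].
  by under [X in bmeas X]eq_fun do rewrite big_nil; exact: bmeas_cst.
by under [X in bmeas X]eq_fun do rewrite big_cons; exact: bmeasD.
Qed.

Lemma le_bint f k : bmeas f -> bmeas k -> (forall x, f x <= k x) ->
  \int[U]_x f x <= \int[U]_x k x.
Proof. by move=> bf bk fk; apply: le_Rintegral => //; exact: bmeas_integrable. Qed.

Lemma bintD f k : bmeas f -> bmeas k ->
  \int[U]_x (f x + k x) = \int[U]_x f x + \int[U]_x k x.
Proof. by move=> bf bk; apply: RintegralD => //; exact: bmeas_integrable. Qed.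

Lemma bintB f k : bmeas f -> bmeas k ->
  \int[U]_x (f x - k x) = \int[U]_x f x - \int[U]_x k x.
Proof. by move=> bf bk; apply: RintegralB => //; exact: bmeas_integrable. Qed.

Lemma bintZ c f : bmeas f -> \int[U]_x (c * f x) = c * \int[U]_x f x.
Proof. by move=> bf; apply: RintegralZl => //; exact: bmeas_integrable. Qed.

Lemma bint_cst c : \int[U]_x c = c.
Proof.
rewrite Rintegral_cst// -[RHS]mulr1; congr (_ * _).
exact: (congr1 fine (@probability_setT _ _ _ U)).
Qed.

Lemma bint_sum (I : Type) (s : seq I) (f : I -> X -> R) :
  (forall i, bmeas (f i)) ->
  \int[U]_x (\sum_(i <- s) f i x) = \sum_(i <- s) \int[U]_x f i x.
Proof.
move=> bf; elim: s => [|i s IH].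
  by under eq_Rintegral do rewrite big_nil; rewrite bint_cst big_nil.
under eq_Rintegral do rewrite big_cons.
by rewrite bintD ?IH ?big_cons//; exact: bmeas_sum.
Qed.

Lemma bintE f : bmeas f -> (\int[U]_x (f x)%:E)%E = (\int[U]_x f x)%:E.
Proof. by move=> bf; rewrite /Rintegral fineK//; exact/integrable_fin_num/bmeas_integrable. Qed.

End bounded_integral.

Lemma prod_onem_ge (R : realType) (I : Type) (s : seq I) (t : I -> R) :
  (forall i, 0 <= t i <= 1) -> 1 - \sum_(i <- s) t i <= \prod_(i <- s) (1 - t i).
Proof.
move=> t01; elim: s => [|i s IH]; first by rewrite !big_nil subr0.
rewrite !big_cons; have /andP[ti0 ti1] := t01 i.
apply: (@le_trans _ _ ((1 - t i) * (1 - \sum_(j <- s) t j))).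
  have := mulr_ge0 ti0 (sumr_ge0 s (P := xpredT) (F := t) (fun j _ => proj1 (andP (t01 j)))); lra.
by apply: ler_wpM2l => //; rewrite subr_ge0.
Qed.

(** * Neighbourhoods in the square *)

Section range.
Context (R : realType) (g : R -> R) (C : R).
Hypothesis g01 : forall x : R, 0 <= x -> 0 <= g x <= 1.
Hypothesis g_noninc : forall x y : R, 0 <= x -> x <= y -> g y <= g x.
Local Notation mu2 := (@lebesgue_measure R \x @lebesgue_measure R)%E.
Hypothesis C_def : (\int[mu2]_x (g (eucl_norm x))%:E = C%:E)%E.
Context (r : R).
Hypothesis r0 : 0 < r.
Local Notation U := (@square_unif R).

Local Notation h := (fun x : R => g (x / r)).
Implicit Types (x y v : plane R) (u : seq (plane R)).
Local Notation link x y := (g (eucl_norm (x - y) / r)).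

Lemma scaled01 (x : R) : 0 <= x -> 0 <= h x <= 1.
Proof. by move=> x0; apply: g01; rewrite divr_ge0// ltW. Qed.

Lemma measurable_scaled : measurable_fun setT
  (fun z : plane R * plane R => h (eucl_norm (z.1 - z.2))).
Proof.
apply: (measurable_profile g_noninc); last first.
  by move=> z; rewrite divr_ge0 ?eucl_norm_ge0// ltW.
apply: measurable_funM => //.
apply: (measurableT_comp (@measurable_eucl_norm R)).
apply: measurable_fun_pair; apply: measurable_funB.
- exact: (measurableT_comp measurable_fst measurable_fst).
- exact: (measurableT_comp measurable_fst measurable_snd).
- exact: (measurableT_comp measurable_snd measurable_fst).
- exact: (measurableT_comp measurable_snd measurable_snd).
Qed.

Lemma link01 x y : 0 <= link x y <= 1.
Proof. exact/scaled01/eucl_norm_ge0. Qed.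

Lemma linkC x y : link x y = link y x.
Proof. by have := absentC h x y; rewrite /absent; lra. Qed.

Lemma bmeas_link x : bmeas (fun y : plane R => link x y).
Proof.
apply: bmeas01 => [|y]; last exact: link01.
have := measurableT_comp measurable_scaled
  (measurable_fun_pair (measurable_cst (x : plane R)) (@measurable_id _ (plane R) setT)).
exact.
Qed.

Lemma bmeas_prod_absent u : bmeas (fun y : plane R => \prod_(x <- u) absent h x y).
Proof.
apply: bmeas01 => [|y].
  exact: (measurable_prod_absentl measurable_scaled).
by rewrite (prod_absent_ge0 scaled01) (prod_absent_le1 scaled01).
Qed.

(* Conditioning the points of [u] to be isolated removes the nodes linked to
   them, which leaves this much of the neighbourhood of [x]. *)
Definition thinned x u : R := \int[U]_y (link x y * \prod_(v <- u) absent h v y).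

Lemma missE u : miss h u = \int[U]_y \prod_(x <- u) absent h x y.
Proof. by []. Qed.

Lemma bmeas_thinned x u : bmeas (fun y => link x y * \prod_(v <- u) absent h v y).
Proof. exact: bmeasM (bmeas_link x) (bmeas_prod_absent u). Qed.

Lemma miss_cons x u : miss h (x :: u) = miss h u - thinned x u.
Proof.
rewrite !missE -bintB; [|exact: bmeas_prod_absent|exact: bmeas_thinned].
by apply: eq_Rintegral => y _; rewrite big_cons /absent; ring.
Qed.

Lemma miss_nil : miss h [::] = 1.
Proof.
by rewrite missE; under eq_Rintegral do rewrite big_nil; exact: bint_cst.
Qed.

Lemma thinned_nil x : thinned x [::] = \int[U]_y link x y.
Proof. by apply: eq_Rintegral => y _; rewrite big_nil mulr1. Qed.

Lemma thinned_le x u : thinned x u <= \int[U]_y link x y.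
Proof.
apply: le_bint => [||y]; [exact: bmeas_thinned|exact: bmeas_link|].
have /andP[l0 l1] := link01 x y.
by rewrite ler_piMr// (prod_absent_le1 scaled01).
Qed.

Lemma thinned_ge x u : \int[U]_y link x y - \sum_(v <- u) \int[U]_y (link x y * link v y)
  <= thinned x u.
Proof.
have bl v : bmeas (fun y => link x y * link v y) by exact: bmeasM (bmeas_link x) (bmeas_link v).
rewrite -bint_sum// -bintB; [|exact: bmeas_link|exact: bmeas_sum].
apply: le_bint => [||y]; [|exact: bmeas_thinned|].
  by apply: bmeasB; [exact: bmeas_link|exact: bmeas_sum].
have /andP[l0 l1] := link01 x y.
rewrite -mulr_sumr -{1}(mulr1 (link x y)) -mulrBr; apply: ler_wpM2l => //.
by apply: prod_onem_ge => v; exact: link01.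
Qed.

Let mlink x : measurable_fun setT (fun y : plane R => (link x y)%:E).
Proof. by apply/measurable_EFinP; have [] := bmeas_link x. Qed.

Let link_ge0 x y : (0 <= (link x y)%:E)%E.
Proof. by rewrite lee_fin; have /andP[] := link01 x y. Qed.

Lemma integral_link_le x : \int[U]_y link x y <= r ^+ 2 * C.
Proof.
rewrite -lee_fin -bintE; last exact: bmeas_link.
rewrite integral_square_unif; [|exact: mlink|exact: link_ge0].
apply: (@le_trans _ _ (\int[mu2]_(y in affine2 x r r @^-1` setT) (link x y)%:E)%E).
  rewrite preimage_setT; apply: ge0_subset_integral => //.
  exact: measurable_unit_square.
have nr : `|r| = r by rewrite gtr0_norm.
rewrite (integral_profile_affine g01 g_noninc C_def x measurableT r0 nr nr).
by rewrite (mass_setT C_def).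
Qed.

(* The point [t] of a side of the square is at distance at least [r * a] from the
   nearer end. *)
Definition room (a t : R) : bool :=
  ((t <= 0) && (- 2^-1 <= t - r * a)) || ((0 < t) && (t + r * a < 2^-1)).

Lemma room0 t : - 2^-1 <= t < 2^-1 -> room 0 t.
Proof. by move=> /andP[t1 t2]; rewrite /room mulr0 subr0 addr0 t1 t2 !andbT; case: leP. Qed.

(** The scale [e] is negative when [t] is in the right half, which turns the nearer end towards the
    negative side. There the room is [a]; on the other side at least half of the square remains, of
    rescaled length [(2 * r)^-1]. *)
Let room_scale a t : room a t -> exists2 e, `|e| = r &
  forall y : R, - a <= (y - t) / e < (2 * r)^-1 -> - 2^-1 <= y < 2^-1.
Proof.
have half : r * (2 * r)^-1 = 2^-1 by field; rewrite lt0r_neq0.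
move=> /orP[]/andP[t0 ta].
  exists r; first by rewrite gtr0_norm.
  move=> y; rewrite ler_pdivlMr// ltr_pdivrMr// => /andP[y1 y2].
  rewrite mulrC half in y2; lra.
exists (- r); first by rewrite normrN gtr0_norm.
move=> y; rewrite invrN mulrN -mulNr opprB ler_pdivlMr// ltr_pdivrMr// => /andP[y1 y2].
rewrite mulrC half in y2; lra.
Qed.

(** After rescaling, the square contains the part of the quadrant below [(2 * r)^-1] in both
    coordinates. The rest of the quadrant is in [far (2 * r)^-1], hence in [far D] as
    [r * D < 2^-1]. *)
Lemma integral_link_ge x a b D : room a x.1 -> room b x.2 -> r * D < 2^-1 ->
  r ^+ 2 * (mass g (quadrant a b) - mass g (far D)) <= \int[U]_y link x y.
Proof.
move=> /room_scale[e1 e1r H1] /room_scale[e2 e2r H2] rD.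
have DD : D <= (2 * r)^-1.
  by rewrite invfM -ler_pdivrMr ?invr_gt0// invrK mulrC ltW.
pose A : set (plane R) := `[- a, (2 * r)^-1[%classic `*` `[- b, (2 * r)^-1[%classic.
have mA : measurable A by apply: measurableX; exact: measurable_itv.
have mf t : measurable (far t : set (plane R)) by exact: measurable_far.
rewrite -lee_fin -bintE; last exact: bmeas_link.
rewrite integral_square_unif; [|exact: mlink|exact: link_ge0].
apply: (@le_trans _ _ (\int[mu2]_(y in affine2 x e1 e2 @^-1` A) (link x y)%:E)%E).
  rewrite (integral_profile_affine g01 g_noninc C_def x mA r0 e1r e2r) lee_fin.
  apply: ler_wpM2l; first exact: sqr_ge0.
  have := le_far g01 g_noninc C_def DD.
  suff : mass g (quadrant a b) <= mass g A + mass g (far (2 * r)^-1) by lra.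
  apply: (mass_cover g01 g_noninc C_def) => //; first exact: measurable_quadrant.
  move=> y [ya yb]; have [y1|y1] := ltP y.1 (2 * r)^-1; last first.
    by right; left; rewrite (le_trans y1)// ler_norm.
  have [y2|y2] := ltP y.2 (2 * r)^-1; last first.
    by right; right; rewrite (le_trans y2)// ler_norm.
  by left; split; rewrite /= in_itv/= ?ya ?yb.
have mpre : measurable (affine2 x e1 e2 @^-1` A).
  by rewrite -[X in measurable X]setTI; apply: measurable_affine2.
apply: ge0_subset_integral; [exact: mpre|exact: measurable_unit_square| | |].
- exact: measurable_funTS.
- by move=> y _; exact: link_ge0.
- move=> y [/=]; rewrite !in_itv/= => y1 y2; split; rewrite /= in_itv/=.
    exact: H1 y1.
  exact: H2 y2.
Qed.

End range.

Section clearing.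
Context (R : realType) (g : R -> R) (C : R).
Hypothesis g01 : forall x : R, 0 <= x -> 0 <= g x <= 1.
Hypothesis g_noninc : forall x y : R, 0 <= x -> x <= y -> g y <= g x.
Local Notation mu2 := (@lebesgue_measure R \x @lebesgue_measure R)%E.
Hypothesis C_def : (\int[mu2]_x (g (eucl_norm x))%:E = C%:E)%E.
Hypothesis C_gt0 : 0 < C.
Implicit Types (z v : plane R).

Lemma sqr_le_bound (a s : R) : - s <= a -> a <= s -> a ^+ 2 <= s ^+ 2.
Proof.
move=> sa as_; rewrite -subr_ge0 subr_sqr mulr_ge0//; lra.
Qed.

Lemma norm_le s z : 0 <= s -> (z.1 ^+ 2 + z.2 ^+ 2 <= s ^+ 2) = (eucl_norm z <= s).
Proof.
move=> s0; rewrite -{2}(ger0_norm s0) -sqrtr_sqr /eucl_norm ler_sqrt//.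
exact: sqr_ge0.
Qed.

Lemma norm_ge s z : 0 <= s -> (s ^+ 2 <= z.1 ^+ 2 + z.2 ^+ 2) = (s <= eucl_norm z).
Proof.
move=> s0; rewrite -{2}(ger0_norm s0) -sqrtr_sqr /eucl_norm ler_sqrt//.
by rewrite addr_ge0// sqr_ge0.
Qed.

Lemma far_norm s z : 0 <= s -> far s z -> s <= eucl_norm z.
Proof.
move=> s0; rewrite -norm_ge// => -[] sz.
  have : s ^+ 2 <= z.1 ^+ 2 by rewrite -(real_normK (num_real z.1)) ler_pXn2r// nnegrE.
  by have := sqr_ge0 z.2; lra.
have : s ^+ 2 <= z.2 ^+ 2 by rewrite -(real_normK (num_real z.2)) ler_pXn2r// nnegrE.
by have := sqr_ge0 z.1; lra.
Qed.

Lemma profile_pos : exists2 eta, 0 < eta & 0 < g eta.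
Proof.
apply: contrapT => H.
have g0 s : 0 < s -> g s = 0.
  move=> s0; apply/eqP; rewrite eq_le; have /andP[-> _] := g01 (ltW s0); rewrite andbT.
  by rewrite leNgt; apply/negP => gs; apply: H; exists s.
have mf t : measurable (far t : set (plane R)) by exact: measurable_far.
have small e : 0 < e -> C <= (2 * e) ^+ 2.
  move=> e0; pose box : set (plane R) := `[- e, e[%classic `*` `[- e, e[%classic.
  have mbox : measurable box by apply: measurableX; exact: measurable_itv.
  have massf : mass g (far e) = 0.
    rewrite /mass integral0_eq// => y ye; rewrite /gp g0//.
    exact: lt_le_trans (far_norm (ltW e0) ye).
  have massb : mass g box <= (2 * e) ^+ 2.
    rewrite -lee_fin -(massE g01 g_noninc C_def)//.
    apply: (@le_trans _ _ (\int[mu2]_(y in box) (cst 1%E) y)%E).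
      apply: ge0_le_integral => //.
      - by move=> y _; rewrite lee_fin gp_ge0.
      - by apply/measurable_EFinP/measurable_funTS; exact: measurable_gp.
      - by move=> y _; rewrite lee_fin gp_le1.
    rewrite integral_cst// mul1e.
    apply: (@le_trans _ _ (mu2 (`[- e, e[%classic `*` `[- e, e[%classic))) => //.
    by rewrite area_box ?lee_fin; lra.
  rewrite -(mass_setT C_def); apply: (@le_trans _ _ (mass g box + mass g (far e))); last first.
    by rewrite massf addr0.
  apply: (mass_cover g01 g_noninc C_def) => // y _; have [ye|ye] := pselect (far e y); [by right|left].
  move/not_orP : ye => -[/negP + /negP]; rewrite -!ltNge !ltr_norml.
  by split; rewrite /= in_itv/=; lra.
have [c c0 cC] : exists2 c, 0 < c & c ^+ 2 < C.
  exists (Num.min 1 (C / 2)); first by rewrite lt_min ltr01 divr_gt0.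
  have c0 : 0 < Num.min 1 (C / 2) by rewrite lt_min ltr01 divr_gt0.
  have c1 : Num.min 1 (C / 2) <= 1 by rewrite ge_min lexx.
  have c2 : Num.min 1 (C / 2) <= C / 2 by rewrite ge_min lexx orbT.
  rewrite expr2; have := ler_wpM2r (ltW c0) c1; lra.
have := small (c / 2); rewrite divr_gt0// => /(_ isT).
by rewrite (_ : 2 * (c / 2) = c); [lra|field].
Qed.

(* A region next to the origin on the left, each point of which is linked to the
   origin with probability at least [alpha], and missed with probability at least
   [beta] by any point on the right that can avoid the origin. *)
Lemma clearing : (exists2 s, 0 < s & g s < 1) ->
  exists t1 t2 w alpha beta, [/\ 0 < t1 < t2, 0 < w, 0 < alpha, 0 < beta <= 1 &
  forall z, - t2 <= z.1 < - t1 -> - w <= z.2 < w -> alpha <= g (eucl_norm z) /\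
    forall v, 0 <= v.1 -> g (eucl_norm v) < 1 -> beta <= 1 - g (eucl_norm (z - v))].
Proof.
move=> [big big0 gbig].
(* If the profile is below 1 at every positive distance, horizontal separation alone suffices: a
   region at distance [eta / 4] from the right half-plane gives [beta = 1 - g (eta / 4)]. Otherwise
   the profile is 1 up to some [s0], and the region must be within [s0] of the origin but further
   than [s0] from every admissible [v]. *)
have [[s1 s10 gs1]|H] := pselect (exists2 s, 0 < s & g s = 1); last first.
  have g1 s : 0 < s -> g s < 1.
    move=> s0; rewrite lt_neqAle; have /andP[_ ->] := g01 (ltW s0); rewrite andbT.
    by apply/eqP => gs; apply: H; exists s.
  have [eta eta0 geta] := profile_pos.
  exists (eta / 4), (eta / 2), (eta / 2), (g eta), (1 - g (eta / 4)); split=> //; try lra.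
    have q0 : 0 < eta / 4 by rewrite divr_gt0.
    by rewrite subr_gt0 (g1 _ q0)/= gerBl; have /andP[] := g01 (ltW q0).
  move=> z /andP[z1 z1'] /andP[z2 z2']; split.
    apply: g_noninc; first exact: eucl_norm_ge0.
    rewrite -norm_le ?(ltW eta0)//.
    have : z.1 ^+ 2 <= (eta / 2) ^+ 2 by apply: sqr_le_bound; lra.
    have : z.2 ^+ 2 <= (eta / 2) ^+ 2.
      by apply: sqr_le_bound; lra.
    have := sqr_ge0 eta; rewrite exprMn; lra.
  move=> v v1 _; rewrite lerD2l lerN2; apply: g_noninc; first lra.
  apply: far_norm; first lra.
  left; rewrite /= distrC ler_normr; apply/orP; left; lra.
pose E : set R := [set s | 0 < s /\ g s = 1].
have ubE : ubound E big.
  move=> s [s0 gs]; rewrite leNgt; apply/negP => bs.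
  by have := g_noninc (ltW big0) (ltW bs); rewrite gs; lra.
have supE : has_sup E by split; [exists s1|exists big].
pose s0 := sup E.
have s00 : 0 < s0 by apply: (lt_le_trans s10); apply: ub_le_sup; [exists big|].
have below s : 0 <= s -> s < s0 -> g s = 1.
  move=> sge ss0; have [t [t0 gt] st] := sup_gt supE.1 ss0.
  apply/eqP; rewrite eq_le; have /andP[_ ->] := g01 sge; rewrite /= -gt.
  by apply: g_noninc => //; exact: ltW.
have above s : s0 < s -> g s < 1.
  move=> ss; have sp : 0 < s by exact: lt_trans ss.
  rewrite lt_neqAle; have /andP[_ ->] := g01 (ltW sp); rewrite andbT.
  apply/eqP => gs; have : s <= s0 by apply: ub_le_sup; [exists big|].
  lra.
(* The region is within [4 / 5 * s0] of the origin, hence surely linked to it. An admissible [v] is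
   at distance [n >= s0] from the origin, so its squared distance to [z] is at least
   [s0 ^+ 2 / 4 + n ^+ 2 - n * s0 / 8], which is at least [9 / 8 * s0 ^+ 2] and exceeds the square
   of [21 / 20 * s0]. A factor above 1 is required because [g s0] itself may be 1. *)
exists (s0 / 2), (3 * s0 / 4), (s0 / 16), 1, (1 - g (21 / 20 * s0)); split=> //; try lra.
  have q0 : 0 < 21 / 20 * s0 by lra.
  rewrite subr_gt0 gerBl; have /andP[-> _] := g01 (ltW q0).
  by rewrite above//; lra.
move=> z /andP[z1 z1'] /andP[z2 z2']; split.
  have zn : eucl_norm z <= 4 / 5 * s0.
    rewrite -norm_le; last lra.
    have : z.1 ^+ 2 <= (3 * s0 / 4) ^+ 2 by apply: sqr_le_bound; lra.
    have : z.2 ^+ 2 <= (s0 / 16) ^+ 2.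
      by apply: sqr_le_bound; lra.
    have := sqr_ge0 s0; rewrite !exprMn; lra.
  by rewrite below//; [exact: eucl_norm_ge0|lra].
move=> v v1 gv; rewrite lerD2l lerN2; apply: g_noninc; first lra.
rewrite -norm_ge; last lra.
have : s0 <= eucl_norm v.
  rewrite leNgt; apply/negP => vs; move: gv; rewrite below ?ltxx//; exact: eucl_norm_ge0.
set n := eucl_norm v => s0n; have nv : n ^+ 2 = v.1 ^+ 2 + v.2 ^+ 2.
  by rewrite sqr_sqrtr// addr_ge0// sqr_ge0.
have v2n : `|v.2| <= n by rewrite -sqrtr_sqr ler_sqrt ?addr_ge0 ?sqr_ge0// lerDr sqr_ge0.
rewrite -[(z - v).1]/(z.1 - v.1) -[(z - v).2]/(z.2 - v.2).
have h1 : (s0 / 2) ^+ 2 + v.1 ^+ 2 <= (z.1 - v.1) ^+ 2.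
  have q : (s0 / 2) ^+ 2 <= z.1 ^+ 2 by rewrite -[z.1 ^+ 2]sqrrN; apply: sqr_le_bound; lra.
  have p : 0 <= - z.1 * v.1 by apply: mulr_ge0 => //; lra.
  by rewrite sqrrB; lra.
have h2 : v.2 ^+ 2 - n * (s0 / 8) <= (z.2 - v.2) ^+ 2.
  have q : z.2 * v.2 <= s0 / 16 * n.
    apply: (le_trans (ler_norm _)); rewrite normrM ler_pM// ler_norml.
    by apply/andP; split; lra.
  by rewrite sqrrB; have := sqr_ge0 z.2; lra.
have h3 : 0 <= (n - s0) * (n + s0 - s0 / 8) by apply: mulr_ge0; lra.
rewrite expr2; rewrite expr2 in nv; rewrite expr2 in h1; have := mulr_gt0 s00 s00; nra.
Qed.

End clearing.

Section range.
Context (R : realType) (g : R -> R) (C : R).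
Hypothesis g01 : forall x : R, 0 <= x -> 0 <= g x <= 1.
Hypothesis g_noninc : forall x y : R, 0 <= x -> x <= y -> g y <= g x.
Local Notation mu2 := (@lebesgue_measure R \x @lebesgue_measure R)%E.
Hypothesis C_def : (\int[mu2]_x (g (eucl_norm x))%:E = C%:E)%E.
Context (r : R).
Hypothesis r0 : 0 < r.
Local Notation U := (@square_unif R).
Local Notation h := (fun x : R => g (x / r)).
Implicit Types (x y v : plane R) (u : seq (plane R)).
Local Notation link x y := (g (eucl_norm (x - y) / r)).

Let bl x : bmeas (fun y => link x y). Proof. exact: bmeas_link. Qed.
Let l01 x y : 0 <= link x y <= 1. Proof. exact: link01. Qed.

Lemma far_link s x y : 0 <= s -> far (s * r) (x - y) -> link x y <= g s.
Proof.
move=> s0 f; apply: g_noninc => //; rewrite ler_pdivlMr//.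
by apply: far_norm => //; rewrite mulr_ge0// ltW.
Qed.

(* No point is within half the distance of two points at once. *)
Lemma overlap_le s x v : 0 <= s -> far (s * r) (x - v) ->
  \int[U]_y (link x y * link v y) <= 2 * r ^+ 2 * C * g (s / 2).
Proof.
move=> s0 f; have s2 : 0 <= s / 2 by rewrite divr_ge0.
have /andP[g0 _] := g01 s2.
apply: (@le_trans _ _ (\int[U]_y (g (s / 2) * (link x y + link v y)))).
  apply: le_bint => [||y]; first exact: bmeasM.
    by apply: bmeasM; [exact: bmeas_cst|exact: bmeasD].
  have /andP[x0 x1] := l01 x y; have /andP[v0 v1] := l01 v y.
  have [xy|xy] := pselect (far (s / 2 * r) (x - y)).
    have := far_link s2 xy => lx.
    have := ler_wpM2r v0 lx; have := mulr_ge0 g0 x0; lra.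
  have vy : far (s / 2 * r) (v - y).
    move/not_orP : xy => -[/negP + /negP]; rewrite -!ltNge => a1 a2.
    case: f => f; [left|right]; rewrite /= in a1 a2 f *.
      have := ler_normB (x.1 - y.1) (v.1 - y.1).
      by rewrite (_ : x.1 - y.1 - (v.1 - y.1) = x.1 - v.1); [lra|ring].
    have := ler_normB (x.2 - y.2) (v.2 - y.2).
    by rewrite (_ : x.2 - y.2 - (v.2 - y.2) = x.2 - v.2); [lra|ring].
  have := far_link s2 vy => lv.
  have := ler_wpM2l x0 lv; have := mulr_ge0 g0 v0; lra.
rewrite bintZ; last exact: bmeasD.
rewrite bintD// [leRHS]mulrC; apply: ler_wpM2l => //.
have ix := integral_link_le g01 g_noninc C_def r0 x.
have iv := integral_link_le g01 g_noninc C_def r0 v.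
lra.
Qed.

Lemma thinned_ge_far s x u : 0 <= s -> (forall v, v \in u -> far (s * r) (x - v)) ->
  \int[U]_y link x y - (size u)%:R * (2 * r ^+ 2 * C * g (s / 2)) <= thinned g r x u.
Proof.
move=> s0 f; apply: le_trans (thinned_ge g01 g_noninc r0 x u); rewrite lerD2l lerN2.
apply: (@le_trans _ _ (\sum_(v <- u) (2 * r ^+ 2 * C * g (s / 2)))).
  by rewrite !big_seq; apply: ler_sum => v vu; apply: overlap_le => //; exact: f.
by rewrite big_const_seq count_predT iter_addr addr0 -[leLHS]mulr_natl.
Qed.

Let room_in a t : room r a t -> r * a < 2^-1 -> - 2^-1 <= t - r * a /\ t + r * a < 2^-1.
Proof. by move=> /orP[]/andP[ha hb] ra; split; lra. Qed.

(** The integral is restricted to the copy of the clearing at [x], which the room [D] keeps inside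
    the square. There the link to [x] contributes [alpha] and each point of [u] a factor [beta]. *)
Lemma thinned_ge_near t1 t2 w alpha beta D x u :
  0 < t1 < t2 -> 0 < w -> 0 < alpha -> 0 < beta ->
  (forall z : plane R, - t2 <= z.1 < - t1 -> - w <= z.2 < w -> alpha <= g (eucl_norm z) /\
    forall v, 0 <= v.1 -> g (eucl_norm v) < 1 -> beta <= 1 - g (eucl_norm (z - v))) ->
  t2 <= D -> w <= D -> r * D < 2^-1 -> room r D x.1 -> room r D x.2 ->
  (forall v, v \in u -> x.1 <= v.1 /\ absent h x v != 0) ->
  r ^+ 2 * (2 * w * (t2 - t1) * (alpha * beta ^+ size u)) <= thinned g r x u.
Proof.
move=> /andP[t10 t12] w0 al be clear t2D wD rD x1 x2 Hu.
pose B : set (plane R) := `[- t2, - t1[%classic `*` `[- w, w[%classic.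
pose Y := affine2 x r r @^-1` B.
have mB : measurable B by apply: measurableX; exact: measurable_itv.
have mY : measurable Y by rewrite -[X in measurable X]setTI; apply: measurable_affine2.
have rn : r != 0 by exact: lt0r_neq0.
have nr : `|r| = r by rewrite gtr0_norm.
have YS : Y `<=` @unit_square R.
  have [a1 a2] := room_in x1 rD; have [b1 b2] := room_in x2 rD.
  have rt := ler_wpM2l (ltW r0) t2D; have rw := ler_wpM2l (ltW r0) wD.
  have rt1 := mulr_gt0 r0 t10.
  move=> y [/=]; rewrite !in_itv/= !ler_pdivlMr// !ltr_pdivrMr// => /andP[y1 y1'] /andP[y2 y2'].
  by split; rewrite /= in_itv/=; apply/andP; split; lra.
have UY : U Y = (r ^+ 2 * (2 * w * (t2 - t1)))%:E.
  apply: (eq_trans (square_unifE Y)); rewrite setIidl//.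
  apply: (eq_trans (area_affine2 x rn rn mB)); rewrite EFinM -expr2 normrX nr.
  by congr (_ * _)%E; rewrite area_box; [congr EFin; ring|lra|lra].
have bY : bmeas (\1_Y : plane R -> R).
  by apply: bmeas01 => [|y]; rewrite ?indicE ?ler01 ?lexx//; case: (y \in Y); rewrite ?lexx ?ler01.
set c := alpha * _.
have -> : r ^+ 2 * (2 * w * (t2 - t1) * c) = \int[U]_y (c * \1_Y y).
  rewrite bintZ//; have -> : \int[U]_y \1_Y y = r ^+ 2 * (2 * w * (t2 - t1)); last ring.
  rewrite -[RHS]/(fine (_%:E)) -UY; congr fine.
  by apply: (eq_trans (integral_indic _ _ _)) => //; rewrite setIT.
have bc : bmeas (fun y => c * \1_Y y) by apply: bmeasM; [exact: bmeas_cst|exact: bY].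
apply: le_bint; [exact: bc|exact: bmeas_thinned|].
move=> y; rewrite indicE; have [Yy|_] := boolP (y \in Y); last first.
  by rewrite mulr0 mulr_ge0//; [have /andP[] := l01 x y|exact: (prod_absent_ge0 (scaled01 g01 r0))].
move/set_mem : Yy => [/= y1 y2]; rewrite mulr1.
rewrite !in_itv/= in y1 y2.
have [ca cb] := clear (affine2 x r r y) y1 y2.
rewrite (eucl_norm_affine2 x y r0 nr nr) in ca.
rewrite /c; apply: ler_pM => //; [exact: ltW|by rewrite exprn_ge0// ltW|].
elim: u Hu {c bc} => [|v u IH] Hu; first by rewrite big_nil.
rewrite big_cons exprS; apply: ler_pM; rewrite ?exprn_ge0 ?(ltW be)//; last first.
  by apply: IH => v' v'u; apply: Hu; rewrite inE v'u orbT.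
have [xv av] := Hu v (mem_head _ _).
have v1 : 0 <= (affine2 x r r v).1 by rewrite /= divr_ge0 ?(ltW r0)//; lra.
have gv : g (eucl_norm (affine2 x r r v)) < 1.
  rewrite (eucl_norm_affine2 x v r0 nr nr) lt_neqAle.
  have /andP[_ ->] := l01 x v; rewrite andbT.
  by apply: contra_neq av => e; rewrite /absent e subrr.
have := cb _ v1 gv.
have -> : affine2 x r r y - affine2 x r r v = affine2 v r r y.
  by rewrite /affine2; congr pair => /=; ring.
by rewrite (eucl_norm_affine2 v y r0 nr nr).
Qed.

End range.

(** * Moments in the interior *)

Section interior.
Context (R : realType) (g : R -> R) (C : R).
Hypothesis g01 : forall x : R, 0 <= x -> 0 <= g x <= 1.
Hypothesis g_noninc : forall x y : R, 0 <= x -> x <= y -> g y <= g x.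
Local Notation mu2 := (@lebesgue_measure R \x @lebesgue_measure R)%E.
Hypothesis C_def : (\int[mu2]_x (g (eucl_norm x))%:E = C%:E)%E.
Context (b L r D rho : R).
Hypothesis r0 : 0 < r.
Hypothesis L0 : 0 < L.
Hypothesis rhoE : rho = expR (L - b).
Hypothesis rhoL : rho * r ^+ 2 * C = L.
Hypothesis D0 : 0 < D.
Hypothesis rD : r * D < 2^-1.
Local Notation U := (@square_unif R).
Local Notation h := (fun x : R => g (x / r)).
Implicit Types (x y v : plane R) (u : seq (plane R)).
Local Notation link x y := (g (eucl_norm (x - y) / r)).

Definition interior : set (plane R) := [set x | room r D x.1 && room r D x.2].

Lemma measurable_room a : measurable [set t : measurableTypeR R | room r a t].
Proof.
rewrite (_ : [set _ | _] = `[- 2^-1 + r * a, 0]%classic `|` `]0, 2^-1 - r * a[%classic).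
  by apply: measurableU; exact: measurable_itv.
apply/seteqP; split=> t /=; rewrite /room.
  by move=> /orP[]/andP[h1 h2]; [left|right]; rewrite in_itv/=; apply/andP; split; lra.
by rewrite !in_itv/= => -[]/andP[h1 h2]; apply/orP; [left|right]; apply/andP; split; lra.
Qed.

Lemma measurable_interior : measurable interior.
Proof.
rewrite (_ : interior = [set t : measurableTypeR R | room r D t] `*`
    [set t : measurableTypeR R | room r D t]).
  by apply: measurableX; exact: measurable_room.
by apply/seteqP; split=> x /=; rewrite /interior /=; [move/andP|move=> H; apply/andP].
Qed.

Definition isolation u : R :=
  (all (fun x => x \in interior) u)%:R * isolation_density h rho u.

(** The conditional probability that [x] is isolated given that [u] is: no edge to [u], and no edge
    to a node of the process that remains after conditioning. *)
Definition rate x u := (\prod_(v <- u) absent h x v) * expR (- (rho * thinned g r x u)).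

Lemma isolation_ge0 u : 0 <= isolation u.
Proof.
rewrite mulr_ge0// mulr_ge0 ?expR_ge0//; exact: (pairprod_ge0 (scaled01 g01 r0)).
Qed.

Lemma isolation_nil : isolation [::] = 1.
Proof. by rewrite /isolation /isolation_density /= miss_nil subrr mulr0 expR0 !mulr1. Qed.

Lemma isolation_cons x u :
  isolation (x :: u) = (x \in interior)%:R * rate x u * isolation u.
Proof.
rewrite /isolation /isolation_density (miss_cons g01 g_noninc r0)/= -mulnb natrM /rate.
have -> : rho * (miss h u - thinned g r x u - 1) =
  - (rho * thinned g r x u) + rho * (miss h u - 1) by ring.
by rewrite expRD; ring.
Qed.

Lemma perm_isolation u u' : perm_eq u u' -> isolation u = isolation u'.
Proof.
move=> uu'; rewrite /isolation /isolation_density (perm_all _ uu') (perm_pairprod (absentC h) uu').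
suff -> : miss h u = miss h u' by [].
by congr fine; apply: eq_integral => y _; rewrite (perm_big _ uu').
Qed.

Lemma smeas_isolation : smeas isolation.
Proof.
move=> dz Z fs; apply: measurable_funM; first exact: (smeas_all measurable_interior).
apply: measurable_funM; first exact: (smeas_pairprod (measurable_scaled g_noninc r0)).
apply: measurableT_comp => //; apply: measurable_funM => //; apply: measurable_funB => //.
exact: (smeas_miss (scaled01 g01 r0) (measurable_scaled g_noninc r0)).
Qed.

Let rho0 : 0 <= rho. Proof. by rewrite rhoE expR_ge0. Qed.

Let prod01 x u : 0 <= \prod_(v <- u) absent h x v <= 1.
Proof.
have E : \prod_(v <- u) absent h x v = \prod_(v <- u) absent h v x.
  by apply: eq_bigr => v _; rewrite absentC.
by rewrite E (prod_absent_ge0 (scaled01 g01 r0)) (prod_absent_le1 (scaled01 g01 r0)).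
Qed.

Lemma rate_ge0 x u : 0 <= rate x u.
Proof. by have /andP[p0 _] := prod01 x u; rewrite mulr_ge0 ?expR_ge0. Qed.

Lemma rate_ge x u : expR (- L) * (1 - \sum_(v <- u) link x v) <= rate x u.
Proof.
apply: (@le_trans _ _ (expR (- L) * \prod_(v <- u) absent h x v)).
  apply: ler_wpM2l; first exact: expR_ge0.
  by apply: prod_onem_ge => v; exact: link01.
rewrite /rate mulrC; have /andP[p0 _] := prod01 x u; apply: ler_wpM2l => //.
rewrite ler_expR lerN2 -rhoL -mulrA; apply: ler_wpM2l => //.
apply: (le_trans (thinned_le g01 g_noninc r0 x u)).
exact: (integral_link_le g01 g_noninc C_def r0).
Qed.

Let rate_le x u t : t <= rho * thinned g r x u -> rho * rate x u <= expR (L - b - t).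
Proof.
move=> tx; rewrite expRD -rhoE; apply: ler_wpM2l => //.
have /andP[p0 p1] := prod01 x u.
apply: (@le_trans _ _ (1 * expR (- (rho * thinned g r x u)))).
  by apply: ler_wpM2r => //; exact: expR_ge0.
by rewrite mul1r ler_expR lerN2.
Qed.

(** Two of the three tail masses come from the two coordinates in [mass_quadrant_far], the third
    from the truncation in [integral_link_ge]. *)
Definition defect := rho * r ^+ 2 * (3 * mass g (far D)).

Lemma rate_far s K x u : 0 <= s -> (size u <= K)%N -> interior x ->
  (forall v, v \in u -> far (s * r) (x - v)) ->
  rho * rate x u <= expR (- b + defect + 2 * K%:R * L * g (s / 2)).
Proof.
move=> s0 uK /andP[x1 x2] f.
have -> : - b + defect + 2 * K%:R * L * g (s / 2) =
  L - b - (L - defect - 2 * K%:R * L * g (s / 2)) by ring.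
apply: rate_le.
have /andP[g0 _] := g01 (divr_ge0 s0 (ler0n R 2)).
have Kg : 2 * (size u)%:R * L * g (s / 2) <= 2 * K%:R * L * g (s / 2).
  apply: ler_wpM2r => //; apply: ler_wpM2r; first exact: ltW.
  by apply: ler_wpM2l => //; rewrite ler_nat.
have t1 := ler_wpM2l rho0 (thinned_ge_far g01 g_noninc C_def r0 s0 f).
have t2 := ler_wpM2l rho0 (integral_link_ge g01 g_noninc C_def r0 x1 x2 rD).
have t3 := ler_wpM2l (mulr_ge0 rho0 (sqr_ge0 r)) (mass_quadrant_far g01 g_noninc C_def D D).
have e1 : rho * (\int[U]_y link x y - (size u)%:R * (2 * r ^+ 2 * C * g (s / 2))) =
    rho * \int[U]_y link x y - 2 * (size u)%:R * L * g (s / 2).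
  by rewrite -rhoL; ring.
have e2 : L - defect = rho * r ^+ 2 * (C - mass g (far D) - mass g (far D)) -
    rho * r ^+ 2 * mass g (far D) by rewrite -{1}rhoL /defect; ring.
rewrite e1 in t1; rewrite mulrA mulrBr in t2; lra.
Qed.

Context (K : nat) (A : R).
Hypothesis A0 : 0 <= A.
Hypothesis KA : 2 * K%:R * g (A / 2) <= 4^-1.
Context (t1 t2 w alpha beta : R).
Hypothesis t12 : 0 < t1 < t2.
Hypothesis w0 : 0 < w.
Hypothesis al0 : 0 < alpha.
Hypothesis be01 : 0 < beta <= 1.
Hypothesis clear : forall z : plane R, - t2 <= z.1 < - t1 -> - w <= z.2 < w ->
  alpha <= g (eucl_norm z) /\
  forall v, 0 <= v.1 -> g (eucl_norm v) < 1 -> beta <= 1 - g (eucl_norm (z - v)).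
Hypothesis t2D : t2 <= D.
Hypothesis wD : w <= D.

(** Three regimes for [rho * rate x u]. If all of [u] is beyond [L * r] from [x], the overlap is of
    order [L * g (L / 2)]. If some point is nearer but none within [A * r], [KA] bounds the overlap
    by [L / 4], whence [middle_rate]. Otherwise only the clearing is left, which still removes a
    fixed fraction of [L] from the exponent in [close_rate]. *)
Definition main_rate := expR (- b + defect + 2 * K%:R * L * g (L / 2)).
Definition middle_rate := expR (- b + defect + L / 4).
Definition close_rate :=
  expR (L - b - rho * r ^+ 2 * (2 * w * (t2 - t1) * (alpha * beta ^+ K))).

Definition excess x v : R :=
  middle_rate * (~~ `[< far (L * r) (x - v) >])%:R +
  close_rate * (~~ `[< far (A * r) (x - v) >])%:R.

Lemma excess_ge0 x v : 0 <= excess x v.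
Proof. by rewrite addr_ge0// mulr_ge0// expR_ge0. Qed.

Let excess_sum x v u : v \in u -> excess x v <= \sum_(v <- u) excess x v.
Proof.
move=> vu; rewrite (perm_big _ (perm_to_rem vu)) big_cons lerDl.
by apply: sumr_ge0 => i _; exact: excess_ge0.
Qed.

(* The clearing on the left of [x] is useful because no point of [u] lies there. *)
Lemma rate_leftmost x u : (size u <= K)%N -> interior x ->
  (forall v, v \in u -> x.1 <= v.1) ->
  rho * rate x u <= main_rate + \sum_(v <- u) excess x v.
Proof.
move=> uK Ix xu.
have S0 : 0 <= \sum_(v <- u) excess x v by apply: sumr_ge0 => v _; exact: excess_ge0.
have M0 : 0 <= main_rate by exact: expR_ge0.
(* If [x] is surely linked to a point of [u], its rate is 0. Otherwise every link probability from
   [x] to [u] is below 1, as [clear] demands. *)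
have [[v vu /eqP av]|ab] := @hasP _ (fun v => absent h x v == 0) u.
  have -> : rate x u = 0 by rewrite /rate (perm_big _ (perm_to_rem vu)) big_cons/= av !mul0r.
  by rewrite mulr0; exact: addr_ge0.
have [[v vu vA]|nA] := pselect (exists2 v, v \in u & ~ far (A * r) (x - v)).
  apply: (@le_trans _ _ close_rate); last first.
    apply: (le_trans _ (le_trans (excess_sum x vu) _)); last by rewrite lerDr.
    rewrite /excess (asboolF vA) mulr1 lerDr; apply: mulr_ge0 => //; exact: expR_ge0.
  have /andP[be0 be1] := be01; have /andP[t10 t12'] := t12.
  rewrite /close_rate; apply: rate_le; rewrite -mulrA; apply: ler_wpM2l => //.
  have /andP[x1 x2] := Ix.
  apply: (le_trans _ (thinned_ge_near g01 g_noninc r0 t12 w0 al0 be0 clear t2D wD rD x1 x2 _)).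
    apply: ler_wpM2l; first exact: sqr_ge0.
    apply: ler_wpM2l; first by apply: mulr_ge0; [apply: mulr_ge0 => //; exact: ltW|lra].
    apply: ler_wpM2l; first exact: ltW.
    by apply: ler_wiXn2l => //; exact: ltW.
  move=> v' v'u; split; first exact: xu.
  by apply/negP => e; case: ab; exists v'.
have [[v vu vL]|nL] := pselect (exists2 v, v \in u & ~ far (L * r) (x - v)).
  apply: (@le_trans _ _ middle_rate); last first.
    apply: (le_trans _ (le_trans (excess_sum x vu) _)); last by rewrite lerDr.
    rewrite /excess (asboolF vL) mulr1 lerDl; apply: mulr_ge0 => //; exact: expR_ge0.
  apply: (le_trans (rate_far A0 uK Ix _)).
    by move=> v' v'u; apply: contrapT => nf; apply: nA; exists v'.
  rewrite ler_expR lerD2l; have := ler_wpM2l (ltW L0) KA; lra.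
apply: (@le_trans _ _ main_rate); last by rewrite lerDl.
apply: (rate_far (ltW L0) uK Ix) => v' v'u.
by apply: contrapT => nf; apply: nL; exists v'.
Qed.

End interior.

Lemma leftmost_perm (R : realType) (X : eqType) (key : X -> R) x0 s :
  exists x v, perm_eq (x0 :: s) (x :: v) /\ forall w, w \in v -> key x <= key w.
Proof.
elim: s x0 => [|y s IH] x0; first by exists x0, [::].
have [x [v [p xv]]] := IH y; have [x0x|/ltW xx0] := leP (key x0) (key x).
  exists x0, (y :: s); split=> // w; rewrite (perm_mem p) inE => /predU1P[-> //|/xv].
  exact: le_trans.
exists x, (x0 :: v); split; last by move=> w; rewrite inE => /predU1P[-> //|/xv].
rewrite -cat1s perm_sym -cat1s -[x0 :: v]cat1s perm_catCA cat1s.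
by rewrite perm_sym perm_cons.
Qed.

(** * Recursion on the number of points, for an abstract density *)

Section recursion.
Context d (X : measurableType d) (R : realType) (U : probability X R).
Implicit Types (x : X) (u v s : seq X).
Context (rho : R) (iso : seq X -> R).
Hypothesis rho0 : 0 <= rho.
Hypothesis iso0 : forall u, 0 <= iso u.
Hypothesis iso_nil : iso [::] = 1.
Hypothesis iso_perm : forall u v, perm_eq u v -> iso u = iso v.
Hypothesis iso_meas : smeas iso.
Context (K : nat).

Let miso n : smeas (fun s => (rho ^+ n * iso s)%:E).
Proof.
move=> dz Z fs; apply/measurable_EFinP; apply: measurable_funM => //; exact: iso_meas.
Qed.

Let iso0E n s : (0 <= (rho ^+ n * iso s)%:E)%E.
Proof. by rewrite lee_fin mulr_ge0// exprn_ge0. Qed.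

Definition moment k : \bar R := iint U k (fun s => (rho ^+ k * iso s)%:E).

Let smeas2_cons (F : seq X -> \bar R) : smeas F ->
  smeas2 (fun u v => if u is x :: _ then F (x :: v) else 0%E).
Proof. by move=> mF dz Z [|f fs] gs //=; exact: (mF _ _ (f :: gs)). Qed.

Let smeas_int (F : seq X -> \bar R) : smeas F -> (forall s, 0 <= F s)%E ->
  smeas (fun s => \int[U]_x F (x :: s))%E.
Proof.
move=> mF F0; apply: (@smeas_iint2 _ _ _ U 1 (fun s v => F (v ++ s))) => // dz Z fs gs.
by have := mF _ Z (gs ++ fs); apply: eq_measurable_fun => z _; rewrite map_cat.
Qed.

Let measurable_head (F : seq X -> \bar R) s : smeas F ->
  measurable_fun setT (fun x => F (x :: s)).
Proof.
move=> mF.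
have := mF _ X (mk_mfun (@measurable_id _ X setT) :: [seq mk_mfun (measurable_cst x) | x <- s]).
by apply: eq_measurable_fun => x _ /=; rewrite -map_comp map_id_in.
Qed.

(** [iint_swap] makes the new point the innermost variable; integrating it with the others fixed
    gains a factor [m]. *)
Lemma moment_lower m : 0 <= m ->
  (forall u, (size u < K)%N -> (m * iso u)%:E <= \int[U]_x (rho * iso (x :: u))%:E)%E ->
  forall k, (k <= K)%N -> ((m ^+ k)%:E <= moment k)%E.
Proof.
move=> m0 H; elim=> [|k IH] kK; first by rewrite /moment/= iso_nil expr0 mulr1.
have m0E : (0 <= m%:E)%E by rewrite lee_fin.
have rk : (0 <= (rho ^+ k)%:E)%E by rewrite lee_fin exprn_ge0.
apply: (@le_trans _ _ (m%:E * moment k)%E).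
  by rewrite exprS EFinM; apply: lee_wpmul2l => //; exact/IH/ltnW.
pose F x s := (rho ^+ k.+1 * iso (x :: s))%:E.
rewrite /moment -iintZl//=.
rewrite -[leRHS]/(\int[U]_x iint U k (F x))%E iint_swap; last 2 first.
- exact: (smeas2_cons (@miso k.+1)).
- by move=> x s; exact: iso0E.
apply: le_iint.
- by move=> dz Z fs; apply: emeasurable_funM => //; exact: (@miso k _ Z fs).
- exact: (smeas_int (@miso k.+1) (iso0E k.+1)).
- by move=> s; apply: mule_ge0.
- move=> s sk; have sK : (size s < K)%N by rewrite sk.
  have := lee_wpmul2l rk (H s sK); rewrite -ge0_integralZl//; last 2 first.
  - by have := measurable_head s (@miso 1); apply: eq_measurable_fun => x _; rewrite expr1.
  - by move=> x _; have := iso0E 1 (x :: s); rewrite expr1.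
  move=> h; apply: (le_trans (le_trans _ h)); first by rewrite -!EFinM lee_fin; lra.
  have -> : (\int[U]_x F x s = \int[U]_x ((rho ^+ k)%:E * (rho * iso (x :: s))%:E))%E.
    by apply: eq_integral => x _; rewrite /F -EFinM exprSr mulrA.
  exact: lexx.
- by move=> s; apply: integral_ge0 => x _; exact: iso0E.
Qed.

Context (key : X -> R) (main : R) (bad : X -> X -> R) (beta : R).
Hypothesis main0 : 0 <= main.
Hypothesis bad0 : forall x y, 0 <= bad x y.
Hypothesis bad_meas : measurable_fun setT (fun z : X * X => bad z.1 z.2).
Hypothesis bad_int : forall y, (\int[U]_x (bad x y)%:E <= beta%:E)%E.
Hypothesis upper : forall x u, (size u < K)%N -> (forall y, y \in u -> key x <= key y) ->
  rho * iso (x :: u) <= (main + \sum_(v <- u) bad x v) * iso u.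

Hypothesis beta0 : 0 <= beta.

(* Which point of [s] is the leftmost is unknown, and summing over all of them
   would cost a factor [k] on [rho ^+ k * iso s] itself; on the excess over
   [main ^+ k] the loss is harmless, as it vanishes in the limit. *)
Let over k s := Num.max (rho ^+ k * iso s - main ^+ k) 0.

Let over0 k s : 0 <= over k s. Proof. by rewrite le_max lexx orbT. Qed.

Let mover k : smeas (over k).
Proof.
move=> dz Z fs; apply: measurable_maxr => //; apply: measurable_funB => //.
by apply: measurable_funM => //; exact: iso_meas.
Qed.

(** The singleton on the left is the candidate for the leftmost point, so that the sum over
    splittings runs over all candidates. Splittings of other shapes get 0, which leaves only the
    term with coefficient ['C(k.+1, 1)] in [iint_star]. *)
Let H k u v : \bar R :=
  if u is [:: x] then
    (main * over k v + (\sum_(w <- v) bad x w) * (rho ^+ k * iso v))%:E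
  else 0%E.

Let H0 k u v : (0 <= H k u v)%E.
Proof.
case: u => [|x [|? ?]] //=; rewrite lee_fin addr_ge0 ?mulr_ge0 ?exprn_ge0//.
by apply: sumr_ge0 => w _.
Qed.

Let mbad dz (Z : measurableType dz) (f : {mfun Z >-> X}) (gs : seq {mfun Z >-> X}) :
  measurable_fun setT
    (fun z => \sum_(w <- [seq h z | h : {mfun Z >-> X} <- gs]) bad (f z) w).
Proof.
elim: gs => [|h gs IH] /=; first by under eq_fun do rewrite big_nil; exact: measurable_cst.
under eq_fun do rewrite big_cons; apply: measurable_funD => //.
have mp : measurable_fun setT (fun z => (f z, h z)).
  by apply: measurable_fun_pair; exact: measurable_funPT.
exact: (measurableT_comp bad_meas mp).
Qed.

Let mH k : smeas2 (H k).
Proof.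
move=> dz Z [|f [|? ?]] gs //=; apply/measurable_EFinP; apply: measurable_funD.
  by apply: measurable_funM => //; exact: mover.
apply: measurable_funM; first exact: mbad.
by apply: measurable_funM => //; exact: iso_meas.
Qed.

Let perm_H k u u' v v' : perm_eq u u' -> perm_eq v v' -> H k u v = H k u' v'.
Proof.
move=> uu' vv'; have hx x : H k [:: x] v = H k [:: x] v'.
  by rewrite /H /over (iso_perm vv') (perm_big _ vv').
have := perm_size uu'; case: u uu' => [|x [|y u]] uu'; case: u' uu' => [|x' [|y' u']] // uu' _.
by have /perm_small_eq -> : perm_eq [:: x] [:: x'] by [].
Qed.

Let star_ge (G : seq X -> seq X -> \bar R) v : (forall u v, 0 <= G u v)%E ->
  (G [::] v <= star adde G v)%E.
Proof.
elim: v G => [|y v IH] G G0 //=.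
apply: (le_trans (IH (fun u v => G u (y :: v)) _)) => //.
by rewrite leeDr// star_ge0.
Qed.

(** All terms of the sum over splittings are nonnegative, so the one that singles out the leftmost
    point suffices. For it, [upper] gives the bound after [main ^+ k.+1] is written as
    [main * main ^+ k]. *)
Let over_star k s : (k < K)%N -> size s = k.+1 -> ((over k.+1 s)%:E <= star adde (H k) s)%E.
Proof.
case: s => // x0 s kK [sk].
have [x [v [p xv]]] := leftmost_perm key x0 s.
have vk : size v = k by have := perm_size p; rewrite /= sk => -[].
rewrite (star_perm (V := \bar R) (@perm_H k) p).
have -> : over k.+1 (x0 :: s) = over k.+1 (x :: v) by rewrite /over (iso_perm p).
apply: (@le_trans _ _ (H k [:: x] v)); last first.
  have G0 u y : (0 <= H k (x :: u) y)%E by [].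
  apply: (le_trans (star_ge v G0)) => /=; apply: leeDl; exact: star_ge0.
have vK : (size v < K)%N by rewrite vk.
have S0 : 0 <= \sum_(w <- v) bad x w by apply: sumr_ge0.
have rk : 0 <= rho ^+ k by exact: exprn_ge0.
rewrite lee_fin ge_max; apply/andP; split; last first.
  by rewrite addr_ge0// mulr_ge0// mulr_ge0.
have h1 := ler_wpM2l rk (upper vK xv).
have h2 : rho ^+ k * iso v - main ^+ k <= over k v by rewrite le_max lexx.
have h3 := ler_wpM2l main0 h2.
rewrite (exprS main) (exprSr rho); lra.
Qed.

(** The factor [k'.+1] counts the candidates for the leftmost point, [k'%:R * beta] bounds the
    integral of [bad] against the other points, and the last sum bounds the moment of order [k'].
    With [main] bounded, the whole tends to 0 with [beta]. *)
Fixpoint over_bound k : R :=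
  if k is k'.+1 then
    k'.+1%:R * (main * over_bound k' + k'%:R * beta * (main ^+ k' + over_bound k'))
  else 0.

Let moment_over k : (moment k <= (main ^+ k)%:E + iint U k (fun s => (over k s)%:E))%E.
Proof.
have mk : (0 <= (main ^+ k)%:E)%E by rewrite lee_fin exprn_ge0.
have mo : smeas (fun s => (over k s)%:E).
  by move=> dz Z fs; apply/measurable_EFinP; exact: mover.
have mc : smeas (cst (main ^+ k)%:E : seq X -> \bar R) by move=> dz Z fs; exact: measurable_cst.
have o0 s : (0 <= (over k s)%:E)%E by rewrite lee_fin.
rewrite -{1}(iint_cst U k mk) -iintD//.
apply: le_iint => //.
- by move=> dz Z fs; apply: emeasurable_funD; [exact: mc|exact: mo].
- move=> s _; rewrite -EFinD lee_fin -lerBlDl le_max lexx//.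
- by move=> s; rewrite adde_ge0.
Qed.

Let mbad_cst s : measurable_fun setT (fun x => \sum_(w <- s) bad x w).
Proof.
have := mbad (mk_mfun (@measurable_id _ X setT)) [seq mk_mfun (measurable_cst w) | w <- s].
by apply: eq_measurable_fun => x _ /=; rewrite -map_comp map_id_in.
Qed.

Let sum_bad0 s x : 0 <= \sum_(w <- s) bad x w.
Proof. exact: sumr_ge0. Qed.

Let int_bad s : (\int[U]_x (\sum_(w <- s) bad x w)%:E <= ((size s)%:R * beta)%:E)%E.
Proof.
elim: s => [|w s IH].
  by under eq_integral do rewrite big_nil; rewrite integral0 lee_fin mul0r.
under eq_integral do rewrite big_cons EFinD.
rewrite ge0_integralD//.
- rewrite -natr1 mulrDl mul1r addrC EFinD; apply: leeD => //.
- by move=> x _; rewrite lee_fin.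
- have mp : measurable_fun setT (fun x : X => (x, w)) by exact: measurable_fun_pair.
  by apply/measurable_EFinP; exact: (measurableT_comp bad_meas mp).
- by move=> x _; rewrite lee_fin.
- by apply/measurable_EFinP.
Qed.

Let iint_H k : (\int[U]_x iint U k (H k [:: x]) <=
  main%:E * iint U k (fun s => (over k s)%:E) + (k%:R * beta)%:E * moment k)%E.
Proof.
have mo : smeas (fun s => (over k s)%:E).
  by move=> dz Z fs; apply/measurable_EFinP; exact: mover.
have o0 s : (0 <= (over k s)%:E)%E by rewrite lee_fin.
have m0 : (0 <= main%:E)%E by rewrite lee_fin.
have mH1 : smeas (fun s => if s is x :: v then H k [:: x] v else 0%E).
  by move=> dz Z [|f fs] //=; exact: (@mH k _ Z [:: f] fs).
have mH2 : smeas2 (fun u v => if u is x :: _ then H k [:: x] v else 0%E).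
  by move=> dz Z [|f fs] gs //=; exact: (@mH k _ Z [:: f] gs).
rewrite iint_swap//.
have kb : 0 <= k%:R * beta by exact: mulr_ge0.
have kbE : (0 <= (k%:R * beta)%:E)%E by rewrite lee_fin.
rewrite /moment -!iintZl//; rewrite -iintD; last 4 first.
- by move=> dz Z fs; apply: emeasurable_funM => //; exact: mo.
- by move=> dz Z fs; apply: emeasurable_funM => //; exact: (@miso k _ Z fs).
- by move=> s; exact: mule_ge0.
- by move=> s; exact: mule_ge0.
apply: le_iint.
- apply: (smeas_int mH1) => -[|x v] //=; exact: (H0 k [:: x] v).
- move=> dz Z fs; apply: emeasurable_funD.
    by apply: emeasurable_funM => //; exact: mo.
  by apply: emeasurable_funM => //; exact: (@miso k _ Z fs).
- by move=> s; apply: integral_ge0 => x _; exact: (H0 k [:: x] s).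
- move=> s sk; rewrite /H.
  pose c := (rho ^+ k * iso s)%:E.
  have -> : (\int[U]_x (main * over k s + (\sum_(w <- s) bad x w) * (rho ^+ k * iso s))%:E =
      (main * over k s)%:E + (\int[U]_x (\sum_(w <- s) bad x w)%:E) * c)%E.
    under eq_integral do rewrite EFinD.
    rewrite ge0_integralD//.
    + congr (_ + _)%E.
        rewrite integral_cst// -[RHS]mule1; congr *%E; exact: probability_setT.
      under eq_integral do rewrite EFinM.
      rewrite ge0_integralZr//.
      * by apply/measurable_EFinP.
      * by move=> x _; rewrite lee_fin.
    + by move=> x _; rewrite lee_fin mulr_ge0.
    + by move=> x _; rewrite lee_fin mulr_ge0// mulr_ge0// exprn_ge0.
    + by apply/measurable_EFinP; exact: measurable_funM.
  rewrite EFinM leeD2l//; apply: lee_wpmul2r; first exact: iso0E.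
  by rewrite -sk; exact: int_bad.
- by move=> s; rewrite adde_ge0//; exact: mule_ge0.
Qed.

Let iint_over k : (k <= K)%N -> (iint U k (fun s => (over k s)%:E) <= (over_bound k)%:E)%E.
Proof.
elim: k => [|k IH] kK.
  by rewrite /= /over iso_nil !expr0 mulr1 subrr maxxx.
apply: (@le_trans _ _ (iint U k.+1 (star adde (H k)))).
  apply: le_iint.
  - by move=> dz Z fs; apply/measurable_EFinP; exact: mover.
  - exact: smeas_star.
  - by move=> s; rewrite lee_fin.
  - by move=> s; exact: over_star.
  - by move=> s; exact: star_ge0.
rewrite iint_star//.
have Z a : a != 1%N -> iint U a (fun u => iint U (k.+1 - a) (H k u)) = 0%E.
  move=> a1; rewrite (@eq_iint _ _ _ U a _ (cst 0%E)) ?iint_cst// => s sa.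
  by case: s sa a1 => [|x [|y s]] <- // _; exact: iint_cst.
rewrite big_ltn// Z// mule0 add0e big_ltn// big_nat big1 ?adde0; last first.
  by move=> a /andP[a1 _]; rewrite Z ?mule0// gtn_eqF.
rewrite subSS subn0 bin1 [over_bound _]/=.
rewrite EFinM; apply: lee_wpmul2l; first by rewrite lee_fin.
apply: (le_trans (iint_H k)).
rewrite EFinD !EFinM; apply: leeD.
  by apply: lee_wpmul2l; [rewrite lee_fin|exact/IH/ltnW].
apply: lee_wpmul2l; first by rewrite -EFinM lee_fin mulr_ge0.
rewrite EFinD; apply: (le_trans (moment_over k)); rewrite leeD2l//; exact/IH/ltnW.
Qed.

Lemma moment_upper k : (k <= K)%N -> (moment k <= (main ^+ k + over_bound k)%:E)%E.
Proof.
move=> kK; rewrite EFinD; apply: (le_trans (moment_over k)).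
by rewrite leeD2l//; exact: iint_over.
Qed.

End recursion.

Section interior_moments.
Context (R : realType) (g : R -> R) (C : R).
Hypothesis g01 : forall x : R, 0 <= x -> 0 <= g x <= 1.
Hypothesis g_noninc : forall x y : R, 0 <= x -> x <= y -> g y <= g x.
Local Notation mu2 := (@lebesgue_measure R \x @lebesgue_measure R)%E.
Hypothesis C_def : (\int[mu2]_x (g (eucl_norm x))%:E = C%:E)%E.
Context (b L r D rho : R).
Hypothesis r0 : 0 < r.
Hypothesis L0 : 0 < L.
Hypothesis rhoE : rho = expR (L - b).
Hypothesis rhoL : rho * r ^+ 2 * C = L.
Hypothesis D0 : 0 < D.
Hypothesis rD : r * D < 2^-1.
Local Notation U := (@square_unif R).
Implicit Types (x y v : plane R) (u : seq (plane R)).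
Local Notation link x y := (g (eucl_norm (x - y) / r)).
Local Notation h := (fun x : R => g (x / r)).
Local Notation iso := (isolation g r D rho).

Let rho0 : 0 <= rho. Proof. by rewrite rhoE expR_ge0. Qed.

Let rD0 : 0 < r * D. Proof. exact: mulr_gt0. Qed.

Lemma interior_area : 1 - 4 * (r * D) <= \int[U]_x \1_(interior r D) x.
Proof.
have mI := @measurable_interior R r D.
have rDp : 0 < r * D by exact: rD0.
pose B : set (plane R) := `[- 2^-1 + r * D, 2^-1 - r * D[%classic `*`
  `[- 2^-1 + r * D, 2^-1 - r * D[%classic.
have mB : measurable B by apply: measurableX; exact: measurable_itv.
have BI : B `<=` interior r D `&` @unit_square R.
  move=> x [/=]; rewrite !in_itv/= => /andP[x1 x1'] /andP[x2 x2'].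
  split.
    apply/andP; split; apply/orP.
      by have [x0|x0] := leP x.1 0; [left|right]; apply/andP; split => //; lra.
    by have [x0|x0] := leP x.2 0; [left|right]; apply/andP; split => //; lra.
  by split; rewrite /= in_itv/=; apply/andP; split; lra.
have mS := @measurable_unit_square R.
have UI : U (interior r D) \is a fin_num.
  by rewrite ge0_fin_numE// (le_lt_trans (probability_le1 U mI))// ltry.
rewrite -lee_fin [leRHS](_ : _ = U (interior r D)); last first.
  rewrite -[RHS]fineK// /Rintegral; congr (fine _)%:E.
  by apply: (eq_trans (integral_indic _ _ _)) => //; rewrite setIT.
rewrite square_unifE; apply: (@le_trans _ _ (mu2 B)); last first.
  by apply: le_measure => //; rewrite inE//; exact: measurableI.
have hh : - 2^-1 + r * D <= 2^-1 - r * D by have := rD; lra.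
rewrite area_box//.
by rewrite lee_fin; have := sqr_ge0 (r * D); rewrite expr2; lra.
Qed.

Let rate_le1 x u : rate g r rho x u <= 1.
Proof.
have /andP[p0 p1] : 0 <= \prod_(v <- u) absent h x v <= 1.
  rewrite (eq_bigr (fun v => absent h v x)); last by move=> v _; rewrite absentC.
  by rewrite (prod_absent_ge0 (scaled01 g01 r0)) (prod_absent_le1 (scaled01 g01 r0)).
rewrite /rate -[leRHS]mulr1; apply: ler_pM; rewrite ?expR_ge0//.
rewrite -expR0 ler_expR oppr_le0 mulr_ge0// /thinned.
apply: Rintegral_ge0 => y _; have /andP[l0 _] := link01 g01 r0 x y.
by rewrite mulr_ge0// (prod_absent_ge0 (scaled01 g01 r0)).
Qed.

Lemma isolation_le1 u : iso u <= 1.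
Proof.
elim: u => [|x u IH]; first by rewrite isolation_nil.
rewrite isolation_cons// -[leRHS]mulr1; apply: ler_pM => //.
- by rewrite mulr_ge0 ?rate_ge0.
- exact: isolation_ge0.
rewrite -[leRHS]mulr1; apply: ler_pM => //; first exact: rate_ge0.
by case: (_ \in _).
Qed.

Lemma moment_fin_num k : moment U rho iso k \is a fin_num.
Proof.
rewrite ge0_fin_numE; last by apply: iint_ge0 => u; rewrite lee_fin mulr_ge0 ?exprn_ge0 ?isolation_ge0.
apply: (@le_lt_trans _ _ (rho ^+ k)%:E); last exact: ltry.
have rk : (0 <= (rho ^+ k)%:E)%E by rewrite lee_fin exprn_ge0.
rewrite -(iint_cst U k rk); apply: le_iint.
- move=> dz Z fs; apply/measurable_EFinP; apply: measurable_funM => //.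
  exact: (smeas_isolation g01 g_noninc D rho r0).
- by move=> dz Z fs; exact: measurable_cst.
- by move=> u; rewrite lee_fin mulr_ge0 ?exprn_ge0 ?isolation_ge0.
- move=> u _; rewrite lee_fin -[leRHS]mulr1; apply: ler_wpM2l; first exact: exprn_ge0.
  exact: isolation_le1.
- by [].
Qed.

Let bmeas_iso u : bmeas (fun x => rho * iso (x :: u)).
Proof.
apply: (bmeasM (bmeas_cst _ rho)); split.
  have := smeas_isolation g01 g_noninc D rho r0
    (mk_mfun (@measurable_id _ (plane R) setT) :: [seq mk_mfun (measurable_cst x) | x <- u]).
  by apply: eq_measurable_fun => x _ /=; rewrite -map_comp map_id_in.
exists (iso u) => x; rewrite ger0_norm; last exact: isolation_ge0.
rewrite isolation_cons//; rewrite ler_piMl//; first exact: isolation_ge0.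
rewrite -[leRHS]mulr1; apply: ler_pM => //; first exact: rate_ge0.
by case: (_ \in _).
Qed.

Let bmeas_I : bmeas (\1_(interior r D) : plane R -> R).
Proof.
have mI := @measurable_interior R r D.
by apply: bmeas01 => [|y]; [exact: measurable_indic|rewrite indicE; case: (_ \in _); rewrite ?lexx ?ler01].
Qed.

(** Integrating [rate_ge] over [x], the factor [expR (- b)] is reduced by the area of the border and
    by the total link probability to the points of [u]. *)
Let interior_lower u :
  ((expR (- b) * (1 - 4 * (r * D) - (size u)%:R * (r ^+ 2 * C)) * iso u)%:E <=
   \int[U]_x (rho * iso (x :: u))%:E)%E.
Proof.
have i0 : 0 <= iso u by exact: isolation_ge0.
have bl v : bmeas (fun x => link x v).
  by have := bmeas_link g01 g_noninc r0 v; congr bmeas; apply/funext => x; exact: linkC.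
have bs : bmeas (fun x => \sum_(v <- u) link x v) by apply: bmeas_sum.
have bb : bmeas (fun x => \1_(interior r D) x - \sum_(v <- u) link x v) by exact: bmeasB.
rewrite bintE// lee_fin.
apply: (@le_trans _ _ (\int[U]_x (expR (- b) * iso u * (\1_(interior r D) x - \sum_(v <- u) link x v)))).
  rewrite bintZ// bintB// mulrAC.
  apply: ler_wpM2l; first by rewrite mulr_ge0// expR_ge0.
  apply: lerD; first exact: interior_area.
  rewrite lerN2 bint_sum//.
  apply: (@le_trans _ _ (\sum_(v <- u) (r ^+ 2 * C))).
    apply: ler_sum => v _; apply: le_trans (integral_link_le g01 g_noninc C_def r0 v).
    by under eq_Rintegral do rewrite linkC.
  by rewrite big_const_seq count_predT iter_addr addr0 -[leLHS]mulr_natl.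
apply: le_bint => [||x]; first by apply: bmeasM => //; exact: bmeas_cst.
  exact: bmeas_iso.
have rx := rate_ge g01 g_noninc C_def r0 rhoE rhoL x u.
have eb : rho * expR (- L) = expR (- b) by rewrite rhoE -expRD; congr expR; ring.
have s0 : 0 <= \sum_(v <- u) link x v.
  by apply: sumr_ge0 => v _; have /andP[] := link01 g01 r0 x v.
rewrite isolation_cons// indicE; case: (x \in _); last first.
  rewrite !mul0r mulr0 sub0r mulrN oppr_le0 mulr_ge0// mulr_ge0// expR_ge0.
rewrite mul1r -eb mulr1n; have := ler_wpM2l (mulr_ge0 rho0 i0) rx; lra.
Qed.

Let far_set s : set (plane R * plane R) := [set z | far s (z.1 - z.2)].

Let measurable_far_set s : measurable (far_set s).
Proof.
have md : measurable_fun setT (fun z : plane R * plane R => z.1 - z.2 : plane R).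
  apply: measurable_fun_pair; apply: measurable_funB.
  - exact: (measurableT_comp measurable_fst measurable_fst).
  - exact: (measurableT_comp measurable_fst measurable_snd).
  - exact: (measurableT_comp measurable_snd measurable_fst).
  - exact: (measurableT_comp measurable_snd measurable_snd).
rewrite -[far_set s]setTI; apply: (md measurableT (far s)); exact: measurable_far.
Qed.

Let near_ind s x v : (~~ `[< far s (x - v) >])%:R = \1_(~` far_set s) (x, v) :> R.
Proof.
rewrite indicE; congr (nat_of_bool _)%:R; apply/idP/idP.
  by move=> /asboolP nf; apply/mem_set.
by move=> /set_mem nf; apply/asboolP.
Qed.

Let measurable_near s : measurable_fun setT
  (fun z : plane R * plane R => (~~ `[< far s (z.1 - z.2) >])%:R : R).
Proof.
have mC : measurable (~` far_set s) by apply: measurableC; exact: measurable_far_set.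
have := @measurable_indic _ _ R setT _ mC; apply: eq_measurable_fun => z _.
by rewrite near_ind -surjective_pairing.
Qed.

Let near_int s v : 0 <= s ->
  (\int[U]_x ((~~ `[< far s (x - v) >])%:R : R)%:E <= (4 * s ^+ 2)%:E)%E.
Proof.
move=> s0; pose B : set (plane R) := `[v.1 - s, v.1 + s[%classic `*` `[v.2 - s, v.2 + s[%classic.
have mB : measurable B by apply: measurableX; exact: measurable_itv.
apply: (@le_trans _ _ (\int[U]_x ((\1_B x : R)%:E))%E).
  apply: ge0_le_integral => //.
  - apply/measurable_EFinP.
    have mp : measurable_fun setT (fun x : plane R => (x, v)) by exact: measurable_fun_pair.
    exact: (measurableT_comp (measurable_near s) mp).
  - by apply/measurable_EFinP; exact: measurable_indic.
  - move=> x _; rewrite lee_fin indicE; case: asboolP => //= nf.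
    rewrite mem_set//; move/not_orP : nf => -[/negP + /negP].
    rewrite -!ltNge !ltr_norml => /andP[a1 a2] /andP[a3 a4].
    by split; rewrite /= in_itv/=; apply/andP; split; rewrite /= in a1 a2 a3 a4; lra.
apply: (@le_trans _ _ (U B)).
  by rewrite le_eqVlt; apply/orP; left; apply/eqP; apply: (eq_trans (integral_indic _ _ _)) => //; rewrite setIT.
rewrite square_unifE; apply: (@le_trans _ _ (mu2 B)).
  apply: le_measure => //; rewrite inE//; apply: measurableI => //; exact: measurable_unit_square.
by rewrite area_box ?lee_fin; lra.
Qed.

Context (K : nat) (A : R).
Hypothesis A0 : 0 <= A.
Hypothesis KA : 2 * K%:R * g (A / 2) <= 4^-1.
Context (t1 t2 w alpha beta : R).
Hypothesis t12 : 0 < t1 < t2.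
Hypothesis w0 : 0 < w.
Hypothesis al0 : 0 < alpha.
Hypothesis be01 : 0 < beta <= 1.
Hypothesis clear : forall z : plane R, - t2 <= z.1 < - t1 -> - w <= z.2 < w ->
  alpha <= g (eucl_norm z) /\
  forall v, 0 <= v.1 -> g (eucl_norm v) < 1 -> beta <= 1 - g (eucl_norm (z - v)).
Hypothesis t2D : t2 <= D.
Hypothesis wD : w <= D.

Local Notation main := (main_rate g b L r D rho K).
Local Notation middle := (middle_rate g b L r D rho).
Local Notation close := (close_rate b L r rho K t1 t2 w alpha beta).

Definition excess_mass := middle * (4 * (L * r) ^+ 2) + close * (4 * (A * r) ^+ 2).

Lemma interior_moment_le k : (k <= K)%N ->
  (moment U rho iso k <= (main ^+ k + over_bound main excess_mass k)%:E)%E.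
Proof.
have mi0 : 0 <= middle by exact: expR_ge0.
have cl0 : 0 <= close by exact: expR_ge0.
apply: (@moment_upper _ _ _ U rho iso rho0 (isolation_ge0 g01 D rho r0)
  (isolation_nil g r D rho) (@perm_isolation _ g r D rho)
  (smeas_isolation g01 g_noninc D rho r0) K fst main
  (excess g b L r D rho K A t1 t2 w alpha beta) excess_mass).
- exact: expR_ge0.
- by move=> x y; exact: excess_ge0.
- by apply: measurable_funD; apply: measurable_funM => //; exact: measurable_near.
- move=> v; under eq_integral do rewrite EFinD EFinM [X in (_ + X)%E]EFinM.
  have mn s : measurable_fun setT (fun x => ((~~ `[< far s (x - v) >])%:R : R)%:E).
    apply/measurable_EFinP.
    have mp : measurable_fun setT (fun x : plane R => (x, v)) by exact: measurable_fun_pair.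
    exact: (measurableT_comp (measurable_near s) mp).
  rewrite ge0_integralD//; last 4 first.
  + by move=> x _; rewrite mule_ge0// lee_fin.
  + exact: emeasurable_funM.
  + by move=> x _; rewrite mule_ge0// lee_fin.
  + exact: emeasurable_funM.
  rewrite !ge0_integralZl//.
  rewrite /excess_mass EFinD EFinM [X in (_ <= _ + X)%E]EFinM.
  apply: leeD; apply: lee_wpmul2l; rewrite ?lee_fin//; apply: near_int.
    by rewrite mulr_ge0// ltW.
  by rewrite mulr_ge0// ltW.
- move=> x u uK xu; rewrite isolation_cons//.
  have i0 : 0 <= iso u by exact: isolation_ge0.
  have e0 : 0 <= \sum_(v <- u) excess g b L r D rho K A t1 t2 w alpha beta x v.
    by apply: sumr_ge0 => v _; exact: excess_ge0.
  rewrite mulrA; apply: ler_wpM2r => //.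
  case: (boolP (x \in _)) => [/set_mem Ix|_]; last first.
    by rewrite mul0r mulr0 addr_ge0// expR_ge0.
  by rewrite mul1r; apply: (rate_leftmost g01 g_noninc C_def) => //; exact: ltnW.
- rewrite /excess_mass; apply: addr_ge0; apply: mulr_ge0 => //.
    by apply: mulr_ge0 => //; exact: sqr_ge0.
  by apply: mulr_ge0 => //; exact: sqr_ge0.
Qed.

Lemma interior_moment_ge k : (k <= K)%N -> 0 <= 1 - 4 * (r * D) - K%:R * (r ^+ 2 * C) ->
  (((expR (- b) * (1 - 4 * (r * D) - K%:R * (r ^+ 2 * C))) ^+ k)%:E <= moment U rho iso k)%E.
Proof.
move=> kK m0.
apply: (@moment_lower _ _ _ U rho iso rho0 (isolation_ge0 g01 D rho r0)
  (isolation_nil g r D rho) (smeas_isolation g01 g_noninc D rho r0) K) => //.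
  by rewrite mulr_ge0// expR_ge0.
move=> u uK; apply: le_trans (interior_lower u); rewrite lee_fin.
apply: ler_wpM2r; first exact: isolation_ge0.
apply: ler_wpM2l; first exact: expR_ge0.
rewrite lerD2l lerN2; apply: ler_wpM2r; last by rewrite ler_nat ltnW.
by rewrite mulr_ge0 ?sqr_ge0// -(mass_setT C_def) mass_ge0.
Qed.

End interior_moments.

(** * Expected number of isolated nodes near the boundary *)

Section boundary.
Context (R : realType) (g : R -> R) (C : R).
Hypothesis g01 : forall x : R, 0 <= x -> 0 <= g x <= 1.
Hypothesis g_noninc : forall x y : R, 0 <= x -> x <= y -> g y <= g x.
Local Notation leb := (@lebesgue_measure R).
Local Notation mu2 := (@lebesgue_measure R \x @lebesgue_measure R)%E.
Hypothesis C_def : (\int[mu2]_x (g (eucl_norm x))%:E = C%:E)%E.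
Context (r D rho : R).
Hypothesis r0 : 0 < r.
Hypothesis rho0 : 0 <= rho.
Hypothesis D0 : 0 <= D.
Hypothesis rD : r * D < 2^-1.
Local Notation U := (@square_unif R).
Local Notation h := (fun x : R => g (x / r)).
Implicit Types (x y v : plane R).
Local Notation link x y := (g (eucl_norm (x - y) / r)).
Local Notation T s := (mass g (far s)).
Local Notation kappa := (rho * r ^+ 2).

Lemma isolation_density1 x : isolation_density h rho [:: x] = expR (- (rho * \int[U]_y link x y)).
Proof.
rewrite /isolation_density /= big_nil !mul1r (miss_cons g01 g_noninc r0) miss_nil thinned_nil.
by congr expR; ring.
Qed.

Let density_le x a c m : room r a x.1 -> room r c x.2 -> m <= mass g (quadrant a c) ->
  isolation_density h rho [:: x] <= expR (- (kappa * (m - T D))).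
Proof.
move=> x1 x2 mM.
rewrite isolation_density1.
rewrite ler_expR lerN2.
rewrite -mulrA.
apply: (ler_wpM2l rho0).
apply: (le_trans _ (integral_link_ge g01 g_noninc C_def r0 x1 x2 rD)).
by apply: ler_wpM2l; [exact: sqr_ge0|rewrite lerD2r].
Qed.

Local Notation tight a t := ((~~ room r a t)%:R : R).

Let edge_strip a : set (measurableTypeR R) :=
  `[- 2^-1, - 2^-1 + r * a[%classic `|` `[2^-1 - r * a, 2^-1[%classic.

Let measurable_strip a : measurable (edge_strip a).
Proof. by apply: measurableU; exact: measurable_itv. Qed.

Let strip_le a : 0 <= a -> (leb (edge_strip a) <= (2 * (r * a))%:E)%E.
Proof.
move=> a0; have ra : 0 <= r * a by rewrite mulr_ge0// ltW.
have mi (i : interval R) : measurable [set` i] by exact: measurable_itv.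
apply: (le_trans (measureU2 _ _ _)); try exact: mi.
have E (s t : R) : s <= t -> leb `[s, t[%classic = (t - s)%:E by exact: lebesgue_itv_lebesgue.
apply: (@le_trans _ _ ((- 2^-1 + r * a - - 2^-1)%:E + (2^-1 - (2^-1 - r * a))%:E)%E).
  by apply: leeD; rewrite le_eqVlt; apply/orP; left; apply/eqP; apply: E; lra.
by rewrite -EFinD lee_fin; lra.
Qed.

Let stripP a t : - 2^-1 <= t < 2^-1 -> ~~ room r a t -> edge_strip a t.
Proof.
move=> /andP[t1 t2]; rewrite /room negb_or !negb_and => /andP[h1 h2].
have [t0|t0] := leP t 0.
  left; move: h1; rewrite t0 /= -ltNge => h1; rewrite /= in_itv/=; apply/andP; split=> //; lra.
right; move: h2; rewrite t0 /= -leNgt => h2; rewrite /= in_itv/=; apply/andP; split=> //; lra.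
Qed.

Let measurable_tight (i : plane R -> R) a : measurable_fun setT (i : plane R -> measurableTypeR R) ->
  measurable_fun setT (fun x => tight a (i x)).
Proof.
move=> mi.
have mr : measurable [set t : measurableTypeR R | ~ room r a t].
  by apply: measurableC; exact: measurable_room.
have mI : measurable_fun setT
    (\1_[set t : measurableTypeR R | ~ room r a t] : measurableTypeR R -> R).
  exact: measurable_indic.
have := measurableT_comp mI mi.
apply: eq_measurable_fun => x _ /=; rewrite indicE; congr (nat_of_bool _)%:R.
by apply/idP/idP => [/set_mem/negP|/negP H]; [|apply/mem_set].
Qed.

Let bmeas_tight (i : plane R -> R) a : measurable_fun setT (i : plane R -> measurableTypeR R) ->
  bmeas (fun x => tight a (i x)).
Proof.
move=> mi; apply: bmeas01 => [|x]; first exact: measurable_tight.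
by case: room; rewrite ?lexx ?ler01.
Qed.

Let bt1 a : bmeas (fun x : plane R => tight a x.1). Proof. exact: (bmeas_tight _ measurable_fst). Qed.
Let bt2 a : bmeas (fun x : plane R => tight a x.2). Proof. exact: (bmeas_tight _ measurable_snd). Qed.

Let int_le (f : plane R -> R) (E1 E2 : set (measurableTypeR R)) c1 c2 : bmeas f ->
  measurable E1 -> measurable E2 -> 0 <= c1 ->
  (leb E1 <= c1%:E)%E -> (leb E2 <= c2%:E)%E ->
  (forall x, 0 <= f x <= 1) ->
  (forall x, unit_square x -> f x != 0 -> E1 x.1 /\ E2 x.2) ->
  \int[U]_x f x <= c1 * c2.
Proof.
move=> bf mE1 mE2 c10 l1 l2 f01 fE.
have mE : measurable (E1 `*` E2 : set (plane R)) by exact: measurableX.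
have mS := @measurable_unit_square R.
rewrite -lee_fin -bintE// integral_square_unif; last 2 first.
- by apply/measurable_EFinP; have [] := bf.
- by move=> x; rewrite lee_fin; have /andP[] := f01 x.
apply: (@le_trans _ _ (\int[mu2]_(x in @unit_square R) (\1_(E1 `*` E2) x)%:E)%E).
  apply: ge0_le_integral => //.
  - by move=> x _; rewrite lee_fin; have /andP[] := f01 x.
  - by apply/measurable_EFinP/measurable_funTS; have [] := bf.
  - by apply/measurable_EFinP/measurable_funTS; exact: measurable_indic.
  - move=> x Sx; rewrite lee_fin indicE; have [->|fx] := eqVneq (f x) 0; first by [].
    have -> : (x \in E1 `*` E2) = true by apply/mem_set; exact: fE.
    by have /andP[] := f01 x.
rewrite integral_indic//; apply: (@le_trans _ _ (mu2 (E1 `*` E2))).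
  apply: le_measure; [|by rewrite inE|exact: subIsetl].
  by rewrite inE; exact: measurableI.
by rewrite product_measure1E// EFinM; apply: lee_pmul.
Qed.

Let sq_itv : (leb `[(- 2^-1)%R, 2^-1%R[%classic <= 1%:E)%E.
Proof.
rewrite le_eqVlt; apply/orP; left; apply/eqP.
by apply: (eq_trans (lebesgue_itv_lebesgue _ _ _)); [lra|congr EFin; lra].
Qed.

Let tight01 a t : 0 <= tight a t <= 1. Proof. by case: room; rewrite ?lexx ?ler01. Qed.

Let tight_neq0 a t : tight a t != 0 -> ~~ room r a t.
Proof. by case: room; rewrite ?eqxx. Qed.

Let int_tight1 a : 0 <= a -> \int[U]_x tight a x.1 <= 2 * (r * a).
Proof.
move=> a0; have ra : 0 <= 2 * (r * a) by rewrite !mulr_ge0// ltW.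
rewrite -[leRHS]mulr1.
apply: (int_le (bt1 a) (measurable_strip a) (measurable_itv `[- 2^-1, 2^-1[) ra (strip_le a0) sq_itv).
  by move=> x; exact: tight01.
move=> x [/= x1 x2] /tight_neq0 nr; split=> //; exact: stripP.
Qed.

Let int_tight2 a : 0 <= a -> \int[U]_x tight a x.2 <= 2 * (r * a).
Proof.
move=> a0; have ra : 0 <= 2 * (r * a) by rewrite !mulr_ge0// ltW.
rewrite -[leRHS]mul1r.
apply: (int_le (bt2 a) (measurable_itv `[- 2^-1, 2^-1[) (measurable_strip a) ler01 sq_itv (strip_le a0)).
  by move=> x; exact: tight01.
move=> x [/= x1 x2] /tight_neq0 nr; split=> //; exact: stripP.
Qed.

Let int_tight12 a : 0 <= a -> \int[U]_x (tight a x.1 * tight a x.2) <= (2 * (r * a)) ^+ 2.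
Proof.
move=> a0; have ra : 0 <= 2 * (r * a) by rewrite !mulr_ge0// ltW.
rewrite expr2.
apply: (int_le (bmeasM (bt1 a) (bt2 a)) (measurable_strip a) (measurable_strip a) ra
  (strip_le a0) (strip_le a0)).
  by move=> x; do 2! case: room; rewrite ?mul0r ?mulr0 ?mulr1 ?lexx ?ler01.
move=> x [/= x1 x2]; rewrite mulf_eq0 negb_or => /andP[/tight_neq0 n1 /tight_neq0 n2].
by split; exact: stripP.
Qed.

Context (w eta A : R).
Hypothesis w0 : 0 <= w.
Hypothesis weta : w <= eta.
Hypothesis A0 : 0 <= A.

(* Near a corner a quarter of the neighbourhood remains; near one side a half,
   plus a strip of width [w] as soon as the point is further than [r * w] from
   the side; beyond [r * A] almost all of it. *)
Definition boundary_bound :=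
  expR (- (kappa * (C / 4 - T D))) * (2 * (r * D)) ^+ 2 +
  2 * (expR (- (kappa * (C / 2 - 2 * T D))) * (2 * (r * w)) +
       expR (- (kappa * (C / 2 + g (2 * eta) * (w * eta) - 2 * T D))) * (2 * (r * A)) +
       expR (- (kappa * (C - T A - 2 * T D))) * (2 * (r * D))).

Local Notation q0 := (expR (- (kappa * (C / 4 - T D)))).
Local Notation q1 := (expR (- (kappa * (C / 2 - 2 * T D)))).
Local Notation q2 := (expR (- (kappa * (C / 2 + g (2 * eta) * (w * eta) - 2 * T D)))).
Local Notation q3 := (expR (- (kappa * (C - T A - 2 * T D)))).

Let side (t : R) := q1 * tight w t + q2 * tight A t + q3 * tight D t.

Let side0 t : 0 <= side t.
Proof. by rewrite !addr_ge0// mulr_ge0// expR_ge0. Qed.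

(** As [tight D t] is 1, the last term is always present and suffices when there is room [A].
    Without it [tight A t] is 1, and the second term suffices if there is room [w]; failing that,
    the first term does. *)
Let side_le t p : ~~ room r D t ->
  (p <= q1) -> (room r w t -> p <= q2) -> (room r A t -> p <= q3) -> p <= side t.
Proof.
move=> nD p1 p2 p3; rewrite /side nD mulr1.
have e1 : 0 <= q1 := expR_ge0 _; have e2 : 0 <= q2 := expR_ge0 _.
have e3 : 0 <= q3 := expR_ge0 _.
case: (room r w t) p2 => [/(_ isT) p2|_]; case: (room r A t) p3 => [/(_ isT) p3|_];
  rewrite ?mulr0 ?mulr1 ?add0r ?addr0; lra.
Qed.

Let pointwise x : unit_square x -> ~ interior r D x ->
  isolation_density h rho [:: x] <=
  q0 * (tight D x.1 * tight D x.2) + (side x.1 + side x.2).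
Proof.
move=> [/= x1 x2] /negP; rewrite /interior negb_and => nI; rewrite !in_itv/= in x1 x2.
have R1 := room0 r x1; have R2 := room0 r x2.
have s1 := side0 x.1; have s2 := side0 x.2; have e0 : 0 <= q0 := expR_ge0 _.
have T2 m : m - T D - T D = m - 2 * T D by ring.
have [r1|n1] := boolP (room r D x.1); have [r2|n2] := boolP (room r D x.2).
- by rewrite r1 r2 in nI.
- rewrite mul0r mulr0 add0r; apply: (@le_trans _ _ (side x.2)); last by rewrite lerDr.
  apply: side_le => //.
  + rewrite -T2; apply: (density_le r1 R2); rewrite (mass_quadrantC g01 g_noninc).
    exact: (mass_quadrant0 g01 g_noninc C_def).
  + move=> rw; rewrite -T2; apply: (density_le r1 rw).
    by rewrite (mass_quadrantC g01 g_noninc); exact: (mass_quadrant_strip g01 g_noninc C_def).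
  + move=> rA; rewrite -T2 (_ : C - T A - T D = C - T D - T A); last by ring.
    by apply: (density_le r1 rA); exact: (mass_quadrant_far g01 g_noninc C_def).
- rewrite !mulr0 add0r; apply: (@le_trans _ _ (side x.1)); last by rewrite lerDl.
  apply: side_le => //.
  + by rewrite -T2; apply: (density_le R1 r2); exact: (mass_quadrant0 g01 g_noninc C_def).
  + by move=> rw; rewrite -T2; apply: (density_le rw r2); exact: (mass_quadrant_strip g01 g_noninc C_def).
  + by move=> rA; rewrite -T2; apply: (density_le rA r2); exact: (mass_quadrant_far g01 g_noninc C_def).
- rewrite !mulr1; apply: (@le_trans _ _ q0); last by lra.
  by apply: (density_le R1 R2); exact: (mass_quadrant00 g01 g_noninc C_def).
Qed.

Lemma boundary_le : (\int[U]_x ((x \in @unit_square R `\` interior r D)%:R *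
    isolation_density h rho [:: x])%:E <= boundary_bound%:E)%E.
Proof.
have bs (i : plane R -> R) : (forall a, bmeas (fun x => tight a (i x))) -> bmeas (fun x => side (i x)).
  move=> bi; have bc c a : bmeas (fun x => c * tight a (i x)).
    by apply: bmeasM => //; exact: bmeas_cst.
  by rewrite /side; apply: bmeasD => //; exact: bmeasD.
have b12 := bmeasM (bt1 D) (bt2 D).
have bq : bmeas (fun x : plane R => q0 * (tight D x.1 * tight D x.2)).
  by apply: bmeasM => //; exact: bmeas_cst.
have bR : bmeas (fun x : plane R => q0 * (tight D x.1 * tight D x.2) + (side x.1 + side x.2)).
  by apply: bmeasD => //; apply: bmeasD; exact: bs.
have sideI (i : plane R -> R) : (forall a, bmeas (fun x => tight a (i x))) ->
    (forall a, 0 <= a -> \int[U]_x tight a (i x) <= 2 * (r * a)) ->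
    \int[U]_x side (i x) <= q1 * (2 * (r * w)) + q2 * (2 * (r * A)) + q3 * (2 * (r * D)).
  move=> bi ii; have bc c a : bmeas (fun x => c * tight a (i x)).
    by apply: bmeasM => //; exact: bmeas_cst.
  rewrite /side bintD//; last exact: bmeasD.
  rewrite bintD// !bintZ//.
  by apply: lerD; [apply: lerD|]; apply: ler_wpM2l; rewrite ?expR_ge0//; exact: ii.
have mB : measurable (@unit_square R `\` interior r D).
  by apply: measurableD; [exact: measurable_unit_square|exact: measurable_interior].
apply: (@le_trans _ _ (\int[U]_x (q0 * (tight D x.1 * tight D x.2) + (side x.1 + side x.2))%:E)%E).
  apply: ge0_le_integral => //.
  - by move=> x _; rewrite lee_fin mulr_ge0// isolation_density1 expR_ge0.
  - apply/measurable_EFinP; apply: measurable_funM.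
      exact: (measurable_indic mB).
    apply: (eq_measurable_fun (fun x => expR (rho * (miss h [:: x] - 1)))).
      by move=> x _; rewrite /isolation_density/= big_nil !mul1r.
    apply: measurableT_comp => //; apply: measurable_funM => //; apply: measurable_funB => //.
    exact: (smeas_miss (scaled01 g01 r0) (measurable_scaled g_noninc r0)
      [:: mk_mfun (@measurable_id _ (plane R) setT)]).
  - by apply/measurable_EFinP; have [] := bR.
  - move=> x _; rewrite lee_fin; case: (boolP (x \in _)) => [/set_mem[Sx nI]|_].
      by rewrite mul1r; exact: pointwise.
    by rewrite mul0r !addr_ge0// mulr_ge0 ?expR_ge0// mulr_ge0.
rewrite bintE// lee_fin bintD//; last by apply: bmeasD; exact: bs.
rewrite bintZ// bintD; [|exact: bs|exact: bs].
have := sideI _ bt1 int_tight1; have := sideI _ bt2 int_tight2.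
have := ler_wpM2l (expR_ge0 (- (kappa * (C / 4 - T D)))) (int_tight12 D0).
rewrite /boundary_bound; lra.
Qed.

End boundary.

(** * Asymptotics *)

Section limits.
Context (R : realType).
Implicit Types f : R -> R.

Lemma cvg_ge0_small f : (forall e, 0 < e -> \forall q \near +oo, 0 <= f q <= e) ->
  f q @[q --> +oo] --> (0 : R).
Proof.
move=> H; apply/cvgrPdist_le => e e0; near=> q.
rewrite sub0r normrN ger0_norm; near: q; apply: filterS (H _ e0); by move=> q /andP[].
Unshelve. all: by end_near. Qed.

Lemma cvg_expr f (l : R) n : f q @[q --> +oo] --> l -> f q ^+ n @[q --> +oo] --> l ^+ n.
Proof. move=> fl; exact: (cvg_comp _ _ fl (@exprn_continuous R n l)). Qed.

Lemma cvg_exp f (l : R) : f q @[q --> +oo] --> l -> expR (f q) @[q --> +oo] --> expR l.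
Proof. move=> fl; exact: (cvg_comp _ _ fl (@continuous_expR R l)). Qed.

Lemma cvg_ext f k (l : R) : (forall q, f q = k q) -> f q @[q --> +oo] --> l ->
  k q @[q --> +oo] --> l.
Proof. by move=> /funext ->. Qed.

Lemma cvg_mul f k (l m : R) : f q @[q --> +oo] --> l -> k q @[q --> +oo] --> m ->
  f q * k q @[q --> +oo] --> l * m.
Proof. by move=> fl km; exact: cvgM. Qed.

Lemma cvg_scale (c : R) f (l : R) : f q @[q --> +oo] --> l -> c * f q @[q --> +oo] --> c * l.
Proof. by move=> fl; apply: cvg_mul => //; exact: cvg_cst. Qed.

Lemma cvg_add f k (l m : R) : f q @[q --> +oo] --> l -> k q @[q --> +oo] --> m ->
  f q + k q @[q --> +oo] --> l + m.
Proof. by move=> fl km; exact: cvgD. Qed.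

(* [expR x >= (x / N) ^+ N] with [N = n + 1]. *)
Lemma pow_expR_cvg0 n m (c : R) : 0 < c ->
  q ^+ n * expR (- (c * q ^+ m.+1)) @[q --> +oo] --> (0 : R).
Proof.
move=> c0; apply: cvg_ge0_small => e e0.
pose N : R := n.+1%:R; have N0 : 0 < N by [].
pose M := (N / c) ^+ n.+1 / e.
near=> q.
have q1 : 1 <= q by near: q; apply: nbhs_pinfty_ge; exact: num_real.
have qM : M <= q by near: q; apply: nbhs_pinfty_ge; exact: num_real.
have q0 : 0 < q by rewrite (lt_le_trans _ q1).
have qq : q <= q ^+ m.+1 by rewrite exprS ler_peMr ?(ltW q0)// exprn_ege1.
apply/andP; split; first by rewrite mulr_ge0 ?expR_ge0// exprn_ge0// ltW.
apply: (@le_trans _ _ (q ^+ n * expR (- (c * q)))).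
  apply: ler_wpM2l; first by rewrite exprn_ge0// ltW.
  by rewrite ler_expR lerN2 ler_wpM2l// ltW.
have h : (c * q / N) ^+ n.+1 <= expR (c * q).
  have -> : expR (c * q) = expR (c * q / N) ^+ n.+1.
    by rewrite -expRM_natr divfK// lt0r_neq0.
  rewrite ler_pXn2r ?nnegrE ?expR_ge0//; last by rewrite divr_ge0 ?mulr_ge0// ltW.
  apply: (le_trans _ (expR_ge1Dxn 0 _)); first by rewrite expr1 divr1 lerDr.
  by rewrite divr_ge0 ?mulr_ge0// ltW.
rewrite expRN ler_pdivrMr ?expR_gt0//.
apply: (le_trans _ (ler_wpM2l (ltW e0) h)).
have -> : e * (c * q / N) ^+ n.+1 = q ^+ n * (q * (e / (N / c) ^+ n.+1)).
  rewrite !expr_div_n !exprMn (exprSr q).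
  have cn : c ^+ n.+1 != 0 by rewrite expf_neq0// lt0r_neq0.
  have Nn : N ^+ n.+1 != 0 by rewrite expf_neq0// lt0r_neq0.
  have en : e != 0 by exact: lt0r_neq0.
  set a := c ^+ n.+1 in cn *; set a' := N ^+ n.+1 in Nn *; field.
  by rewrite cn Nn.
apply: ler_peMr; first by rewrite exprn_ge0// ltW.
rewrite -(ler_pdivrMr _ _ (divr_gt0 _ _)) ?exprn_gt0 ?divr_gt0// div1r invf_div.
Unshelve. all: by end_near. Qed.

End limits.

Section asymptotics.
Context (R : realType) (g : R -> R) (b C : R).
Hypothesis g01 : forall x : R, 0 <= x -> 0 <= g x <= 1.
Hypothesis g_noninc : forall x y : R, 0 <= x -> x <= y -> g y <= g x.
Local Notation mu2 := (@lebesgue_measure R \x @lebesgue_measure R)%E.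
Hypothesis C_def : (\int[mu2]_x (g (eucl_norm x))%:E = C%:E)%E.
Hypothesis C_gt0 : 0 < C.
Hypothesis g_small : (g : R -> R^o) =o_ (pinfty_nbhs R)
  (fun x => (x ^+ 2 * ln x ^+ 2)^-1 : R^o).
Local Notation U := (@square_unif R).
Local Notation T s := (mass g (far s)).

(* Everything is expressed through the fourth root [q] of [rho * r ^+ 2]. *)
Definition logdens q : R := C * q ^+ 4.
Definition dens q : R := expR (logdens q - b).
Definition radius q : R := q ^+ 2 * expR (- (logdens q - b) / 2).
(** The logarithm is a fixed fraction of [logdens q], so that [far_ln] makes [q ^+ 4] times the tail
    mass vanish. The exponent is small enough for [radius q * margin q] to vanish, and for
    [margin q ^+ 2] not to spoil the factor [expR (- logdens q / 4)] of the corners: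
    [- 1 / 4 + 2 / 20] is negative. *)
Definition margin q : R := expR (logdens q / 20).

Local Notation L := logdens.
Local Notation rho := dens.
Local Notation r := radius.
Local Notation D := margin.

Lemma near_pinfty_ge (M : R) : \forall q \near +oo, M <= q.
Proof. by apply: nbhs_pinfty_ge; exact: num_real. Qed.

Lemma logdens_ge M : \forall q \near +oo, M <= L q.
Proof.
near=> q.
have q1 : 1 <= q by near: q; exact: near_pinfty_ge.
have qM : M / C <= q by near: q; exact: near_pinfty_ge.
rewrite ler_pdivrMr// mulrC in qM; apply: (le_trans qM).
apply: ler_wpM2l; first exact: ltW.
by rewrite (exprS _ 3) ler_peMr ?exprn_ege1//; lra.
Unshelve. all: by end_near. Qed.

Lemma dens_radius2 q : rho q * r q ^+ 2 = q ^+ 4.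
Proof.
rewrite /rho /r exprMn -exprM mulrCA -expRM_natr -expRD.
by rewrite (_ : _ + _ = 0) ?expR0 ?mulr1//; field.
Qed.

Lemma dens_radius q : rho q * r q = q ^+ 2 * expR ((L q - b) / 2).
Proof. by rewrite mulrCA -expRD; congr (_ * expR _); field. Qed.

Lemma far_margin_cvg0 : q ^+ 4 * T (D q) @[q --> +oo] --> (0 : R).
Proof.
apply: cvg_ge0_small => e e0.
have e'0 : 0 < e * C / 20 by rewrite divr_gt0// mulr_gt0.
have [s0 s01 Hs] := far_ln g01 g_noninc C_def g_small e'0.
near=> q.
have Ls : 20 * ln s0 <= L q by near: q; exact: logdens_ge.
apply/andP; split; first by rewrite mulr_ge0 ?mass_ge0// -[4%N]/(2 * 2)%N exprM sqr_ge0.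
have sD : s0 <= D q.
  have s0p : 0 < s0 by exact: lt_trans s01.
  rewrite -(lnK s0p) ler_expR; lra.
have := Hs _ sD; rewrite /margin expRK => h.
have -> : q ^+ 4 * T (D q) = T (D q) * (L q / 20) * (20 / C).
  by rewrite /logdens; field; rewrite lt0r_neq0.
have := ler_wpM2r (ltW (divr_gt0 (ltr0n R 20) C_gt0)) h.
by rewrite -/(margin q) (_ : e * C / 20 * (20 / C) = e)//; field; rewrite lt0r_neq0.
Unshelve. all: by end_near. Qed.

Lemma profile_logdens_cvg0 : L q * g (L q / 2) @[q --> +oo] --> (0 : R).
Proof.
apply: cvg_ge0_small => e e0.
have e20 : 0 < e / 2 by rewrite divr_gt0.
have [s0 s01 Hs] := profile_small g01 g_small e20.
near=> q.
have L1 : 2 * s0 <= L q by near: q; exact: logdens_ge.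
have L2 : 2 * expR 1 <= L q by near: q; exact: logdens_ge.
have L0 : 2 <= L q by near: q; exact: logdens_ge.
have Lp : 0 <= L q / 2 by lra.
have /andP[g0 _] := g01 Lp.
apply/andP; split; first by rewrite mulr_ge0//; lra.
have sL : s0 <= L q / 2 by lra.
set x := L q / 2 in g0 sL Lp *.
have x1 : 1 <= x by rewrite /x; lra.
have lx : 1 <= ln x.
  by rewrite -(expRK 1) ler_ln ?posrE ?expR_gt0//; rewrite /x; lra.
have -> : L q = 2 * x by rewrite /x; field.
have x0 : 0 <= 2 * x by lra.
apply: (le_trans (ler_wpM2l x0 (Hs _ sL))).
have xp : 0 < x by lra.
have xn : x != 0 by exact: lt0r_neq0.
have ln0 : ln x != 0 by apply: lt0r_neq0; lra.
have -> : 2 * x * (e / 2 / (x ^+ 2 * ln x ^+ 2)) = e / (x * ln x ^+ 2) by field; rewrite xn ln0.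
have lp : 0 < ln x by lra.
rewrite ler_pdivrMr; last by rewrite mulr_gt0// exprn_gt0.
by rewrite ler_peMr ?(ltW e0)// mulr_ege1// exprn_ege1.
Unshelve. all: by end_near. Qed.

Lemma radius_margin_cvg0 : r q * D q @[q --> +oo] --> (0 : R).
Proof.
have c0 : 0 < 9 * C / 20 by rewrite divr_gt0// mulr_gt0.
have := cvg_scale (c := expR (b / 2)) (@pow_expR_cvg0 R 2 3 _ c0); rewrite mulr0.
apply: cvg_ext => q.
by rewrite mulrCA /radius /margin -[RHS]mulrA -!expRD; congr (_ * expR _); rewrite /logdens; field.
Qed.

Lemma radius2_cvg0 c : c * r q ^+ 2 @[q --> +oo] --> (0 : R).
Proof.
have := cvg_scale (c := c * expR b) (@pow_expR_cvg0 R 4 3 _ C_gt0); rewrite mulr0.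
apply: cvg_ext => q.
rewrite /radius exprMn -exprM -expRM_natr mulrCA [RHS]mulrCA; congr (_ * _).
by rewrite -[LHS]mulrA -expRD; congr (_ * expR _); rewrite /logdens; field.
Qed.

Let defectE q : defect g (r q) (D q) (rho q) = 3 * (q ^+ 4 * T (D q)).
Proof. by rewrite /defect dens_radius2; ring. Qed.

Lemma defect_cvg0 : defect g (r q) (D q) (rho q) @[q --> +oo] --> (0 : R).
Proof.
have := cvg_scale (c := 3) far_margin_cvg0; rewrite mulr0.
by apply: cvg_ext => q; rewrite defectE.
Qed.

Lemma main_rate_cvg K :
  main_rate g b (L q) (r q) (D q) (rho q) K @[q --> +oo] --> expR (- b).
Proof.
have hb : (fun _ : R => - b) q @[q --> (+oo : set_system R)] --> - b by exact: cvg_cst.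
have h1 := cvg_add hb defect_cvg0.
have := cvg_exp (cvg_add h1 (cvg_scale (c := 2 * K%:R) profile_logdens_cvg0)).
rewrite mulr0 !addr0; apply: cvg_ext => q.
by rewrite /main_rate mulrA.
Qed.

(** The square of the radius is [q ^+ 4 * expR (b - L q)]. Up to the vanishing defect, the exponent
    is therefore [- 3 / 4 * L q] in the middle regime, with the power [q ^+ 12] coming from
    [L q ^+ 2 * r q ^+ 2], and a negative multiple of [q ^+ 4] in the close one. *)
Lemma excess_mass_cvg0 K A t1 t2 w alpha beta : 0 < w * (t2 - t1) * (alpha * beta ^+ K) ->
  excess_mass g b (L q) (r q) (D q) (rho q) K A t1 t2 w alpha beta @[q --> +oo] --> (0 : R).
Proof.
move=> c0; set c := w * _ * _ in c0; have c2 : 0 < 2 * c by rewrite mulr_gt0.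
have C2 : 0 < 3 * C / 4 by rewrite divr_gt0// mulr_gt0.
have h1 := cvg_mul (cvg_exp defect_cvg0) (@pow_expR_cvg0 R 12 3 _ C2).
have h2 := cvg_scale (c := 4 * A ^+ 2) (@pow_expR_cvg0 R 4 3 _ c2).
have := cvg_add (cvg_scale (c := 4 * C ^+ 2) h1) h2; rewrite !mulr0 addr0.
apply: cvg_ext => q; rewrite /excess_mass.
have e2 : r q ^+ 2 = q ^+ 4 * expR (b - L q).
  by rewrite /radius exprMn -exprM -expRM_natr; congr (_ * expR _); field.
congr (_ + _).
  rewrite exprMn e2 /middle_rate.
  have -> : expR (- b + defect g (r q) (D q) (rho q) + L q / 4) * (4 * (L q ^+ 2 * (q ^+ 4 * expR (b - L q)))) =
     4 * C ^+ 2 * (q ^+ 12 * (expR (- b + defect g (r q) (D q) (rho q) + L q / 4) * expR (b - L q))).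
    have -> : L q ^+ 2 = C ^+ 2 * q ^+ 8 by rewrite /logdens; ring.
    by ring.
  rewrite -expRD; congr (_ * _); rewrite mulrCA -expRD; congr (_ * expR _).
  by rewrite /logdens; field.
rewrite /close_rate dens_radius2 exprMn e2; set X := expR (L q - b - _).
have -> : X * (4 * (A ^+ 2 * (q ^+ 4 * expR (b - L q)))) =
    4 * A ^+ 2 * (q ^+ 4 * (X * expR (b - L q))) by ring.
by rewrite /X -expRD; congr (_ * (_ * expR _)); rewrite /c; ring.
Qed.

End asymptotics.

Section asymptotics.
Context (R : realType) (g : R -> R) (b C : R).
Hypothesis g01 : forall x : R, 0 <= x -> 0 <= g x <= 1.
Hypothesis g_noninc : forall x y : R, 0 <= x -> x <= y -> g y <= g x.
Local Notation mu2 := (@lebesgue_measure R \x @lebesgue_measure R)%E.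
Hypothesis C_def : (\int[mu2]_x (g (eucl_norm x))%:E = C%:E)%E.
Hypothesis C_gt0 : 0 < C.
Hypothesis g_small : (g : R -> R^o) =o_ (pinfty_nbhs R)
  (fun x => (x ^+ 2 * ln x ^+ 2)^-1 : R^o).
Local Notation U := (@square_unif R).
Local Notation T s := (mass g (far s)).
Local Notation L := (logdens C).
Local Notation rho := (dens b C).
Local Notation r := (radius b C).
Local Notation D := (margin C).

Lemma radius_gt0 q : 0 < q -> 0 < r q.
Proof. by move=> q0; rewrite mulr_gt0 ?exprn_gt0 ?expR_gt0. Qed.

Lemma radius_margin_lt : \forall q \near +oo, r q * D q < 2^-1.
Proof.
have h0 : (0 : R) < 2^-1 by rewrite invr_gt0.
have := radius_margin_cvg0 b C_gt0 => /cvgrPdist_lt /(_ _ h0); apply: filterS => q.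
by rewrite sub0r normrN => /(le_lt_trans (ler_norm _)).
Qed.

Lemma inv_cvg0 : (q : R)^-1 @[q --> +oo] --> (0 : R).
Proof.
apply: cvg_ge0_small => e e0; near=> q.
have q1 : 1 <= q by near: q; exact: near_pinfty_ge.
have qe : e^-1 <= q by near: q; exact: near_pinfty_ge.
have q0 : 0 < q by lra.
rewrite invr_ge0 (ltW q0)/= -(invrK e) lef_pV2 ?posrE ?invr_gt0.
Unshelve. all: by end_near. Qed.

Let cstc (c : R) : (fun _ : R => c) q @[q --> (+oo : set_system R)] --> c.
Proof. exact: cvg_cst. Qed.

Lemma over_bound_cvg k (m e : R -> R) (l : R) : m q @[q --> +oo] --> l ->
  e q @[q --> +oo] --> (0 : R) -> over_bound (m q) (e q) k @[q --> +oo] --> (0 : R).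
Proof.
move=> ml e0; elim: k => [|k IH] /=; first exact: cstc.
have h := cvg_mul (cvg_scale (c := k%:R) e0) (cvg_add (cvg_expr (n := k) ml) IH).
have := cvg_scale (c := k.+1%:R) (cvg_add (cvg_mul ml IH) h).
by rewrite !mulr0 mul0r addr0 mulr0.
Qed.

Lemma moment_cvg k :
  let M q := moment U (rho q) (isolation g (r q) (D q) (rho q)) k in
  fine (M q) @[q --> +oo] --> expR (- b) ^+ k.
Proof.
move=> M.
(* With [g s <= (8 * k.+1%:R)^-1] and [A = 2 * s], the product is at most [k / (4 * (k + 1))]; the
   successor avoids an inverse of 0 when [k = 0]. *)
have [A [A0 KA]] : exists A, 0 <= A /\ 2 * k%:R * g (A / 2) <= 4^-1.
  have e0 : (0 : R) < (8 * k.+1%:R)^-1 by rewrite invr_gt0 mulr_gt0.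
  have [s s0 Hs] := profile_cvg0 g01 g_small e0.
  exists (2 * s); split; first by rewrite mulr_ge0// ltW.
  have k0 : 0 <= 2 * k%:R :> R by rewrite mulr_ge0.
  rewrite (_ : 2 * s / 2 = s); last by field.
  apply: (le_trans (ler_wpM2l k0 (Hs _ (lexx _)))).
  rewrite ler_pdivrMr ?mulr_gt0// mulrA (_ : 4^-1 * 8 = 2); last by field.
  by apply: ler_wpM2l => //; rewrite ler_nat.
have [|t1 [t2 [w [alpha [beta [t12 w0 al0 be01 clear]]]]]] := clearing g01 g_noninc C_def C_gt0.
  have h0 : (0 : R) < 2^-1 by rewrite invr_gt0.
  have [s s0 Hs] := profile_cvg0 g01 g_small h0.
  by exists s => //; apply: (le_lt_trans (Hs _ (lexx _))); rewrite invf_lt1 ?ltr1n.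
pose main q := main_rate g b (L q) (r q) (D q) (rho q) k.
pose em q := excess_mass g b (L q) (r q) (D q) (rho q) k A t1 t2 w alpha beta.
pose lo q := (expR (- b) * (1 - 4 * (r q * D q) - k%:R * (r q ^+ 2 * C))) ^+ k.
pose up q := main q ^+ k + over_bound (main q) (em q) k.
have mcv : main q @[q --> +oo] --> expR (- b) by exact: main_rate_cvg.
have ecv : em q @[q --> +oo] --> (0 : R).
  apply: excess_mass_cvg0 => //; have /andP[t10 t12'] := t12; have /andP[be0 _] := be01.
  by rewrite !mulr_gt0 ?subr_gt0// exprn_gt0.
have upc : up q @[q --> +oo] --> expR (- b) ^+ k.
  have := cvg_add (cvg_expr (n := k) mcv) (over_bound_cvg k mcv ecv).
  by rewrite addr0.
have inc : 1 - 4 * (r q * D q) - k%:R * (r q ^+ 2 * C) @[q --> +oo] --> (1 : R).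
  have h1 := cvg_scale (c := -4) (radius_margin_cvg0 b C_gt0).
  have h2 := radius2_cvg0 b C_gt0 (- (k%:R * C)).
  have := cvg_add (cvg_add (@cstc 1) h1) h2; rewrite mulr0 !addr0.
  by apply: cvg_ext => q; ring.
have loc : lo q @[q --> +oo] --> expR (- b) ^+ k.
  by have := cvg_expr (n := k) (cvg_scale (c := expR (- b)) inc); rewrite mulr1.
have bounds : \forall q \near +oo, ((lo q)%:E <= M q)%E /\ (M q <= (up q)%:E)%E.
  have i1 : \forall q \near +oo, 0 <= 1 - 4 * (r q * D q) - k%:R * (r q ^+ 2 * C).
    move/cvgrPdist_lt : inc => /(_ _ ltr01); apply: filterS => q /(le_lt_trans (ler_norm _)); lra.
  near=> q.
  have q1 : 1 <= q by near: q; exact: near_pinfty_ge.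
  have q0 : 0 < q by exact: lt_le_trans q1.
  have rp := radius_gt0 q0.
  have L0 : 0 < L q by rewrite mulr_gt0// exprn_gt0.
  have rL : rho q * r q ^+ 2 * C = L q by rewrite dens_radius2 mulrC.
  have D0 : 0 < D q by exact: expR_gt0.
  have DL : L q / 20 <= D q.
    by apply: (le_trans _ (expR_ge1Dxn 0 _)); rewrite ?expr1 ?divr1 ?lerDr// divr_ge0// ltW.
  have t2D : t2 <= D q.
    have : 20 * t2 <= L q by near: q; exact: logdens_ge.
    lra.
  have wD : w <= D q.
    have : 20 * w <= L q by near: q; exact: logdens_ge.
    lra.
  have rD : r q * D q < 2^-1 by near: q; exact: radius_margin_lt.
  split.
    apply: (interior_moment_ge g01 g_noninc C_def rp (erefl _) rL D0 rD (leqnn k)).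
    by near: q.
  exact: (interior_moment_le g01 g_noninc C_def rp L0 (erefl _) rL rD A0 KA t12 w0 al0 be01
    clear t2D wD (leqnn k)).
apply: (squeeze_cvgr _ loc upc).
apply: filterS bounds => q [h1 h2].
have fM : M q \is a fin_num.
  by rewrite fin_real// (lt_le_trans (ltNyr _) h1) (le_lt_trans h2 (ltry _)).
by rewrite -!lee_fin fineK// h1 h2.
Unshelve. all: by end_near. Qed.

Lemma boundary_cvg0 : exists w eta A : R -> R,
  (\forall q \near +oo, [/\ 0 <= w q, w q <= eta q & 0 <= A q]) /\
  rho q * boundary_bound g C (r q) (D q) (rho q) (w q) (eta q) (A q)
    @[q --> +oo] --> (0 : R).
Proof.
have [eta' eta'0 geta] := profile_pos g01 g_noninc C_def C_gt0.
pose eta := eta' / 2; have eta0 : 0 < eta by rewrite divr_gt0.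
have ge : 0 < g (2 * eta) by rewrite /eta mulrC divfK.
have C8 : 0 < C / 8 by rewrite divr_gt0.
have [A1 HA] := far_cvg0 g01 g_noninc C_def C8.
pose A := Num.max A1 0.
have TA : T A <= C / 8 by apply: HA; rewrite le_max lexx.
(* The width must satisfy two opposite demands. The strip closest to the side contributes
   [q ^+ 2 * w = q^-1], which vanishes; beyond it the gain in the exponent is proportional to
   [q ^+ 4 * w = q], which beats every power of [q]. *)
exists (fun q => q^-1 ^+ 3), (fun=> eta), (fun=> A); split.
  near=> q.
  have q1 : 1 <= q by near: q; exact: near_pinfty_ge.
  have qe : eta^-1 <= q by near: q; exact: near_pinfty_ge.
  have q0 : 0 < q by exact: lt_le_trans q1.
  have iq : 0 <= q^-1 by rewrite invr_ge0 ltW.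
  have iq1 : q^-1 <= 1 by rewrite invf_le1.
  split; [by rewrite exprn_ge0| |by rewrite le_max lexx orbT].
  apply: (@le_trans _ _ q^-1); first by rewrite -[leRHS]expr1; apply: ler_wiXn2l.
  by rewrite -(invrK eta) lef_pV2 ?posrE ?invr_gt0.
pose qT q := q ^+ 4 * T (D q).
have qT0 : qT q @[q --> +oo] --> (0 : R) by exact: far_margin_cvg0.
(* The exponent beyond [r * A] from the side, per unit of [q ^+ 4]: [C - T A] from the
   neighbourhood, minus [C / 2] from [rho * r] and [C / 20] from the margin. It is positive since
   [A] was taken with [T A <= C / 8]. *)
pose c := 9 * C / 20 - T A.
have c0 : 0 < c by rewrite /c; have := C_gt0; lra.
have c1 : 0 < 3 * C / 20 by rewrite divr_gt0// mulr_gt0.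
have c2 : 0 < g (2 * eta) * eta by exact: mulr_gt0.
have h1 := cvg_scale (c := 4) (cvg_mul (cvg_exp qT0) (@pow_expR_cvg0 R 4 3 _ c1)).
have h2 := cvg_add (cvg_add inv_cvg0 (cvg_scale (c := A) (@pow_expR_cvg0 R 2 0 _ c2)))
  (@pow_expR_cvg0 R 2 3 _ c0).
have h3 := cvg_scale (c := 4 * expR (- b / 2)) (cvg_mul (cvg_exp (cvg_scale (c := 2) qT0)) h2).
have := cvg_add h1 h3; rewrite !mulr0 !addr0 !mulr0 addr0.
apply: cvg_ext => q; rewrite /boundary_bound dens_radius2; apply/esym.
set e0 := expR _; set e1 := expR _; set e2 := expR _; set e3 := expR _; set w := q^-1 ^+ 3.
have qw : q ^+ 4 * w = q.
  rewrite /w; have [->|qn] := eqVneq q 0; first by rewrite expr0n mul0r.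
  by field.
have qw2 : q ^+ 2 * w = q^-1.
  rewrite /w; have [->|qn] := eqVneq q 0; first by rewrite expr0n mul0r invr0.
  by field.
pose X := expR ((L q - b) / 2).
have k1 : rho q * r q = q ^+ 2 * X by exact: dens_radius.
transitivity (4 * (rho q * r q ^+ 2) * (e0 * D q ^+ 2) +
  4 * (rho q * r q) * (e1 * w + e2 * A + e3 * D q)); first ring.
rewrite k1 dens_radius2.
have x0 : e0 * D q ^+ 2 = expR (qT q) * expR (- (3 * C / 20 * q ^+ 4)).
  by rewrite /e0 /margin -expRM_natr -!expRD; congr expR; rewrite /qT /logdens; field.
have x1 : X * e1 = expR (- b / 2) * expR (2 * qT q).
  by rewrite /X /e1 -!expRD; congr expR; rewrite /qT /logdens; field.
have x2 : X * e2 = expR (- b / 2) * expR (2 * qT q) * expR (- (g (2 * eta) * eta * q ^+ 1)).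
  rewrite /X /e2 -!expRD; congr expR; rewrite /qT /logdens.
  rewrite (_ : q ^+ 4 * (C / 2 + g (2 * eta) * (w * eta) - 2 * T (margin C q)) =
    q ^+ 4 * (C / 2 - 2 * T (margin C q)) + g (2 * eta) * eta * (q ^+ 4 * w)); last ring.
  by rewrite qw; field.
have x3 : X * e3 * D q = expR (- b / 2) * expR (2 * qT q) * expR (- (c * q ^+ 4)).
  by rewrite /X /e3 /margin -!expRD; congr expR; rewrite /c /qT /logdens /margin; field.
transitivity (4 * (q ^+ 4 * (e0 * D q ^+ 2)) +
  4 * ((X * e1) * (q ^+ 2 * w) + (X * e2) * A * q ^+ 2 + (X * e3 * D q) * q ^+ 2)); first ring.
rewrite x0 x1 x2 x3 qw2; ring.
Unshelve. all: by end_near. Qed.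

End asymptotics.

Section law.
Context d (Omega : measurableType d) (R : realType) (P : probability Omega R).
Variables (G : random_network P) (rho : R).
Hypothesis rho0 : 0 <= rho.
Hypothesis GP : poisson_on_square G rho.

Lemma num_isolatedE w :
  num_isolated G w = count (isolated_at G (nodes G w) w) (iota 0 (nodes G w)).
Proof.
rewrite /num_isolated cardE /enum_mem size_filter -val_enum_ord count_map enumT.
apply: eq_count => i /=; rewrite inE; apply/forallP/allP => [H j|H j].
  rewrite mem_iota add0n /= => jn; have := H (Ordinal jn).
  by rewrite -val_eqE /=; case: eqP.
have := H j; rewrite mem_iota add0n ltn_ord => /(_ isT).
by rewrite -val_eqE /=; case: eqP.
Qed.

Lemma num_isolated_setU (A : set (plane R)) w :
  num_isolated G w = (num_isolated_in G A w + num_isolated_in G (@unit_square R `\` A) w)%N.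
Proof.
rewrite num_isolatedE /num_isolated_in.
set a := isolated_at G (nodes G w) w.
rewrite [X in (_ + X)%N](@eq_in_count _ _ (fun i => a i && (pos G i w \notin A))).
  elim: (iota _ _) => //= i s ->.
  by case: (a i); case: (_ \in A); rewrite /= ?add0n ?add1n ?addSn ?addnS.
move=> i; rewrite mem_iota add0n /= => iw; congr (_ && _).
have Si := pos_in_square GP iw; apply/idP/idP => [/set_mem[_ nA]|nA].
  by apply/negP => /set_mem.
by apply/mem_set; split=> // Ai; move/negP : nA; apply; exact: mem_set.
Qed.

Lemma measurable_num_isolated_in (A : set (plane R)) (n : nat) : measurable A ->
  measurable [set w | num_isolated_in G A w = n].
Proof.
move=> mA; have mf := measurable_bin_isolated G mA 1.
rewrite (_ : [set _ | _] = (fun w => ('C(num_isolated_in G A w, 1))%:R%:E) @^-1` [set n%:R%:E : \bar R]).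
  by rewrite -[X in measurable X]setTI; apply: mf.
by apply/seteqP; split=> w /=; rewrite bin1; [move=> -> |case=> /eqP; rewrite eqr_nat => /eqP].
Qed.

(** The two counts differ only if some isolated node lies outside [A], and by the inequality of
    Markov this has probability at most the expected number of such nodes. *)
Lemma isolated_law_dist (A : set (plane R)) j e : measurable A ->
  (\int[P]_w ('C(num_isolated_in G (@unit_square R `\` A) w, 1))%:R%:E <= e%:E)%E ->
  `|fine (P [set w | num_isolated G w = j]) - fine (P [set w | num_isolated_in G A w = j])| <= e.
Proof.
move=> mA He; have mB : measurable (@unit_square R `\` A).
  by apply: measurableD => //; exact: measurable_unit_square.
set VB := num_isolated_in G _ in He *.
pose E := [set w | VB w <> 0%N].
have mE : measurable E.
  by apply: measurableC; exact: measurable_num_isolated_in.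
have mV : measurable [set w | num_isolated G w = j].
  rewrite (_ : [set _ | _] = isolated_rv G @^-1` [set j])//.
  exact: measurable_funPTI.
have mA' := measurable_num_isolated_in j mA.
have finP S : measurable S -> P S \is a fin_num by move=> mS; exact: fin_num_measure.
have PE : (P E <= e%:E)%E.
  apply: le_trans He; rewrite -[P E]/(P E) -(setIT E) -integral_indic//.
  apply: ge0_le_integral => //.
  - by apply/measurable_EFinP; exact: measurable_indic.
  - exact: measurable_bin_isolated.
  - move=> w _; rewrite lee_fin indicE bin1; case: (boolP (w \in E)) => // /set_mem Ew.
    by rewrite ler_nat lt0n; apply/eqP.
have sub S S' : measurable S -> measurable S' -> S `<=` S' `|` E -> fine (P S) <= fine (P S') + e.
  move=> mS mS' SS'; rewrite -lee_fin EFinD !fineK ?finP//.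
  apply: (@le_trans _ _ (P (S' `|` E))).
    by apply: le_measure; rewrite ?inE//; exact: measurableU.
  by apply: (le_trans (measureU2 _ _ _)) => //; exact: leeD2l.
have split w := num_isolated_setU A w.
rewrite ler_distl; apply/andP; split.
  rewrite lerBlDr; apply: sub => // w /= wj; have [w0|w0] := pselect (VB w = 0%N); last by right.
  by left; rewrite /= (split w) wj -/VB w0 addn0.
apply: sub => // w /= wj; have [w0|w0] := pselect (VB w = 0%N); last by right.
by left; rewrite /= -wj (split w) -/VB w0 addn0.
Qed.

End law.

Unset Implicit Arguments.
Set Strict Implicit.
Set Printing Implicit Defensive.

Theorem theorem4 (R : realType) (b C : R) (g : R -> R)
  (g01 : forall x : R, 0 <= x -> 0 <= g x <= 1)
  (g_noninc : forall x y : R, 0 <= x -> x <= y -> g y <= g x)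
  (C_def : (\int[lebesgue_measure \x lebesgue_measure]_x
              (g (eucl_norm x))%:E = C%:E)%E)
  (C_gt0 : 0 < C)
  (g_small : (g : R -> R^o) =o_ (pinfty_nbhs R)
              (fun x => (x ^+ 2 * ln x ^+ 2)^-1 : R^o))
  (d : R -> measure_display) (Omega : forall rho : R, measurableType (d rho))
  (P : forall rho : R, probability (Omega rho) R)
  (G : forall rho : R, random_network (P rho))
  (G_rcm : forall rho : R, 0 < rho -> 0 < ln rho + b ->
     random_connection_network rho
       (fun x => g (x / Num.sqrt ((ln rho + b) / (C * rho)))) (G rho)) :
  cvg_in_law +oo (fun rho => distribution (P rho) (isolated_rv (G rho)))
    (poisson_prob (expR (- b)) 0).
Proof.
(* For large [rho], the parametrised [dens] and [radius] at [q rho] are [rho] and the connection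
   range of the statement, so the limits in [q] carry over along [q_cvg]. *)
pose q (rho : R) := Num.sqrt (Num.sqrt ((ln rho + b) / C)).
have q4 rho : 0 < ln rho + b -> q rho ^+ 4 = (ln rho + b) / C.
  move=> L0; have LC : 0 <= (ln rho + b) / C by rewrite divr_ge0// ltW.
  by rewrite -[4%N]/(2 * 2)%N exprM /q !sqr_sqrtr// sqrtr_ge0.
have L_cvg M : \forall rho \near +oo, M <= ln rho + b.
  near=> rho; have : expR (M - b) <= rho by near: rho; exact: near_pinfty_ge.
  move=> Mrho; have rho0 : 0 < rho by apply: lt_le_trans Mrho; exact: expR_gt0.
  by rewrite -lerBlDr -ler_expR lnK.
have q_cvg : q rho @[rho --> +oo] --> +oo.
  apply/cvgryPge => A; near=> rho.
  have L1 : 1 <= ln rho + b by near: rho; exact: L_cvg.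
  have LA : C * Num.max A 0 ^+ 4 <= ln rho + b by near: rho; exact: L_cvg.
  apply: (@le_trans _ _ (Num.max A 0)); first by rewrite le_max lexx.
  have A0 : 0 <= Num.max A 0 by rewrite le_max lexx orbT.
  rewrite -(@ler_pXn2r _ 4)// ?nnegrE ?sqrtr_ge0// q4; last by lra.
  by rewrite ler_pdivlMr// mulrC.
pose good rho := 0 < rho /\ 0 < ln rho + b.
have near_good : \forall rho \near +oo, good rho.
  near=> rho; have r1 : 1 <= rho by near: rho; exact: near_pinfty_ge.
  have L1 : 1 <= ln rho + b by near: rho; exact: L_cvg.
  by split; lra.
have q0 rho : good rho -> 0 < q rho.
  by move=> [_ L0]; rewrite !sqrtr_gt0 divr_gt0.
have LE rho : good rho -> logdens C (q rho) = ln rho + b.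
  by move=> [_ L0]; rewrite /logdens q4// mulrC divfK// lt0r_neq0.
have densE rho : good rho -> dens b C (q rho) = rho.
  by move=> gr; rewrite /dens LE// addrK lnK//; exact: gr.1.
have radiusE rho : good rho -> Num.sqrt ((ln rho + b) / (C * rho)) = radius b C (q rho).
  move=> gr; have r0 := radius_gt0 b C (q0 _ gr); have [rho0 L0] := gr.
  rewrite -(ger0_norm (ltW r0)) -sqrtr_sqr; congr Num.sqrt.
  have := dens_radius2 b C (q rho); rewrite densE// q4// => h.
  apply: (mulfI (lt0r_neq0 rho0)); rewrite h; field.
  by rewrite !lt0r_neq0.
have rcm rho (gr : good rho) : poisson_on_square (G rho) rho /\
    connects_with (G rho) (fun x => g (x / radius b C (q rho))).
  by rewrite -radiusE//; exact: G_rcm gr.1 gr.2.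
pose r rho := radius b C (q rho).
pose D rho := margin C (q rho).
pose I rho := interior (r rho) (D rho).
pose M rho k := fine (moment (@square_unif R) rho (isolation g (r rho) (D rho) rho) k).
have M_cvg k : M rho k @[rho --> +oo] --> expR (- b) ^+ k.
  have := cvg_comp _ _ q_cvg (@moment_cvg R g b C g01 g_noninc C_def C_gt0 g_small k).
  apply: cvg_trans; apply: near_eq_cvg; near=> rho.
  have gr : good rho by near: rho.
  by rewrite /M /= densE.
have rD : \forall rho \near +oo, r rho * D rho < 2^-1.
  exact: q_cvg (radius_margin_lt b C_gt0).
have in_law j : fine (P rho [set w | num_isolated_in (G rho) (I rho) w = j]) @[rho --> +oo] -->
    poisson_weight (expR (- b)) j.
  apply: (@poisson_limit_pmf R R +oo _ (expR (- b))
    (fun rho i => fine (P rho [set w | num_isolated_in (G rho) (I rho) w = i]))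
    (fun rho k => M rho k / k`!%:R)).
    move=> i n; near=> rho; have gr : good rho by near: rho.
    have r0 : 0 < r rho := radius_gt0 b C (q0 _ gr).
    have mI : measurable (I rho) by exact: measurable_interior.
    have [GP GC] := rcm _ gr.
    apply: (moment_bonferroni (a := fun k => M rho k / k`!%:R)).
    - by move=> m; exact: measurable_num_isolated_in.
    - by move=> k; exact: measurable_bin_isolated.
    move=> k; apply: (eq_trans (factorial_moment (ltW gr.1) GP (scaled01 g01 r0)
      (measurable_scaled g_noninc r0) GC mI k)).
    have rho0 := ltW gr.1.
    have rk : (0 <= (rho ^+ k)%:E)%E by rewrite lee_fin exprn_ge0.
    have ME : ((M rho k)%:E = (rho ^+ k)%:E *
        iint (@square_unif R) k (fun u => (isolation g (r rho) (D rho) rho u)%:E))%E.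
      rewrite /M fineK; last exact: (moment_fin_num g01 g_noninc (D rho) r0 (esym (densE _ gr))).
      rewrite /moment -iintZl//.
      - move=> ? Z fs; apply/measurable_EFinP.
        exact: (smeas_isolation g01 g_noninc (D rho) rho r0).
      - by move=> u; rewrite lee_fin isolation_ge0.
    rewrite [RHS]EFinM ME [RHS]muleAC EFinM -!muleA; congr (_ * _)%E.
  move=> k; rewrite mulrC; under eq_fun do rewrite mulrC.
  exact: cvg_mull.
have dist_cvg j : fine (P rho [set w | num_isolated (G rho) w = j]) @[rho --> +oo] -->
    poisson_weight (expR (- b)) j.
  have [w [eta [A [wA bb]]]] := @boundary_cvg0 R g b C g01 g_noninc C_def C_gt0 g_small.
  pose e rho := dens b C (q rho) * boundary_bound g C (radius b C (q rho)) (margin C (q rho))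
    (dens b C (q rho)) (w (q rho)) (eta (q rho)) (A (q rho)).
  have e0 : e rho @[rho --> +oo] --> (0 : R) by exact: cvg_comp _ _ q_cvg bb.
  have wAq := q_cvg _ wA.
  pose pV rho := fine (P rho [set w | num_isolated (G rho) w = j]).
  pose pI rho := fine (P rho [set w | num_isolated_in (G rho) (I rho) w = j]).
  (* The first factorial moment over the border is the expected number of isolated nodes there;
     [boundary_le] bounds it by [e rho], and [isolated_law_dist] passes from the interior count to
     the full one. *)
  have d0 : pV rho - pI rho @[rho --> +oo] --> (0 : R).
    have e0N : - e rho @[rho --> +oo] --> (0 : R) by rewrite -(oppr0 R); exact: cvgN.
    apply: (squeeze_cvgr _ e0N e0); near=> rho; rewrite -ler_norml.
    have gr : good rho by near: rho.
    have rho0 := ltW gr.1.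
    have r0 : 0 < r rho := radius_gt0 b C (q0 _ gr).
    have mI : measurable (I rho) by exact: measurable_interior.
    have mB : measurable (@unit_square R `\` I rho).
      by apply: measurableD => //; exact: measurable_unit_square.
    have [GP GC] := rcm _ gr.
    have [w0 weta A0] : [/\ 0 <= w (q rho), w (q rho) <= eta (q rho) & 0 <= A (q rho)].
      by near: rho.
    have rDr : r rho * D rho < 2^-1 by near: rho.
    apply: (isolated_law_dist GP j mI).
    have le_eq (x y z : \bar R) : x = y -> (y <= z)%E -> (x <= z)%E by move=> ->.
    apply: (le_eq _ _ _ (factorial_moment rho0 GP (scaled01 g01 r0)
      (measurable_scaled g_noninc r0) GC mB 1)).
    rewrite expr1 divr1 /e densE// EFinM; apply: lee_wpmul2l; first by rewrite lee_fin.
    have := boundary_le g01 g_noninc C_def r0 rho0 (expR_ge0 _) rDr w0 weta A0.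
    apply: le_trans; rewrite le_eqVlt; apply/orP; left; apply/eqP => /=.
    by apply: eq_integral => x _; rewrite andbT.
  have := cvg_add (in_law j) d0; rewrite addr0; apply: cvg_ext => rho.
  by rewrite /pV /pI; ring.
apply: cvg_in_law_pmf => j.
have E : poisson_prob (expR (- b)) 0 [set j] = (poisson_weight (expR (- b)) j)%:E.
  rewrite /poisson_prob expR_gt0 esum_set1; last by rewrite lee_fin poisson_pmf_ge0.
  by rewrite /poisson_pmf expR_gt0 /poisson_weight; congr EFin; ring.
rewrite [X in _ --> X](_ : _ = poisson_weight (expR (- b)) j); first exact: dist_cvg.
exact: (congr1 fine E).
Unshelve. all: by end_near. Qed.
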